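(* Fix any $1\leqslant q<\infty$, any ordinal $\xi$, and any operators $A_i:X_i\to Y_i$, $i=0,1$, between Banach spaces, and let $A_0\otimes A_1:X_0\hat\otimes_\varepsilon X_1\to Y_0\hat\otimes_\varepsilon Y_1$ be the induced operator between injective tensor products. If $A_0$ and $A_1$ have $\xi$-$q$-summable Szlenk index, then so does $A_0\otimes A_1$. Also, $\mathbf{p}_\xi(A_0\otimes A_1)\leqslant\max\{\mathbf{p}_\xi(A_0),\mathbf{p}_\xi(A_1)\}$. If $A_0,A_1\neq0$, then $A_0\otimes A_1$ has $\xi$-$q$-summable Szlenk index if and only if $A_0$ and $A_1$ both do, and $\mathbf{p}_\xi(A_0\otimes A_1)=\max\{\mathbf{p}_\xi(A_0),\mathbf{p}_\xi(A_1)\}$.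
   Context: $\mathbb{N}=\{1,2,\ldots\}$; operators are bounded and linear; $B_X$ is the closed unit ball of $X$. Injective tensor product. $X\hat\otimes_\varepsilon Y$ is the norm closed span in the space of operators from $Y^*$ to $X$ of the operators $x\otimes y:Y^*\to X$, $(x\otimes y)(y^* )=y^*(y)x$. For $A_i:X_i\to Y_i$, $A_0\otimes A_1$ is given by $(A_0\otimes A_1)(u)=A_0uA_1^*:Y_1^*\to Y_0$. Szlenk index. For a weak$^*$-compact $K\subset X^*$ and $\varepsilon>0$, $s_\varepsilon(K)$ is the set of $x^*\in K$ such that $\mathrm{diam}(V\cap K)>\varepsilon$ (norm diameter) for every weak$^*$-neighborhood $V$ of $x^*$; $s^0_\varepsilon(K)=K$, $s^{\xi+1}_\varepsilon(K)=s_\varepsilon(s^\xi_\varepsilon(K))$, $s^\xi_\varepsilon(K)=\bigcap_{\zeta<\xi}s^\zeta_\varepsilon(K)$ for limit $\xi$; $s^\xi_\varepsilon(K)=K$ if $\varepsilon\leqslant0$. $Sz(K,\varepsilon)$ is the least $\xi$ with $s^\xi_\varepsilon(K)=\varnothing$ ($\infty$ if none exists), and $Sz(K)=\sup_{\varepsilon>0}Sz(K,\varepsilon)$. For $1\leqslant q<\infty$, $K$ has $\xi$-$q$-summable Szlenk index if there is $M\geqslant0$ such that whenever $\varepsilon_1,\ldots,\varepsilon_n\geqslant0$ and $s^{\omega^\xi}_{\varepsilon_1}\cdots s^{\omega^\xi}_{\varepsilon_n}(K)\neq\varnothing$, $\sum_{i=1}^n\varepsilon_i^q\leqslant M^q$.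 If $Sz(K)\leqslant\omega^{\xi+1}$, let $Sz_\xi(K,\varepsilon)$ be the smallest $n\in\mathbb{N}$ with $Sz(K,\varepsilon)\leqslant\omega^\xi n$ (it exists by compactness) and $\mathbf{p}_\xi(K)=\limsup_{\varepsilon\to0^+}\frac{\log Sz_\xi(K,\varepsilon)}{|\log\varepsilon|}\in[0,\infty]$; if $Sz(K)>\omega^{\xi+1}$, $\mathbf{p}_\xi(K)=\infty$. For an operator $A:X\to Y$, $A$ has $\xi$-$q$-summable Szlenk index if $A^*B_{Y^*}$ does, and $\mathbf{p}_\xi(A)=\mathbf{p}_\xi(A^*B_{Y^*})$. *)

(* Defs.v *)
From HB Require Import structures.
From mathcomp Require Import all_boot all_order all_algebra.
From mathcomp Require Import complex.
From mathcomp Require Import all_classical all_reals all_analysis.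

Set Implicit Arguments.
Unset Strict Implicit.
Unset Printing Implicit Defensive.

Import Order.TTheory GRing.Theory Num.Theory.
Import numFieldNormedType.Exports.

Local Open Scope classical_set_scope.
Local Open Scope ring_scope.

(* Ordinals, up to the equivalence [ole a b /\ ole b a].  [osup f] denotes the
   supremum of an arbitrary family (possibly empty, possibly with a maximum),
   so it covers limits and every small ordinal is denoted by some term.
   All the functions of ordinals below respect the equivalence. *)
Inductive ord : Type :=
| ozero : ord
| osucc : ord -> ord
| osup : forall I : Type, (I -> ord) -> ord.

(* The inner fixpoint is the strict order [a < b]. *)
Fixpoint ole (a : ord) : ord -> Prop :=
  match a with
  | ozero => fun=> True
  | osucc a' => fix lt (b : ord) : Prop :=
      match b with
      | ozero => False
      | osucc b' => ole a' b'
      | osup _ g => exists i, lt (g i)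
      end
  | osup _ f => fun b => forall i, ole (f i) b
  end.

Definition olt (a b : ord) : Prop := ole (osucc a) b.

Section ord_order.

Lemma ole_sup_r I (g : I -> ord) i a : ole a (g i) -> ole a (osup g).
Proof.
elim: a => [//|a _ /=|J f IH /= H j]; first by exists i.
by apply: IH; exact: H.
Qed.

Lemma ole_refl a : ole a a.
Proof. by elim: a => [//|//|I f IH /= i]; apply: ole_sup_r (IH i). Qed.

Lemma ole_trans b a c : ole a b -> ole b c -> ole a c.
Proof.
elim: a b c => [//|a IHa|I f IH] b c; last first.
  by move=> H bc i; exact: IH (H i) bc.
elim: b c => [//|b _|I g IHb] c.
  move=> /= ab; elim: c => [//|c _ /= bc|J h IHc /=]; first exact: IHa bc.
  by case=> j /IHc hj; exists j.
by move=> /= [i ai] H; exact: IHb ai (H i).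
Qed.

Lemma oltW a b : olt a b -> ole a b.
Proof.
rewrite /olt; elim: b a => [//|b IH|I g IH] a; last first.
  by move=> [i /IH]; exact: ole_sup_r.
move=> /= ab; apply: ole_trans ab _; elim: b {IH} => [//|b IH|I f IH] /=.
  exact: IH.
by move=> i; apply: ole_trans (IH i) _ => /=; apply: ole_sup_r (ole_refl _).
Qed.

Lemma ole_total a b : ole a b \/ olt b a.
Proof.
elim: a b => [|a IH|I f IH] b; first by left.
  elim: b => [|b _|J g IHb].
  - by right.
  - by case: (IH b) => [|h]; [left | right].
  - have [[j h]|nh] := pselect (exists j, ole (osucc a) (g j)).
      by left; exists j.
    right => /= j; have [h|//] := IHb j.
    by case: nh; exists j.
have [[i h]|nh] := pselect (exists i, olt b (f i)).
  by right; exists i.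
left => i; have [//|h] := IH i b.
by case: nh; exists i.
Qed.

Lemma ord_least (P : ord -> Prop) :
  (exists a, P a) -> exists a, P a /\ forall b, P b -> ole a b.
Proof.
suff H a : forall b, ole b a -> P b ->
    exists a, P a /\ forall b, P b -> ole a b.
  by case=> a; exact: H (ole_refl a).
elim: a => [|a IH|I f IH] b.
- move=> b0 Pb; exists b; split=> // c _; exact: ole_trans b0 _.
- move=> ba Pb.
  have [[c [Pc ca]]|nh] := pselect (exists c, P c /\ ole c a).
    exact: IH ca Pc.
  exists b; split=> // c Pc; apply: ole_trans ba _.
  by have [ca|//] := ole_total c a; case: nh; exists c.
- move=> bf Pb.
  have [[c [Pc [i ci]]]|nh] := pselect (exists c, P c /\ exists i, ole c (f i)).
    exact: IH ci Pc.
  exists b; split=> // c Pc; apply: ole_trans bf _ => /= i.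
  have [ci|/oltW//] := ole_total c (f i).
  by case: nh; exists c; split=> //; exists i.
Qed.

End ord_order.

Fixpoint oadd (a b : ord) : ord :=
  match b with
  | ozero => a
  | osucc b' => osucc (oadd a b')
  | osup T f => osup (fun o : option T => if o is Some i then oadd a (f i) else a)
  end.

Fixpoint omuln (a : ord) (n : nat) : ord :=
  if n is n'.+1 then oadd (omuln a n') a else ozero.

(* omega ^ a; the index [None] makes the power of an empty supremum equal 1. *)
Fixpoint oexpw (a : ord) : ord :=
  match a with
  | ozero => osucc ozero
  | osucc a' => osup (fun n : nat => omuln (oexpw a') n)
  | osup T f => osup (fun o : option T =>
                        if o is Some i then oexpw (f i) else osucc ozero)
  end.

(* Ordinals extended with a largest element, [None]. *)
Definition xord : Type := option ord.

Definition xole (a b : xord) : Prop :=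
  match a, b with
  | _, None => True
  | None, Some _ => False
  | Some a', Some b' => ole a' b'
  end.

Definition xosup (I : Type) (f : I -> xord) : xord :=
  if `[< exists i, f i = None >] then None
  else Some (osup (fun i => odflt ozero (f i))).

(* The Banach spaces are real or complex. *)
Inductive scalars := RealScalars | ComplexScalars.

Definition scalar_field (R : realType) (k : scalars) : numFieldType :=
  match k with
  | RealScalars => R
  | ComplexScalars => R[i]
  end.

Section scalar_theory.
Variables (R : realType) (k : scalars).
Local Notation K := (scalar_field R k).

Definition scalar_Re : K -> R :=
  match k return scalar_field R k -> R with
  | RealScalars => id
  | ComplexScalars => @complex.Re R
  end.

Definition scalar_of : R -> K :=
  match k return R -> scalar_field R k with
  | RealScalars => id
  | ComplexScalars => @real_complex R
  end.

Lemma scalar_ofK : cancel scalar_of scalar_Re.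
Proof. by rewrite /scalar_of /scalar_Re; case: k. Qed.

Lemma scalar_ReK (x : K) : 0 <= x -> scalar_of (scalar_Re x) = x.
Proof.
rewrite /scalar_of /scalar_Re; case: k x => //= x x0.
exact: RRe_real (ger0_real x0).
Qed.

Lemma scalar_ofD (a b : R) : scalar_of (a + b) = scalar_of a + scalar_of b.
Proof. by rewrite /scalar_of; case: k => //=; rewrite raddfD. Qed.

Lemma scalar_ofM (a b : R) : scalar_of (a * b) = scalar_of a * scalar_of b.
Proof. by rewrite /scalar_of; case: k => //=; rewrite rmorphM. Qed.

Lemma scalar_of1 : scalar_of 1 = 1.
Proof. by rewrite /scalar_of; case: k => //=; rewrite rmorph1. Qed.

Lemma scalar_of0 : scalar_of 0 = 0.
Proof. by rewrite /scalar_of; case: k => //=; rewrite rmorph0. Qed.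

Lemma ler_scalar_of (a b : R) : (scalar_of a <= scalar_of b) = (a <= b).
Proof. by rewrite /scalar_of; case: k => //=; rewrite lecR. Qed.

Lemma ltr_scalar_of (a b : R) : (scalar_of a < scalar_of b) = (a < b).
Proof. by rewrite /scalar_of; case: k => //=; rewrite ltcR. Qed.

(* The norm of a normed K-space is K-valued in MathComp-Analysis; this is its
   value as a real number. *)
Definition rnorm (V : normedModType K) (x : V) : R := scalar_Re `|x|.

Lemma rnormE (V : normedModType K) (x : V) : `|x| = scalar_of (rnorm x).
Proof. by rewrite /rnorm scalar_ReK. Qed.

Lemma rnorm_ge0 (V : normedModType K) (x : V) : 0 <= rnorm x.
Proof. by rewrite -ler_scalar_of -rnormE scalar_of0. Qed.

Lemma rnormD (V : normedModType K) (x y : V) :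
  rnorm (x + y) <= rnorm x + rnorm y.
Proof. by rewrite -ler_scalar_of scalar_ofD -!rnormE ler_normD. Qed.

Lemma rnormZ (V : normedModType K) (a : K) (x : V) :
  rnorm (a *: x) = rnorm (a : K^o) * rnorm x.
Proof.
by apply: (can_inj scalar_ofK); rewrite scalar_ofM -!rnormE normrZ.
Qed.

Lemma rnorm0 (V : normedModType K) : rnorm (0 : V) = 0.
Proof. by apply: (can_inj scalar_ofK); rewrite -rnormE normr0 scalar_of0. Qed.

Lemma rnorm_eq0 (V : normedModType K) (x : V) : rnorm x = 0 -> x = 0.
Proof. by move=> x0; apply: normr0_eq0; rewrite rnormE x0 scalar_of0. Qed.

Lemma rnorm_scalar (a : R) : 0 <= a -> rnorm (scalar_of a : K^o) = a.
Proof.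
move=> a0; apply: (can_inj scalar_ofK); rewrite -rnormE.
by rewrite [LHS]ger0_norm // -scalar_of0 ler_scalar_of.
Qed.

End scalar_theory.

Section bounded_operators.
Variables (R : realType) (k : scalars).
Local Notation K := (scalar_field R k).
Variables (X Y : normedModType K).

Definition bounded_op : pred (X -> Y) := fun f =>
  `[< linear f /\ exists M : R, forall x, rnorm (f x) <= M * rnorm x >].

Lemma bounded_op_submod : submod_closed bounded_op.
Proof.
split.
  apply/asboolP; split; first by move=> a x y /=; rewrite /= scaler0 addr0.
  by exists 0 => x; rewrite mul0r rnorm0.
move=> a f g /asboolP[lf [M fM]] /asboolP[lg [N gN]]; apply/asboolP; split.
  move=> c x y; rewrite !fctE /= lf lg !scalerDr !scalerA mulrC.
  by rewrite addrACA.
exists (rnorm (a : K^o) * M + N) => x; rewrite !fctE /=.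
apply: le_trans (rnormD _ _) _; rewrite mulrDl lerD // rnormZ -mulrA.
by rewrite ler_wpM2l // rnorm_ge0.
Qed.

HB.instance Definition _ :=
  GRing.isSubmodClosed.Build K (X -> Y) bounded_op bounded_op_submod.

Record bop := Bop { bop_val :> X -> Y; bop_valP : bop_val \in bounded_op }.

HB.instance Definition _ := [isSub for bop_val].
HB.instance Definition _ := [Choice of bop by <:].
HB.instance Definition _ := [SubChoice_isSubLmodule of bop by <:].

Definition opnorm (f : bop) : R :=
  sup [set rnorm (f x) | x in [set x : X | rnorm x <= 1]].

Lemma bop_linear (f : bop) : linear f.
Proof. by case: f => f /= /asboolP[]. Qed.

Lemma bop_bounded (f : bop) : exists M : R, forall x, rnorm (f x) <= M * rnorm x.
Proof. by case: f => f /= /asboolP[]. Qed.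

HB.instance Definition _ (f : bop) :=
  GRing.isLinear.Build K X Y *:%R (bop_val f) (@bop_linear f).

Lemma opnorm_has_sup (f : bop) :
  has_sup [set rnorm (f x) | x in [set x : X | rnorm x <= 1]].
Proof.
split; first by exists (rnorm (f 0)); exists 0 => //=; rewrite rnorm0.
have [M fM] := bop_bounded f; exists `|M| => _ [x /= x1 <-].
apply: le_trans (fM x) _; apply: le_trans (_ : `|M| * rnorm x <= _).
  by rewrite ler_wpM2r ?rnorm_ge0 // ler_norm.
by rewrite ler_piMr.
Qed.

Lemma ler_opnorm_ball (f : bop) (x : X) : rnorm x <= 1 -> rnorm (f x) <= opnorm f.
Proof.
by move=> x1; apply: ub_le_sup; [case: (opnorm_has_sup f)|exists x].
Qed.

Lemma opnorm_le (f : bop) (M : R) :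
  (forall x, rnorm x <= 1 -> rnorm (f x) <= M) -> opnorm f <= M.
Proof.
move=> fM; apply: ge_sup; first by case: (opnorm_has_sup f).
by move=> _ [x /= x1 <-]; exact: fM.
Qed.

Lemma opnorm_ge0 (f : bop) : 0 <= opnorm f.
Proof.
apply: le_trans (rnorm_ge0 (f 0)) _.
by apply: ler_opnorm_ball; rewrite rnorm0.
Qed.

Lemma ler_opnorm (f : bop) (x : X) : rnorm (f x) <= opnorm f * rnorm x.
Proof.
have [x0|x0] := eqVneq (rnorm x) 0.
  by rewrite (rnorm_eq0 x0) linear0 !rnorm0 mulr0.
have xp : 0 < rnorm x by rewrite lt0r x0 rnorm_ge0.
have := @ler_opnorm_ball f (scalar_of k (rnorm x)^-1 *: x).
rewrite linearZ !rnormZ /= rnorm_scalar ?invr_ge0 ?rnorm_ge0 // mulVf //.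
by move=> /(_ (lexx _)); rewrite mulrC ler_pdivrMr.
Qed.

Lemma opnormD (f g : bop) : opnorm (f + g) <= opnorm f + opnorm g.
Proof.
apply: opnorm_le => x x1; apply: le_trans (rnormD _ _) _.
by rewrite lerD // ler_opnorm_ball.
Qed.

Lemma opnormZ (a : K) (f : bop) :
  opnorm (a *: f) = rnorm (a : K^o) * opnorm f.
Proof.
have le_opnormZ b g : opnorm (b *: g) <= rnorm (b : K^o) * opnorm g.
  apply: opnorm_le => x x1; rewrite [X in rnorm X]/(b *: g x) rnormZ.
  by rewrite ler_wpM2l ?rnorm_ge0 // ler_opnorm_ball.
have [->|a0] := eqVneq a 0.
  apply/eqP; rewrite eq_le le_opnormZ /=.
  by rewrite [rnorm _]rnorm0 mul0r opnorm_ge0.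
apply/eqP; rewrite eq_le le_opnormZ /=.
have := le_opnormZ a^-1 (a *: f); rewrite scalerA mulVf // scale1r.
move=> /(ler_wpM2l (rnorm_ge0 (a : K^o))) /le_trans; apply.
rewrite mulrA -rnormZ [_ *: _]divff //.
by rewrite -{1}(scalar_of1 R k) rnorm_scalar // mul1r.
Qed.

Lemma opnorm_eq0 (f : bop) : opnorm f = 0 -> f = 0.
Proof.
move=> f0; apply/val_inj/funext => x; apply: rnorm_eq0; apply: le_anti.
by rewrite rnorm_ge0 andbT -[X in _ <= X](mul0r (rnorm x)) -f0 ler_opnorm.
Qed.

Let norm (f : bop) : K := scalar_of k (opnorm f).

Let ler_norm_bopD f g : norm (f + g) <= norm f + norm g.
Proof. by rewrite -scalar_ofD ler_scalar_of opnormD. Qed.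

Let norm_bopZ (a : K) f : norm (a *: f) = `|a| * norm f.
Proof. by rewrite /norm opnormZ scalar_ofM -rnormE. Qed.

Let norm_bop_eq0 f : norm f = 0 -> f = 0.
Proof.
rewrite /norm -(scalar_of0 R k) => /(can_inj (@scalar_ofK _ _)).
exact: opnorm_eq0.
Qed.

HB.instance Definition _ :=
  Lmodule_isNormed.Build K bop ler_norm_bopD norm_bopZ norm_bop_eq0.

Lemma rnorm_bop (f : bop) : rnorm f = opnorm f.
Proof. by rewrite /rnorm [`|f|]/(norm f) scalar_ofK. Qed.

End bounded_operators.

Arguments bop {R k} X Y.

Section composition.
Variables (R : realType) (k : scalars).
Local Notation K := (scalar_field R k).

Lemma bop_comp_subproof (X Y Z : normedModType K) (g : bop Y Z) (f : bop X Y) :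
  g \o f \in @bounded_op R k X Z.
Proof.
apply/asboolP; split=> [a x y /=|]; first by rewrite !linearP.
exists (opnorm g * opnorm f) => x /=; apply: le_trans (ler_opnorm _ _) _.
by rewrite -mulrA ler_wpM2l ?opnorm_ge0 // ler_opnorm.
Qed.

Definition bop_comp (X Y Z : normedModType K) (g : bop Y Z) (f : bop X Y) :
  bop X Z := Bop (bop_comp_subproof g f).

Definition dual_space (X : normedModType K) := bop X K^o.

Lemma adjoint_subproof (X Y : normedModType K) (A : bop X Y) :
  (fun f : dual_space Y => bop_comp f A : dual_space X)
    \in @bounded_op R k (dual_space Y) (dual_space X).
Proof.
apply/asboolP; split=> [a f g|]; first exact/val_inj.
exists (opnorm A) => f; rewrite !rnorm_bop; apply: opnorm_le => x x1 /=.
apply: le_trans (ler_opnorm _ _) _; rewrite mulrC.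
by rewrite ler_wpM2r ?opnorm_ge0 // ler_opnorm_ball.
Qed.

Definition adjoint (X Y : normedModType K) (A : bop X Y) :
  bop (dual_space Y) (dual_space X) := Bop (adjoint_subproof A).

End composition.

Section injective_tensor_product.
Variables (R : realType) (k : scalars).
Local Notation K := (scalar_field R k).
Variables (X Y : normedModType K).

Lemma tens_subproof (x : X) (y : Y) :
  (fun f : dual_space Y => (f y : K) *: x) \in @bounded_op R k (dual_space Y) X.
Proof.
apply/asboolP; split=> [a f g|]; first by rewrite scalerDl -scalerA.
exists (rnorm y * rnorm x) => f; rewrite rnormZ rnorm_bop mulrAC.
by rewrite ler_wpM2r ?rnorm_ge0 // mulrC ler_opnorm.
Qed.

Definition tens (x : X) (y : Y) : bop (dual_space Y) X := Bop (tens_subproof x y).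

Definition tens_span : set (bop (dual_space Y) X) :=
  [set u | exists s : seq (K * (X * Y)),
     u = \sum_(p <- s) p.1 *: tens p.2.1 p.2.2].

Definition in_injtens : pred (bop (dual_space Y) X) :=
  fun u => `[< closure tens_span u >].

Lemma in_injtensP (u : bop (dual_space Y) X) :
  reflect (forall e : R, 0 < e -> exists2 v, tens_span v & rnorm (u - v) < e)
          (in_injtens u).
Proof.
apply: (iffP (asboolP _)) => [cu e e0|cu B].
  have e0' : 0 < scalar_of k e by rewrite -(scalar_of0 R k) ltr_scalar_of.
  have [v [sv]] := cu _ (nbhsx_ballx u _ e0').
  by rewrite -ball_normE /ball_ /= rnormE ltr_scalar_of => uv; exists v.
move=> /nbhs_ballP[e /= e0 eB].
have e0' : 0 < scalar_Re e.
  by rewrite -(ltr_scalar_of k) scalar_ReK ?ltW // scalar_of0.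
have [v sv uv] := cu _ e0'; exists v; split=> //; apply: eB.
by rewrite -ball_normE /ball_ /= rnormE -(scalar_ReK (ltW e0)) ltr_scalar_of.
Qed.

Lemma tens_span_submod a u v : tens_span u -> tens_span v -> tens_span (a *: u + v).
Proof.
move=> [s ->] [t ->]; exists ([seq (a * p.1, p.2) | p <- s] ++ t).
rewrite big_cat big_map /= scaler_sumr; congr (_ + _).
by apply: eq_bigr => p _; rewrite scalerA.
Qed.

Lemma in_injtens_submod : submod_closed in_injtens.
Proof.
split.
  apply/in_injtensP => e e0; exists 0; last by rewrite subr0 rnorm0.
  by exists [::]; rewrite big_nil.
move=> a u v /in_injtensP cu /in_injtensP cv; apply/in_injtensP => e e0.
have d0 : 0 < rnorm (a : K^o) + 1 by rewrite ltr_wpDl // rnorm_ge0.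
have [u' su uu'] := cu (e / 2 / (rnorm (a : K^o) + 1)) ltac:(by rewrite !divr_gt0).
have [v' sv vv'] := cv (e / 2) ltac:(by rewrite divr_gt0).
exists (a *: u' + v'); first exact: tens_span_submod.
rewrite opprD addrACA -scalerBr; apply: le_lt_trans (rnormD _ _) _.
rewrite [X in _ < X](splitr e) ler_ltD // rnormZ.
rewrite ltr_pdivlMr // mulrC in uu'; apply: le_trans (ltW uu').
by rewrite ler_wpM2r ?rnorm_ge0 // lerDl.
Qed.

HB.instance Definition _ := GRing.isSubmodClosed.Build K (bop (dual_space Y) X)
  in_injtens in_injtens_submod.

Record injtens := Injtens {
  injtens_val :> bop (dual_space Y) X;
  injtens_valP : injtens_val \in in_injtens }.

HB.instance Definition _ := [isSub for injtens_val].
HB.instance Definition _ := [Choice of injtens by <:].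
HB.instance Definition _ := [SubChoice_isSubLmodule of injtens by <:].

Let norm (u : injtens) : K := `|injtens_val u|.

Let ler_norm_injtensD u v : norm (u + v) <= norm u + norm v.
Proof. exact: ler_normD. Qed.

Let norm_injtensZ (a : K) u : norm (a *: u) = `|a| * norm u.
Proof. exact: normrZ. Qed.

Let norm_injtens_eq0 u : norm u = 0 -> u = 0.
Proof. by move=> /normr0_eq0 u0; apply: val_inj. Qed.

HB.instance Definition _ := Lmodule_isNormed.Build K injtens
  ler_norm_injtensD norm_injtensZ norm_injtens_eq0.

Lemma rnorm_injtens (u : injtens) : rnorm u = opnorm (injtens_val u).
Proof. by rewrite -rnorm_bop. Qed.

End injective_tensor_product.

Arguments injtens {R k} X Y.

Section tensor_operator.
Variables (R : realType) (k : scalars).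
Local Notation K := (scalar_field R k).
Variables (X0 X1 Y0 Y1 : normedModType K) (A0 : bop X0 Y0) (A1 : bop X1 Y1).

Definition tensop_val (u : bop (dual_space X1) X0) : bop (dual_space Y1) Y0 :=
  bop_comp A0 (bop_comp u (adjoint A1)).

Lemma tensop_val_linear : linear tensop_val.
Proof. by move=> a u v; apply/val_inj/funext => f /=; rewrite linearP. Qed.

HB.instance Definition _ := GRing.isLinear.Build K _ _ *:%R tensop_val
  tensop_val_linear.

Lemma opnorm_tensop_val u :
  opnorm (tensop_val u) <= opnorm A0 * opnorm A1 * opnorm u.
Proof.
apply: opnorm_le => f f1 /=; apply: le_trans (ler_opnorm _ _) _.
rewrite -mulrA ler_wpM2l ?opnorm_ge0 //; apply: le_trans (ler_opnorm _ _) _.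
rewrite mulrC ler_wpM2r ?opnorm_ge0 // rnorm_bop; apply: opnorm_le => x x1 /=.
apply: le_trans (ler_opnorm _ _) _; rewrite -[X in _ <= X]mul1r.
by rewrite ler_pM ?opnorm_ge0 ?rnorm_ge0 ?ler_opnorm_ball // -rnorm_bop.
Qed.

Lemma tensop_val_tens x y : tensop_val (tens x y) = tens (A0 x) (A1 y).
Proof. by apply/val_inj/funext => f /=; rewrite linearZ. Qed.

Lemma tensop_val_in (u : injtens X0 X1) : tensop_val u \in @in_injtens R k Y0 Y1.
Proof.
apply/in_injtensP => e e0; have /in_injtensP cu := injtens_valP u.
pose d := opnorm A0 * opnorm A1 + 1.
have d0 : 0 < d by rewrite ltr_wpDl // mulr_ge0 ?opnorm_ge0.
have [v [s ->] uv] := cu (e / d) ltac:(by rewrite divr_gt0).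
exists (tensop_val (\sum_(p <- s) p.1 *: tens p.2.1 p.2.2)).
  exists [seq (p.1, (A0 p.2.1, A1 p.2.2)) | p <- s].
  rewrite big_map linear_sum; apply: eq_bigr => p _ /=.
  by rewrite linearZ /= tensop_val_tens.
rewrite -linearB rnorm_bop; apply: le_lt_trans (opnorm_tensop_val _) _.
rewrite ltr_pdivlMr // mulrC rnorm_bop in uv; apply: le_lt_trans uv.
by rewrite ler_wpM2r ?opnorm_ge0 // lerDl.
Qed.

Lemma tensop_subproof :
  (fun u : injtens X0 X1 => Injtens (tensop_val_in u))
    \in @bounded_op R k (injtens X0 X1) (injtens Y0 Y1).
Proof.
apply/asboolP; split=> [a u v|].
  by apply: val_inj; exact: tensop_val_linear.
exists (opnorm A0 * opnorm A1) => u; rewrite !rnorm_injtens.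
exact: opnorm_tensop_val.
Qed.

Definition tensop : bop (injtens X0 X1) (injtens Y0 Y1) := Bop tensop_subproof.

End tensor_operator.

Section szlenk.
Variables (R : realType) (k : scalars).
Local Notation K := (scalar_field R k).
Variable X : normedModType K.
Implicit Types (L V : set (dual_space X)) (e q : R) (xi : ord).

Definition weakstar : topologicalType :=
  initial_topology (fun f : dual_space X => (f : {ptws X -> K^o})).

Definition diam L : \bar R :=
  ereal_sup [set (rnorm (p.1 - p.2))%:E | p in L `*` L].

Definition szlenk_der e L : set (dual_space X) :=
  [set f | L f /\ forall V, nbhs (f : weakstar) V -> (e%:E < diam (V `&` L))%E].

(* The iterates of [szlenk_der e] for 0 < e.  They decrease with [xi], so the
   iterate at a supremum is the intersection of the iterates at its members;
   [L] is added for the empty family, whose supremum is 0. *)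
Fixpoint szlenk_iter e xi L : set (dual_space X) :=
  match xi with
  | ozero => L
  | osucc z => szlenk_der e (szlenk_iter e z L)
  | osup _ z => L `&` \bigcap_i szlenk_iter e (z i) L
  end.

Definition szlenk e xi L : set (dual_space X) :=
  if e <= 0 then L else szlenk_iter e xi L.

Definition Sz_eps L e : xord :=
  if pselect (exists xi, szlenk e xi L = set0) is left h
  then Some (sval (cid (ord_least h))) else None.

Definition Sz L : xord := xosup (fun e : {e : R | 0 < e} => Sz_eps L (sval e)).

Definition q_summable xi q L : Prop :=
  exists M : R, 0 <= M /\
    forall s : seq R, all (fun e => 0 <= e) s ->
      foldr (fun e => szlenk e (oexpw xi)) L s !=set0 ->
      \sum_(e <- s) e `^ q <= M `^ q.

(* The default value 1 is only used when [omega ^ xi * n] never bounds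
   [Sz_eps L e], which [p_index] excludes for 0 < e. *)
Definition Sz_xi xi L e : nat :=
  xget 1%N [set n | (0 < n)%N /\ xole (Sz_eps L e) (Some (omuln (oexpw xi) n)) /\
    forall m, (0 < m)%N -> xole (Sz_eps L e) (Some (omuln (oexpw xi) m)) ->
      (n <= m)%N].

Definition p_index xi L : \bar R :=
  if `[< xole (Sz L) (Some (oexpw (osucc xi))) >]
  then limf_esup (fun e => (ln (Sz_xi xi L e)%:R / `|ln e|)%:E) 0^'+
  else +oo%E.

End szlenk.

Section szlenk_operator.
Variables (R : realType) (k : scalars) (X Y : normedModType (scalar_field R k)).
Implicit Types (A : bop X Y) (xi : ord) (q : R).

Definition adjoint_ball A : set (dual_space X) :=
  adjoint A @` [set f : dual_space Y | rnorm f <= 1].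

Definition op_q_summable xi q A : Prop := q_summable xi q (adjoint_ball A).

Definition op_p_index xi A : \bar R := p_index xi (adjoint_ball A).

End szlenk_operator.

(* Main.v *)
(* Idea.  Every functional in the image [K] of the dual ball under the adjoint of
   A0 (x) A1 lies in the weak*-closed convex hull of the functionals
   [u |-> f (u g)], where [f] and [g] range over the corresponding images [K0] and
   [K1]: this is Hahn-Banach, since these functionals compute the injective norm.
   A derivation of the set of all [f (x) g] derives [K0] or [K1], so only the
   convex hull is a problem.

   Let [L] be weak*-compact, let [phi x] measure how deep [x] sits in the iterated
   derived sets of [L] (for summability, the largest [sum e_i ^ q] with [x] in
   [s_{e_1} ... s_{e_n} L]), and let [C t] be the weak* closure of the averages
   [sum l_i x_i] of points of [L] with [sum l_i phi x_i >= t].  One derivation of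
   order [omega ^ xi] and size [e] maps [C t] into [C (t + c e ^ q)]: mass that
   moves by [r] when points of [L] are replaced by nearby ones gains [r ^ q] in
   [phi], and if the gain is small then the averages near a given point form a
   mixture of sets whose own index is below [omega ^ xi], their radii being small in the
   mean.  The same argument, with [phi] counting derivations, proves by induction
   on [xi] that the convex hull of a set with index at most [omega ^ xi] at size [e]
   has index at most [omega ^ xi] at any size larger than [e].

   For p_xi: p_xi < q implies q-summability, which implies p_xi <= q; and
   for a symmetric convex set p_xi < 1 forces all derived sets of order
   [omega ^ xi] to be empty.  Conversely [K0] and [K1] are images of [K] under
   adjoints of [x |-> x (x) x1] and [y |-> x0 (x) y]. *)
Require Import Defs.
From mathcomp Require Import all_boot all_order all_algebra.
From mathcomp Require Import complex ring lra.
From mathcomp Require Import all_classical all_reals all_analysis.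
Import Order.TTheory GRing.Theory Num.Theory.
Import numFieldNormedType.Exports.
Set Implicit Arguments.
Unset Strict Implicit.
Unset Printing Implicit Defensive.
Local Open Scope classical_set_scope.
Local Open Scope ring_scope.

(** * Iterated derivations *)

(** The quantities in the theorem are insensitive to rescaling the radii, so a constant factor may
    be lost once, as in passing from diameters to finite covers. Inside the transfinite induction on
    [xi] a factor would compound, so every loss there is an additive [eta] chosen afresh at each
    stage. Powers of [omega] matter because they are additively indecomposable: a closed set that
    vanishes after [omega ^ xi] derivations for each of two relations also does so for their
    conjunction. This distributes a derivation of a product over its factors, and controls the
    finitely many components of a mixture together. The condition [1 <= q] is tied to convexity: the
    radii of the components enter a mixture through their mean, while the gains are means of [q]-th
    powers. An index below 1 is out of reach of this argument, which is why such values are shown to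
    force empty derived sets. *)

Section iterates.
Variables (T : Type) (d : set T -> set T).

(** Same recursion as [szlenk_iter], for any derivation [d]: it serves both the Szlenk derivation
    and the one by finite colourings. *)
Fixpoint oiter (xi : ord) (L : set T) : set T :=
  match xi with
  | ozero => L
  | osucc z => d (oiter z L)
  | osup _ z => L `&` \bigcap_i oiter (z i) L
  end.

Hypothesis d_sub : forall L, d L `<=` L.
Hypothesis d_mono : forall L L', L `<=` L' -> d L `<=` d L'.

Lemma oiter_sub xi L : oiter xi L `<=` L.
Proof.
elim: xi => [//|xi IH|J f IH] /=; last by move=> x [].
exact: subset_trans (@d_sub _) IH.
Qed.

Lemma oiter_mono xi L L' : L `<=` L' -> oiter xi L `<=` oiter xi L'.
Proof.
move=> LL'; elim: xi => [//|xi IH|J f IH] /=; first exact: d_mono.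
by move=> x [/LL' L'x H]; split=> // i _; exact: IH (H i I).
Qed.

Lemma oiter_ole a b L : ole a b -> oiter b L `<=` oiter a L.
Proof.
elim: a b => [|a IHa|J f IHf] b; first by move=> _; exact: oiter_sub.
  elim: b => [//|b _ /= ab|J0 g IHb /= [j aj]]; first exact/d_mono/IHa.
  by move=> x [_ /(_ j I)]; exact: IHb.
move=> /= H x bx; split; first exact: oiter_sub bx.
by move=> i _; exact: IHf (H i) _ bx.
Qed.

Lemma oiter_add a b L : oiter (oadd a b) L = oiter b (oiter a L).
Proof.
elim: b => [//|b IH|J f IH] /=; first by rewrite IH.
apply/seteqP; split=> x [H1 H2].
  split; first exact: (H2 None I).
  by move=> j _; rewrite -IH; exact: (H2 (Some j) I).
split; first exact: oiter_sub H1.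
by case=> [j|] _ //; rewrite IH; exact: H2.
Qed.

Lemma oiter_muln a n L : oiter (omuln a n) L = iter n (oiter a) L.
Proof. by elim: n => [//|n IH] /=; rewrite oiter_add IH. Qed.

Lemma oiter_expS a L :
  oiter (oexpw (osucc a)) L = \bigcap_n iter n (oiter (oexpw a)) L.
Proof.
rewrite /=; under eq_bigcapr do rewrite oiter_muln.
by apply/seteqP; split=> [x []//|x H]; split=> //; exact: (H 0%N I).
Qed.

(** Rests on [1 <= omega ^ xi]; at a supremum, possibly empty, this is the index [None] of
    [oexpw]. *)
Lemma oiter_exp_sub1 xi L : oiter (oexpw xi) L `<=` d L.
Proof.
elim: xi => [//|xi IH|J f IH].
  by rewrite oiter_expS => x /(_ 1%N I); exact: IH.
by move=> x [_ /(_ None I)].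
Qed.

Lemma iter_oiter_sub xi m L : iter m (oiter xi) L `<=` L.
Proof. by elim: m => [//|m IH] /=; exact: subset_trans (@oiter_sub _ _) IH. Qed.

Lemma iter_oiter_mono xi m L L' :
  L `<=` L' -> iter m (oiter xi) L `<=` iter m (oiter xi) L'.
Proof. by move=> LL'; elim: m => [//|m IH] /=; exact: oiter_mono. Qed.

Lemma iter_oiter_le xi m n L :
  (m <= n)%N -> iter n (oiter xi) L `<=` iter m (oiter xi) L.
Proof. by move=> /subnK <-; rewrite iterD; exact: iter_oiter_sub. Qed.

End iterates.

Lemma oiter_le T (d d' : set T -> set T) xi L :
  (forall L, d L `<=` d' L) ->
  (forall L L', L `<=` L' -> d' L `<=` d' L') ->
  oiter d xi L `<=` oiter d' xi L.
Proof.
move=> dd' d'm; elim: xi => [//|xi IH|J f IH] /=.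
  exact: subset_trans (dd' _) (d'm _ _ IH).
by move=> x [Lx H]; split=> // i _; exact: IH (H i I).
Qed.

(* Finite colourings encode finite covers by sets of small diameter: [rho a b]
   will be [|a - b| <= e].  The conjunction of two relations then describes the
   sets that are small for both. *)
Section colorings.
Variable T : Type.
Implicit Types (rho : T -> T -> Prop) (A B : set T).

Definition fincol rho A := exists (C : finType) (c : T -> C),
  forall a b, A a -> A b -> c a = c b -> rho a b.

Lemma fincolS rho A B : A `<=` B -> fincol rho B -> fincol rho A.
Proof. by move=> AB [C [c H]]; exists C, c => a b /AB Ba /AB; exact: H. Qed.

Lemma fincol0 rho : fincol rho set0.
Proof. by exists unit, (fun=> tt). Qed.

Lemma fincolU rho A B : fincol rho A -> fincol rho B -> fincol rho (A `|` B).
Proof.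
move=> [C [c H]] [D [e G]].
exists (C + D)%type, (fun a => if `[< A a >] then inl (c a) else inr (e a)).
move=> a b ABa ABb; case: asboolP => Aa; case: asboolP => Ab //.
  by case; exact: H.
by case: ABa ABb => // Ba []// Bb []; exact: G.
Qed.

Lemma fincolI rho sigma A : fincol rho A -> fincol sigma A ->
  fincol (fun a b => rho a b /\ sigma a b) A.
Proof.
move=> [C [c H]] [D [e G]]; exists (C * D)%type, (fun a => (c a, e a)).
by move=> a b Aa Ab [ca ea]; split; [exact: H|exact: G].
Qed.

Lemma fincol_mono rho sigma A :
  (forall a b, A a -> A b -> rho a b -> sigma a b) ->
  fincol rho A -> fincol sigma A.
Proof.
by move=> rs [C [c H]]; exists C, c => a b Aa Ab ?; apply: rs => //; exact: H.
Qed.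

End colorings.

Lemma fincol_preimage (T U : Type) (f : U -> T) (rho : T -> T -> Prop)
    (A : set U) (B : set T) :
  (forall a, A a -> B (f a)) -> fincol rho B ->
  fincol (fun a b => rho (f a) (f b)) A.
Proof.
by move=> fAB [C [c H]]; exists C, (c \o f) => a b /fAB ? /fAB ?; exact: H.
Qed.

Lemma fincol_image (T U : Type) (f : T -> U) (rho : T -> T -> Prop)
    (sigma : U -> U -> Prop) (A : set T) (B : set U) :
  (forall a b, A a -> A b -> rho a b -> sigma (f a) (f b)) ->
  (forall u, B u -> exists2 a, A a & f a = u) ->
  fincol rho A -> fincol sigma B.
Proof.
move=> rs BA [C [c H]].
have [/eqP->|/set0P[u0 /BA[a0 _ _]]] := boolP (B == set0).
  exact: fincol0.
pose g u := if pselect (exists2 a, A a & f a = u) is left h then s2val (cid2 h) else a0.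
exists C, (c \o g) => u v Bu Bv cuv.
have gP w : B w -> A (g w) /\ f (g w) = w.
  by rewrite /g; case: pselect => [h _|n /BA//]; case: (cid2 h).
have [[Au <-] [Av <-]] := (gP u Bu, gP v Bv).
by apply: rs => //; exact: H.
Qed.

(** * The derivation by finite colourings *)

Section derivation.
Variable T : topologicalType.
Implicit Types (rho : T -> T -> Prop) (A B K : set T) (xi : ord).

(* For [rho a b := |a - b| <= e] this is the Szlenk derivation up to a factor 2
   in [e] (see [der_szlenk_der] and [szlenk_der_der]); unlike it, it loses nothing
   on finite unions, images and products. *)
Definition der rho A : set T :=
  [set x | A x /\ forall V, nbhs x V -> ~ fincol rho (V `&` A)].

Lemma der_sub rho A : der rho A `<=` A. Proof. by move=> x []. Qed.

Lemma der_mono rho A B : A `<=` B -> der rho A `<=` der rho B.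
Proof.
move=> AB x [Ax H]; split; first exact: AB.
by move=> V Vx; apply: contra_not (H V Vx); apply: fincolS => y [? /AB].
Qed.

Lemma der_le rho sigma A :
  (forall a b, A a -> A b -> sigma a b -> rho a b) ->
  der rho A `<=` der sigma A.
Proof.
move=> rs x [Ax H]; split=> // V Vx; apply: contra_not (H V Vx).
by apply: fincol_mono => a b [_ Aa] [_ Ab]; exact: rs.
Qed.

Lemma fincol_der rho A : fincol rho A -> der rho A = set0.
Proof.
move=> cA; rewrite -subset0 => x [_ /(_ setT filterT)]; apply.
exact: fincolS cA.
Qed.

Lemma der_closed rho A : closed A -> closed (der rho A).
Proof.
move=> cA x clx; split; first by apply: cA; move=> V /clx[y [[Ay _] Vy]]; exists y.
move=> V; rewrite nbhsE => -[U [oU Ux] UV] cV.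
have [y [[Ay H] Uy]] := clx U (open_nbhs_nbhs (conj oU Ux)).
apply: (H U); first by apply: open_nbhs_nbhs.
by apply: fincolS cV; apply: setSI.
Qed.

(** At a point in neither derived set, closedness gives a neighbourhood on which each of [A], [B] is
    finitely coloured or absent, and the two colourings combine. *)
Lemma derU rho A B : closed A -> closed B ->
  der rho (A `|` B) `<=` der rho A `|` der rho B.
Proof.
move=> cA cB x [ABx H]; apply: contrapT => /not_orP[nA nB].
have loc C : closed C -> ~ der rho C x ->
    exists2 V, nbhs x V & fincol rho (V `&` C).
  move=> cC nC; have [Cx|nCx] := pselect (C x).
    apply: contrapT => Hn; apply: nC; split=> // V Vx cV.
    by apply: Hn; exists V.
  exists (~` C); last by rewrite setICl; exact: fincol0.
  by apply: open_nbhs_nbhs; split=> //; exact: closed_openC.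
have [V Vx cV] := loc A cA nA; have [W Wx cW] := loc B cB nB.
apply: (H (V `&` W)); first exact: filterI.
apply: fincolS (fincolU cV cW) => y [[Vy Wy] [Ay|By]]; [by left|by right].
Qed.

Lemma derI rho sigma A : closed A ->
  der (fun a b => rho a b /\ sigma a b) A `<=` der rho A `|` der sigma A.
Proof.
move=> cA x [Ax H]; apply: contrapT => /not_orP[nA nB].
have loc tau : ~ der tau A x -> exists2 V, nbhs x V & fincol tau (V `&` A).
  move=> nC; apply: contrapT => Hn; apply: nC; split=> // V Vx cV.
  by apply: Hn; exists V.
have [V Vx cV] := loc rho nA; have [W Wx cW] := loc sigma nB.
apply: (H (V `&` W)); first exact: filterI.
by apply: fincolI; [apply: fincolS cV|apply: fincolS cW] => y [[]].
Qed.

Definition dit rho := oiter (der rho).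

Lemma dit_sub rho xi A : dit rho xi A `<=` A.
Proof. by apply: oiter_sub; exact: der_sub. Qed.

Lemma dit_mono rho xi A B : A `<=` B -> dit rho xi A `<=` dit rho xi B.
Proof. by apply: oiter_mono; exact: der_mono. Qed.

Lemma dit_ole rho a b A : ole a b -> dit rho b A `<=` dit rho a A.
Proof. by apply: oiter_ole; [exact: der_sub|exact: der_mono]. Qed.

Lemma dit_closed rho xi A : closed A -> closed (dit rho xi A).
Proof.
move=> cA; rewrite /dit; elim: xi => [//|xi IH|J f IH] /=; first exact: der_closed.
by apply: closedI => //; apply: closed_bigI => i _; exact: IH.
Qed.

Lemma dit_le rho sigma xi A :
  (forall a b, A a -> A b -> sigma a b -> rho a b) ->
  dit rho xi A `<=` dit sigma xi A.
Proof.
move=> rs; rewrite /dit; elim: xi => [//|xi IH|J f IH] /=.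
  apply: subset_trans (der_mono IH); apply: der_le => a b Aa Ab; apply: rs.
    exact: dit_sub Aa.
  exact: dit_sub Ab.
by move=> x [Ax H]; split=> // i _; exact: IH (H i I).
Qed.

Lemma iter_dit_closed rho xi n A : closed A -> closed (iter n (dit rho xi) A).
Proof. by move=> cA; elim: n => [//|n IH]; exact: dit_closed. Qed.

(** If [x] misses [A i] and [B j], it misses both members of the smaller of the two pairs. This
    carries unions through the intersections at limit stages. *)
Lemma bigcap_chainU (J : Type) (A B : J -> set T) :
  (forall i j, (A i `<=` A j /\ B i `<=` B j) \/ (A j `<=` A i /\ B j `<=` B i)) ->
  \bigcap_i (A i `|` B i) `<=` \bigcap_i A i `|` \bigcap_i B i.
Proof.
move=> ch x H; apply: contrapT => /not_orP[nA nB].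
have [i ni] : exists i, ~ A i x.
  by apply: contrapT => n; apply: nA => i _; apply: contrapT => ?; apply: n; exists i.
have [j nj] : exists j, ~ B j x.
  by apply: contrapT => n; apply: nB => j _; apply: contrapT => ?; apply: n; exists j.
have [[Aij Bij]|[Aji Bji]] := ch i j.
  by have [//|/Bij] := H i I.
by have [/Aji|//] := H j I.
Qed.

(** The index [None] stands for the initial set [A] in [oiter], so empty families need no separate
    case. *)
Lemma dit_sup rho J (f : J -> ord) A : dit rho (osup f) A =
  \bigcap_(o : option J) dit rho (if o is Some j then f j else ozero) A.
Proof.
apply/seteqP; split=> [x [Ax H] [j|] _ //|x H]; first exact: H.
by split=> [|j _]; [exact: (H None I)|exact: (H (Some j) I)].
Qed.

Lemma bigcap_ditU rho sigma J (f : J -> ord) A B :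
  \bigcap_i (dit rho (f i) A `|` dit sigma (f i) B) `<=`
  \bigcap_i dit rho (f i) A `|` \bigcap_i dit sigma (f i) B.
Proof.
apply: bigcap_chainU => i j.
by have [ij|/oltW ji] := ole_total (f i) (f j); [right|left];
  split; apply: dit_ole.
Qed.

Lemma ditU rho xi A B : closed A -> closed B ->
  dit rho xi (A `|` B) `<=` dit rho xi A `|` dit rho xi B.
Proof.
move=> cA cB; elim: xi => [//|xi IH|J f IH].
  by apply: subset_trans (der_mono IH) _; apply: derU; exact: dit_closed.
rewrite !dit_sup => x H; apply: bigcap_ditU => -[j|] _; last exact: (H None I).
exact/IH/(H (Some j) I).
Qed.

Lemma iter_ditU rho xi n A B : closed A -> closed B ->
  iter n (dit rho xi) (A `|` B) `<=`
  iter n (dit rho xi) A `|` iter n (dit rho xi) B.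
Proof.
move=> cA cB; elim: n => [//|n IH] /=.
by apply: subset_trans (dit_mono IH) _; apply: ditU; exact: iter_dit_closed.
Qed.

Lemma iter_dit_sub rho xi n A : iter n (dit rho xi) A `<=` A.
Proof. by apply: iter_oiter_sub; exact: der_sub. Qed.

Lemma iter_dit_mono rho xi n A B :
  A `<=` B -> iter n (dit rho xi) A `<=` iter n (dit rho xi) B.
Proof. by apply: iter_oiter_mono; exact: der_mono. Qed.

Lemma iter_dit_le rho xi m n A : (m <= n)%N ->
  iter n (dit rho xi) A `<=` iter m (dit rho xi) A.
Proof. by apply: iter_oiter_le; exact: der_sub. Qed.

Lemma dit_expS rho xi A :
  dit rho (oexpw (osucc xi)) A = \bigcap_n iter n (dit rho (oexpw xi)) A.
Proof. by apply: oiter_expS; exact: der_sub. Qed.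

(** Additive indecomposability of [omega ^ xi]. Of [m + n] derivations for the conjunction, either
    [m] can be charged to [rho] or [n] to [sigma] ([key]); at a successor [m = n] is arbitrary, and
    a chain argument selects one alternative for all [n]. For a general order, say 2, the inclusion
    may fail, as one derivation may be charged to each side. *)
Lemma ditI rho sigma xi A : closed A ->
  dit (fun a b => rho a b /\ sigma a b) (oexpw xi) A `<=`
  dit rho (oexpw xi) A `|` dit sigma (oexpw xi) A.
Proof.
set tau := (X in dit X).
elim: xi A => [|xi IH|J f IH] A cA; first exact: derI.
  rewrite !dit_expS.
  have key m n B : closed B -> iter (m + n) (dit tau (oexpw xi)) B `<=`
      iter m (dit rho (oexpw xi)) B `|` iter n (dit sigma (oexpw xi)) B.
    move: {2}(m + n)%N (erefl (m + n)%N) => p.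
    elim: p m n B => [|p IHp] [|m] [|n] B // e cB; try by move=> x; left.
    - by move=> x /iter_dit_sub; left.
    - by move=> x /iter_dit_sub; right.
    rewrite addSn iterSr; apply: subset_trans (iter_dit_mono (IH _ cB)) _.
    have c1 := @dit_closed rho (oexpw xi) _ cB.
    have c2 := @dit_closed sigma (oexpw xi) _ cB.
    apply: subset_trans (iter_ditU c1 c2) _.
    move: e; rewrite addSn => -[e] x [].
      move=> /(IHp _ _ _ e c1)[H|]; first by left; rewrite iterSr.
      by move=> /(iter_dit_mono (@dit_sub _ _ _)); right.
    rewrite -addSnnS; rewrite -addSnnS in e.
    move=> /(IHp _ _ _ e c2)[|H]; last by right; rewrite iterSr.
    by move=> /(iter_dit_mono (@dit_sub _ _ _)); left.
  move=> x H; apply: bigcap_chainU => [i j|n _].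
    have [ij|/ltnW ji] := leqP i j; [right|left];
      by split; apply: iter_dit_le.
  exact: key (H (n + n)%N I).
(* [oexpw] of a supremum is itself a supremum over [option J], to which [dit_sup] adds one more
   index: hence three cases. *)
pose g (o : option J) := if o is Some j then oexpw (f j) else osucc ozero.
rewrite -[oexpw (osup f)]/(osup g) !dit_sup => x H; apply: bigcap_ditU => -[[j|]|] _.
- exact/IH/(H (Some (Some j)) I).
- exact/derI/(H (Some None) I).
- by left; exact: (H None I).
Qed.

End derivation.

(** * Derivations of compact sets *)

Section compact_derivation.
Variable T : topologicalType.
Implicit Types (rho : T -> T -> Prop) (A B K : set T) (xi : ord).

(** If [Q K] failed, the sets whose complement in [K] has [Q] would form a proper filter, and a
    cluster point of it in [K] would contradict the local hypothesis. Below, this stands in for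
    finite subcovers. *)
Lemma compact_local (Q : set T -> Prop) K :
  Q set0 -> (forall A B, A `<=` B -> Q B -> Q A) ->
  (forall A B, Q A -> Q B -> Q (A `|` B)) -> compact K ->
  (forall x, K x -> exists2 V, nbhs x V & Q (V `&` K)) -> Q K.
Proof.
move=> Q0 QS QU cK loc; apply: contrapT => nQ.
pose F : set_system T := [set S | Q (K `\` S)].
have FF : ProperFilter F.
  apply: Build_ProperFilter_ex => [S FS|].
    apply: contrapT => nS; apply: nQ; apply: QS FS => x Kx; split=> // Sx.
    by apply: nS; exists x.
  split; first by rewrite /F /= setDT.
    by move=> P S FP FS; rewrite /F /= setDIr; exact: QU.
  by move=> P S PS; apply: QS; exact: setDS.
have FK : F K by rewrite /F /= setDv.
have [x [Kx clx]] := cK F FF FK.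
have [V Vx QV] := loc x Kx.
have FV : F (K `\` V) by rewrite /F /= setDDr setDv set0U setIC.
by have [y [[_ nVy] Vy]] := clx _ _ FV Vx.
Qed.

Lemma compact_chain K (J : Type) (j0 : J) (A : J -> set T) : compact K ->
  (forall i, closed (A i)) -> (forall i j, A i `<=` A j \/ A j `<=` A i) ->
  K `&` \bigcap_i A i = set0 -> exists i, K `&` A i = set0.
Proof.
move=> cK cA ch e; have [i Hi] : exists i, K `<=` ~` A i; last first.
  by exists i; rewrite -subset0 => x [/Hi].
apply: (@compact_local (fun S => exists i, S `<=` ~` A i)) => //.
- by exists j0.
- by move=> B C BC [i Ci]; exists i; exact: subset_trans Ci.
- move=> B C [i Bi] [j Cj]; have [ij|ji] := ch i j; [exists i|exists j].
    by move=> x [/Bi//|/Cj nj /ij].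
  by move=> x [/Bi ni /ji|/Cj//].
- move=> x Kx; have [i ni] : exists i, ~ A i x.
    apply: contrapT => n; suff : set0 x by [].
    by rewrite -e; split=> // i _; apply: contrapT => ?; apply: n; exists i.
  exists (~` A i); last by exists i => y [].
  by apply: open_nbhs_nbhs; split=> //; exact: closed_openC.
Qed.

(** A chain of closed subsets of a compact set with empty intersection has an empty member, so an
    iterate never becomes empty first at a limit. The witness [j0] excludes the empty supremum,
    where the iterate is [K]. *)
Lemma dit_sup_empty rho J (j0 : J) (f : J -> ord) K : compact K -> closed K ->
  dit rho (osup f) K = set0 -> exists j, dit rho (f j) K = set0.
Proof.
move=> cK clK e; have [|||j H] := @compact_chain K J j0 (fun j => dit rho (f j) K) cK.
- by move=> i; exact: dit_closed.
- move=> i j; have [ij|/oltW ji] := ole_total (f i) (f j); [right|left];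
    exact: dit_ole.
- exact: e.
- by exists j; rewrite -subset0 => x jx; rewrite -H; split=> //; exact: dit_sub jx.
Qed.

Lemma dit_expS_empty rho xi K : compact K -> closed K ->
  dit rho (oexpw (osucc xi)) K = set0 ->
  exists n, iter n (dit rho (oexpw xi)) K = set0.
Proof.
move=> cK clK /(dit_sup_empty 0%N cK clK)[n]; exists n.
by rewrite -oiter_muln //; exact: der_sub.
Qed.

Lemma dit_fincol rho xi K : fincol rho K -> dit rho (oexpw xi) K = set0.
Proof.
move=> /fincol_der cK; rewrite -subset0 -cK; apply: oiter_exp_sub1.
exact: der_sub.
Qed.

Lemma ditI_empty rho sigma xi K : closed K ->
  dit rho (oexpw xi) K = set0 -> dit sigma (oexpw xi) K = set0 ->
  dit (fun a b => rho a b /\ sigma a b) (oexpw xi) K = set0.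
Proof.
by move=> cK e1 e2; rewrite -subset0; apply: subset_trans (ditI cK) _; rewrite e1 e2 setU0.
Qed.

Lemma dit_forall_empty (J : finType) (rho : J -> T -> T -> Prop) xi K :
  closed K -> (forall i, dit (rho i) (oexpw xi) K = set0) ->
  dit (fun a b => forall i, rho i a b) (oexpw xi) K = set0.
Proof.
move=> cK H.
suff G (s : seq J) :
    dit (fun a b => forall i, i \in s -> rho i a b) (oexpw xi) K = set0.
  rewrite -subset0 -(G (enum J)); apply: dit_le => a b _ _ h i.
  by apply: h; rewrite mem_enum.
elim: s => [|i s IH].
  by apply: dit_fincol; exists unit, (fun=> tt).
rewrite -subset0 -(ditI_empty cK (H i) IH); apply: dit_le => a b _ _ [ri rs] j.
by rewrite inE => /predU1P[->//|]; exact: rs.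
Qed.

Lemma dit_local rho xi A V : open V -> dit rho xi A `&` V `<=` dit rho xi (A `&` V).
Proof.
move=> oV; elim: xi => [//|xi IH|J f IH].
  move=> x [[Ax H] Vx]; split; first exact: IH.
  move=> W Wx; apply: contra_not (H (W `&` V) _).
    by apply: fincolS => y [[Wy Vy] Ay]; split=> //; exact: IH.
  by apply: filterI => //; exact: open_nbhs_nbhs.
rewrite !dit_sup => x [H Vx] [j|] _; first by apply: IH; split=> //; exact: (H (Some j)).
by split=> //; exact: (H None I).
Qed.

(** Supplies a closed piece of [A] around [z] that vanishes under the same derivation, in a
    neighbourhood free of surviving points. Regularity allows the neighbourhood, and so the piece,
    to be closed. *)
Lemma dit_closed_local rho xi A z :
  (forall V, nbhs z V -> exists2 F, nbhs z F & closed F /\ F `<=` V) ->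
  closed A -> ~ dit rho xi A z ->
  exists2 F, nbhs z F & [/\ closed F, F `<=` ~` dit rho xi A &
    dit rho xi (A `&` F) = set0].
Proof.
move=> reg cA nz; have [|F Fz [cF FA]] := reg (~` dit rho xi A).
  by apply: open_nbhs_nbhs; split=> //; apply: closed_openC; exact: dit_closed.
exists F => //; split=> //; rewrite -subset0 => x h.
have [_ /FA] := dit_sub h; apply.
by apply: dit_mono h.
Qed.

End compact_derivation.

(** * Derivations and continuous maps *)

Section maps.
Variables T U : topologicalType.
Implicit Types (rho : T -> T -> Prop) (sigma : U -> U -> Prop).

Lemma dit_preimage (f : T -> U) sigma xi A B : continuous f ->
  (forall a, A a -> B (f a)) ->
  dit (fun a b => sigma (f a) (f b)) xi A `<=` f @^-1` dit sigma xi B.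
Proof.
move=> cf AB; set rho := (X in dit X); elim: xi => [//|xi IH|J g IH].
  move=> x [Ax H]; split; first exact: IH.
  move=> V Vx; apply: contra_not (H _ (cf x V Vx)).
  by apply: fincol_preimage => a [Va Aa]; split=> //; exact: IH.
rewrite !dit_sup => x H [j|] _; last exact/AB/(H None I).
exact/IH/(H (Some j) I).
Qed.

(** A tube lemma: points of the fibre are handled by the local hypothesis, the others are separated
    from [y] because [U] is Hausdorff. Continuity is asked relative to [A], since [tfun_pair] is
    shown to be weak* continuous on bounded sets only. *)
Lemma compact_fiber (f : T -> U) A y (Q : set T -> Prop) :
  hausdorff_space U -> compact A ->
  (forall a V, A a -> nbhs (f a) V -> nbhs a (fun x => A x -> V (f x))) ->
  Q set0 -> (forall S S', S `<=` S' -> Q S' -> Q S) ->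
  (forall S S', Q S -> Q S' -> Q (S `|` S')) ->
  (forall a, A a -> f a = y -> exists2 V, nbhs a V & Q (V `&` A)) ->
  exists2 V, nbhs y V & Q (A `&` f @^-1` V).
Proof.
move=> hU cA cf Q0 QS QU loc.
apply: (@compact_local _ (fun S => exists2 V, nbhs y V & Q (S `&` f @^-1` V)) A) => //.
- by exists setT; [exact: filterT|rewrite set0I].
- by move=> S S' SS' [V Vy QV]; exists V => //; apply: QS QV; exact: setSI.
- move=> S S' [V Vy QV] [W Wy QW]; exists (V `&` W); first exact: filterI.
  by apply: QS (QU _ _ QV QW) => x [[Sx|Sx] [Vx Wx]]; [left|right].
- move=> a Aa; have [fay|fay] := pselect (f a = y).
    have [V Va QV] := loc a Aa fay; exists V => //; exists setT; first exact: filterT.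
    by rewrite preimage_setT setIT.
  move: hU; rewrite open_hausdorff => /(_ (f a) y).
  case; [exact/eqP|move=> [V W] [/set_mem Va /set_mem Wy] [oV oW /eqP VW]].
  exists (fun x => A x -> V (f x)).
    by apply: cf => //; exact: open_nbhs_nbhs.
  exists W; first exact: open_nbhs_nbhs.
  apply: QS Q0 => x [[/= h /h Vfx] Wfx].
  suff : set0 (f x) by [].
  by rewrite -VW.
Qed.

(** If no point of the fibre over [y] survives, each has a neighbourhood that is coloured or, at a
    supremum, free of some iterate. [compact_fiber] turns these into one neighbourhood of [y], over
    which the colouring is pushed forward. *)
Lemma dit_image (f : T -> U) rho sigma xi A :
  hausdorff_space U -> compact A -> closed A ->
  (forall a V, A a -> nbhs (f a) V -> nbhs a (fun x => A x -> V (f x))) ->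
  (forall a b, A a -> A b -> rho a b -> sigma (f a) (f b)) ->
  dit sigma xi (f @` A) `<=` f @` dit rho xi A.
Proof.
move=> hU cA clA cf rs; elim: xi => [//|xi IH|J g IH].
  set D := dit rho xi A in IH *.
  have DA : D `<=` A := @dit_sub _ _ _ _.
  have cD : compact D by apply: subclosed_compact (dit_closed clA) cA DA.
  move=> y [_ H]; apply: contrapT => ny.
  have [|||| a Da fay|V Vy cV] := @compact_fiber f D y (fincol rho) hU cD.
  - move=> a V Da Vfa; apply: filterS (cf a V (DA _ Da) Vfa) => x h /DA; exact: h.
  - exact: fincol0.
  - by move=> S S'; exact: fincolS.
  - by move=> S S'; exact: fincolU.
  - apply: contrapT => n; apply: ny; exists a => //; split=> // V Va cV.
    by apply: n; exists V.
  - apply: (H V Vy); apply: (fincol_image (f := f)) cV.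
      by move=> a b [/DA Aa _] [/DA Ab _]; exact: rs.
    by move=> u [Vu /IH[a Da fa]]; exists a => //; split=> //=; rewrite fa.
rewrite !dit_sup => y H; apply: contrapT => ny.
set D := fun o : option J => dit rho (if o is Some j then g j else ozero) A.
have [| | | a Aa fay | V Vy [p Do]] := @compact_fiber f A y
    (fun S => exists o, S `&` D o = set0) hU cA cf.
- by exists None; rewrite set0I.
- by move=> S S' SS' [p e]; exists p; rewrite -subset0 -e; exact: setSI.
- move=> S S' [p e] [p' e'].
  have [/dit_ole le|/oltW/dit_ole le] := ole_total
    (if p is Some j then g j else ozero) (if p' is Some j then g j else ozero).
    exists p'; rewrite setIUl e' setU0 -subset0 -e => x [Sx Dx]; split=> //.
    exact: le Dx.
  exists p; rewrite setIUl e set0U -subset0 -e' => x [Sx Dx]; split=> //.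
  exact: le Dx.
- have [p no] : exists o, ~ D o a.
    apply: contrapT => n; apply: ny; exists a => // o _.
    by apply: contrapT => no; apply: n; exists o.
  exists (~` D p); last first.
    by exists p; rewrite -subset0 => x [[]].
  apply: open_nbhs_nbhs; split=> //; apply: closed_openC; exact: dit_closed.
- have : exists2 a, D p a & f a = y.
    case: p {Do} @D => [j|] /=; last by have [a] := H None I; exists a.
    by have [a ha <-] := IH j y (H (Some j) I); exists a.
  move=> [a Da fay]; suff : set0 a by [].
  rewrite -Do; split=> //; split; first exact: dit_sub Da.
  by rewrite /= fay; exact: nbhs_singleton.
Qed.

End maps.

(** * The weak* topology *)

Section scalar_facts.
Variables (R : realType) (k : scalars).
Local Notation K := (scalar_field R k).

Lemma rnormN (V : normedModType K) (x : V) : rnorm (- x) = rnorm x.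
Proof. by rewrite /rnorm normrN. Qed.

Lemma rnormC (V : normedModType K) (x y : V) : rnorm (x - y) = rnorm (y - x).
Proof. by rewrite /rnorm distrC. Qed.

Lemma rnorm_triangle (V : normedModType K) (y x z : V) :
  rnorm (x - z) <= rnorm (x - y) + rnorm (y - z).
Proof. by rewrite -[X in rnorm X](subrKA y); exact: rnormD. Qed.

Lemma rnorm_sum (V : normedModType K) (J : Type) (s : seq J) (F : J -> V) :
  rnorm (\sum_(i <- s) F i) <= \sum_(i <- s) rnorm (F i).
Proof.
elim: s => [|i s IH]; first by rewrite !big_nil rnorm0.
by rewrite !big_cons; apply: le_trans (rnormD _ _) _; rewrite lerD2l.
Qed.

Lemma rnormZr (V : normedModType K) (a : R) (x : V) : 0 <= a ->
  rnorm (scalar_of k a *: x) = a * rnorm x.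
Proof. by move=> a0; rewrite rnormZ rnorm_scalar. Qed.

Lemma scalar_ofN (a : R) : scalar_of k (- a) = - scalar_of k a.
Proof. by rewrite /scalar_of; case: k => //=; rewrite raddfN. Qed.

Lemma scalar_ofB (a b : R) : scalar_of k (a - b) = scalar_of k a - scalar_of k b.
Proof. by rewrite scalar_ofD scalar_ofN. Qed.

Lemma rnorm_scalar_of (a : R) : rnorm (scalar_of k a : K^o) = `|a|.
Proof.
have [a0|a0] := leP 0 a; first by rewrite rnorm_scalar // ger0_norm.
by rewrite -rnormN -[- _]scalar_ofN rnorm_scalar ?oppr_ge0 ?ltW // ltr0_norm.
Qed.

Lemma cvg_rnormP (V : normedModType K) (T : Type) (F : set_system T)
    (f : T -> V) (l : V) : Filter F ->
  f @ F --> l <-> forall e : R, 0 < e -> \forall x \near F, rnorm (f x - l) < e.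
Proof.
move=> FF; split=> [/cvgrPdist_lt H e e0|H].
  have e0' : 0 < scalar_of k e by rewrite -(scalar_of0 R k) ltr_scalar_of.
  by apply: filterS (H _ e0') => x; rewrite distrC rnormE ltr_scalar_of.
apply/cvgrPdist_lt => e e0.
have e0' : 0 < scalar_Re e.
  by rewrite -(ltr_scalar_of k) scalar_ReK ?ltW // scalar_of0.
apply: filterS (H _ e0') => x.
by rewrite distrC -(ltr_scalar_of k) -rnormE scalar_ReK // ltW.
Qed.

Lemma scalar_of_cvg (T : Type) (F : set_system T) (f : T -> R) (l : R) :
  Filter F -> f @ F --> l -> (fun t => scalar_of k (f t) : K^o) @ F --> (scalar_of k l
      : K^o).
Proof.
move=> FF /cvgrPdist_lt H; apply/cvg_rnormP => e e0.
apply: filterS (H e e0) => x; rewrite distrC -(rnorm_scalar_of (_ - _)).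
by rewrite scalar_ofB.
Qed.

End scalar_facts.

Section weakstar_topology.
Variables (R : realType) (k : scalars).
Local Notation K := (scalar_field R k).
Variable X : normedModType K.
Local Notation W := (weakstar X).
Implicit Types (f g : dual_space X) (x : X).

Lemma weakstar_cvgP (F : set_system W) (f : W) : Filter F ->
  F --> f <-> forall x, (fun g : dual_space X => g x : K^o) @ F --> (f : dual_space X) x.
Proof.
move=> FF; pose j : W -> {ptws X -> K^o} := fun g => (g : dual_space X).
have cj : continuous j by exact: initial_continuous.
split=> [Ff x|H].
  have : j @ F --> j f by apply: cvg_trans (cj f); exact: cvg_app.
  by move=> /pointwise_cvgP /(_ x).
have jF : j @ F --> j f by apply/pointwise_cvgP => x; exact: H.
move=> A; rewrite nbhsE => -[B [[C oC <-] Cf] BA].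
by apply: filterS BA _; apply: jF; exact: open_nbhs_nbhs.
Qed.

Lemma weakstar_eval x : continuous (fun g : W => (g : dual_space X) x : K^o).
Proof. by move=> g; have /weakstar_cvgP : nbhs g --> g by []; exact. Qed.

Lemma cvg_eval (T : Type) (F : set_system T) (h : T -> W) (f : W) x : Filter F ->
  h @ F --> f ->
  (fun t => (h t : dual_space X) x : K^o) @ F --> ((f : dual_space X) x : K^o).
Proof.
move=> FF hf; apply: (@cvg_comp _ _ _ h (fun g : W => (g : dual_space X) x : K^o) _ _ _ hf).
exact: weakstar_eval.
Qed.

Lemma weakstar_near (f : W) x (e : R) : 0 < e ->
  nbhs f [set g : W | rnorm ((g : dual_space X) x - (f : dual_space X) x) < e].
Proof. by move=> e0; have /cvg_rnormP := @weakstar_eval x f; exact. Qed.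

Lemma cvg_weakstar (T : Type) (F : set_system T) (h : T -> W) (f : W) : Filter F ->
  (forall x, (fun t => (h t : dual_space X) x : K^o) @ F --> (f : dual_space X) x) ->
  h @ F --> f.
Proof. by move=> FF H; apply/weakstar_cvgP => x; exact: H. Qed.

(** The sets containing such a box form a filter that converges to [f] at every vector, hence weak*,
    so it contains all neighbourhoods of [f]. *)
Lemma weakstar_nbhs (f : W) (V : set W) : nbhs f V ->
  exists (s : seq X) (e : R), 0 < e /\ forall g : W,
    (forall x, x \in s -> rnorm ((g : dual_space X) x - (f : dual_space X) x) <= e) -> V g.
Proof.
move=> fV; pose F : set_system W := [set V : set W | exists (s : seq X) (e : R), 0 < e
    /\ forall g : W,
    (forall x, x \in s -> rnorm ((g : dual_space X) x - (f : dual_space X) x) <= e) -> V g].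
have FF : Filter F.
  split; first by exists [::], 1.
    move=> A B [s [e [e0 H]]] [t [d [d0 G]]]; exists (s ++ t), (Num.min e d).
    split; first by rewrite lt_min e0.
    move=> g h; split; [apply: H|apply: G] => x xs.
      by apply: le_trans (h x _) _; rewrite ?mem_cat ?xs // ge_min lexx.
    by apply: le_trans (h x _) _; rewrite ?mem_cat ?xs ?orbT // ge_min lexx orbT.
  by move=> A B AB [s [e [e0 H]]]; exists s, e; split=> // g /H /AB.
suff : F --> f by apply.
apply/weakstar_cvgP => x; apply/cvg_rnormP => e e0.
exists [:: x], (e / 2); split=> [|g /(_ x)]; first by rewrite divr_gt0.
rewrite inE eqxx => /(_ isT) h; apply: le_lt_trans h _.
by rewrite ltr_pdivrMr // ltr_pMr // ltr1n.
Qed.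

Lemma closed_weakstar_eval (f : dual_space X) x (e : R) :
  closed [set g : W | rnorm ((g : dual_space X) x - f x) <= e].
Proof.
move=> g clg /=; rewrite leNgt; apply/negP => lt.
have d0 : 0 < rnorm (g x - f x) - e by rewrite subr_gt0.
have [h [/= he hg]] := clg _ (weakstar_near g x d0).
have := rnorm_triangle (h x) (g x) (f x); rewrite (rnormC (g x) (h x)).
by move: he hg; lra.
Qed.

Lemma dual_rnorm_le (f : dual_space X) (e : R) :
  (forall x, rnorm x <= 1 -> rnorm (f x) <= e) -> rnorm f <= e.
Proof. by rewrite rnorm_bop; exact: opnorm_le. Qed.

Lemma ler_dual (f : dual_space X) x : rnorm (f x) <= rnorm f * rnorm x.
Proof. by rewrite rnorm_bop; exact: ler_opnorm. Qed.

Lemma closed_weakstar_ball (f : dual_space X) (e : R) :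
  closed [set g : W | rnorm ((g : dual_space X) - f) <= e].
Proof.
rewrite (_ : [set _ | _] = \bigcap_(x in [set x | rnorm x <= 1])
    [set g : W | rnorm ((g : dual_space X) x - f x) <= e]).
  by apply: closed_bigI => x _; exact: closed_weakstar_eval.
apply/seteqP; split=> g /=.
  move=> h x x1; apply: le_trans (ler_dual (g - f) x) _.
  by apply: le_trans h; rewrite ler_piMr // rnorm_ge0.
by move=> h; apply: dual_rnorm_le => x x1; exact: h.
Qed.

Lemma weakstar_hausdorff : hausdorff_space W.
Proof.
move=> f g clfg; apply/val_inj/funext => x; apply/eqP; rewrite -subr_eq0; apply/eqP.
apply: rnorm_eq0; apply/eqP; rewrite eq_le rnorm_ge0 andbT; apply/ler_addgt0Pr => e e0.
rewrite add0r.
have e2 : 0 < e / 2 by rewrite divr_gt0.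
have [h [/= h1 h2]] := clfg _ _ (weakstar_near f x e2) (weakstar_near g x e2).
have := rnorm_triangle (h x) ((f : dual_space X) x) ((g : dual_space X) x).
by rewrite (rnormC (f x) (h x)); move: h1 h2; lra.
Qed.

Lemma weakstar_regular (f : W) (V : set W) : nbhs f V ->
  exists2 F, nbhs f F & closed F /\ F `<=` V.
Proof.
move=> /weakstar_nbhs[s [e [e0 H]]].
exists [set g : W | forall x, x \in s -> rnorm ((g : dual_space X) x - (f : dual_space
    X) x) <= e].
  elim: s {H} => [|y s IH]; first by apply: filterS filterT.
  apply: filterS (filterI IH (weakstar_near f y e0)) => g [gs /= gy] x.
  by rewrite inE => /predU1P[->|/gs//]; exact: ltW.
split; last exact: H.
rewrite (_ : [set _ | _] = \bigcap_(x in [set x | x \in s])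
  [set g : W | rnorm ((g : dual_space X) x - (f : dual_space X) x) <= e]) //.
by apply: closed_bigI => x _; exact: closed_weakstar_eval.
Qed.

End weakstar_topology.

Section scalar_ball.
Variables (R : realType) (k : scalars).
Local Notation K := (scalar_field R k).

(** Handles both scalar fields: [i] is 0 in the real case and the imaginary unit in the complex
    case. *)
Lemma scalar_decomp : exists i : K, forall z : K, exists a b : R,
  [/\ z = scalar_of k a + scalar_of k b * i, `|a| <= rnorm (z : K^o) & `|b| <= rnorm (z
      : K^o)].
Proof.
case: k => /=.
  exists 0 => z; exists z, 0; rewrite mulr0 addr0 normr0 /rnorm /=; split=> //.
exists 'i%C => z; exists (complex.Re z), (complex.Im z); split.
- by case: z => a b; apply/eqP; rewrite eq_complex /= !mulr0 !mul0r !mulr1 subrr !addr0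
    add0r !eqxx.
- by case: z => a b; rewrite /rnorm /= -sqrtr_sqr ler_wsqrtr // lerDl sqr_ge0.
- by case: z => a b; rewrite /rnorm /= -sqrtr_sqr ler_wsqrtr // lerDr sqr_ge0.
Qed.

Lemma closed_rnorm_ball (V : normedModType K) (D : R) : closed [set z : V | rnorm z <= D].
Proof.
move=> z clz /=; rewrite leNgt; apply/negP => lt.
have d0 : 0 < rnorm z - D by rewrite subr_gt0.
have : nbhs z [set y | rnorm (y - z) < rnorm z - D].
  by have /cvg_rnormP : (id : V -> V) @ z --> z by []; apply.
move=> /clz[y [/= yD yz]].
have := rnorm_triangle y z 0; rewrite !subr0 rnormC.
by move: yD yz; lra.
Qed.

Lemma compact_scalar_ball (D : R) : compact [set z : K^o | rnorm z <= D].
Proof.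
have [i Hi] := scalar_decomp.
pose h (p : R * R) : K^o := scalar_of k p.1 + scalar_of k p.2 * i.
have ch : continuous h.
  move=> p; rewrite /h; apply: cvgD; first by apply: scalar_of_cvg; exact: cvg_fst.
  by apply: cvgMr_tmp; apply: scalar_of_cvg; exact: cvg_snd.
apply: (@subclosed_compact _ _ (h @` (`[(- D), D] `*` `[(- D), D]))).
- exact: closed_rnorm_ball.
- apply: continuous_compact; first exact: continuous_subspaceT.
  by apply: compact_setX; exact: segment_compact.
- move=> z /= zD; have [a [b [e ha hb]]] := Hi z; exists (a, b); last by rewrite /h -e.
  rewrite /= !in_itv /= -!ler_norml.
  by split; [exact: le_trans ha zD|exact: le_trans hb zD].
Qed.
End scalar_ball.

Section alaoglu.
Variables (R : realType) (k : scalars).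
Local Notation K := (scalar_field R k).
Variable X : normedModType K.
Local Notation W := (weakstar X).

(** Banach-Alaoglu. Along an ultrafilter every evaluation stays in a compact ball of scalars and so
    converges; the limits form a linear functional of norm at most [D]. *)
Lemma compact_weakstar_ball (D : R) : compact [set f : W | rnorm (f : dual_space X) <= D].
Proof.
rewrite compact_ultra => F FU FD.
have PF : ProperFilter F by exact: ultra_proper.
pose ev x (g : W) : K^o := (g : dual_space X) x.
have evD x g : rnorm (g : dual_space X) <= D -> rnorm (ev x g) <= D * rnorm x.
  move=> gD; apply: le_trans (ler_dual g x) _.
  by rewrite ler_wpM2r // rnorm_ge0.
have lim x : exists l : K^o, ev x @ F --> l.
  have FB : F (ev x @^-1` [set z : K^o | rnorm z <= D * rnorm x]).
    by apply: filterS FD => g; exact: evD.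
  have [l [_ cll]] := compact_scalar_ball (fmap_proper_filter _ PF) FB.
  exists l => V lV; have [//|nV] := in_ultra_setVsetC (ev x @^-1` V) FU.
  have nV' : (ev x @ F) (~` V) by [].
  by have [y []] := cll _ _ nV' lV.
pose l x := sval (cid (lim x)); have lP x := svalP (cid (lim x)) : ev x @ F --> l x.
have ll : linear (l : X -> K^o).
  move=> a x y; apply: (cvg_unique (@norm_hausdorff _ K^o) (lP _)).
  rewrite (_ : ev _ = (a \*: ev x) + ev y).
    by apply: cvgD (lP y); apply: cvgZl_tmp; exact: lP.
  by apply/funext => g; rewrite /ev linearP.
have lb x : rnorm (l x) <= D * rnorm x.
  have cl := @closed_rnorm_ball _ _ K^o (D * rnorm x). apply: (@closed_cvg _ _ F _ (ev
      x) _ cl _ (l x) (lP x)).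
  by apply: filterS FD => g; exact: evD.
have lB : l \in @bounded_op R k X K^o by apply/asboolP; split=> //; exists D.
have D0 : 0 <= D by have [f] := filter_ex FD; exact/le_trans/rnorm_ge0.
exists (Bop lB); split.
  apply: dual_rnorm_le => x x1 /=; apply: le_trans (lb x) _.
  by rewrite ler_piMr.
by apply/weakstar_cvgP => x; exact: lP.
Qed.

End alaoglu.

(** * Derivations along a list of radii *)

Section derivation_lists.
Variables (E : eqType) (T : topologicalType).
Implicit Types (rho sigma : E -> T -> T -> Prop) (s : seq E) (A B : set T).

(** As in [q_summable], the last entry of [s] acts first; hence the induction from the right in
    [ditsI]. *)
Definition dits rho xi s A := foldr (fun e => dit (rho e) (oexpw xi)) A s.

Lemma dits_sub rho xi s A : dits rho xi s A `<=` A.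
Proof. elim: s => [//|e s IH]; exact: subset_trans (@dit_sub _ _ _ _) IH. Qed.

Lemma dits_mono rho xi s A B : A `<=` B -> dits rho xi s A `<=` dits rho xi s B.
Proof. by move=> AB; elim: s => [//|e s IH]; exact: dit_mono. Qed.

Lemma dits_closed rho xi s A : closed A -> closed (dits rho xi s A).
Proof. by move=> cA; elim: s => [//|e s IH]; exact: dit_closed. Qed.

Lemma ditsU rho xi s A B : closed A -> closed B ->
  dits rho xi s (A `|` B) `<=` dits rho xi s A `|` dits rho xi s B.
Proof.
move=> cA cB; elim: s => [//|e s IH] /=.
by apply: subset_trans (dit_mono IH) _; apply: ditU; exact: dits_closed.
Qed.

Lemma dits_rcons rho xi s e A :
  dits rho xi (rcons s e) A = dits rho xi s (dit (rho e) (oexpw xi) A).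
Proof. by rewrite /dits foldr_rcons. Qed.

(** Each entry is charged to one of the two relations by [ditI]; leaving it out of the other sublist
    only enlarges that derived set. The order of the entries does not affect the sums to be
    bounded. *)
Lemma ditsI rho sigma xi s A x : closed A ->
  dits (fun e a b => rho e a b /\ sigma e a b) xi s A x ->
  exists s1 s2, [/\ perm_eq (s1 ++ s2) s, dits rho xi s1 A x &
    dits sigma xi s2 A x].
Proof.
elim/last_ind: s A => [|s e IH] A cA; first by exists [::], [::].
have c1 := @dit_closed _ (rho e) (oexpw xi) _ cA.
have c2 := @dit_closed _ (sigma e) (oexpw xi) _ cA.
rewrite dits_rcons => /(dits_mono (@ditI _ _ _ _ _ cA)) /(ditsU c1 c2)[].
  move=> /(IH _ c1)[s1 [s2 [p h1 h2]]]; exists (rcons s1 e), s2; split.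
  - by rewrite -cats1 -catA perm_catCA /= perm_sym perm_rcons perm_cons perm_sym.
  - by rewrite dits_rcons.
  - by apply: dits_mono h2; exact: dit_sub.
move=> /(IH _ c2)[s1 [s2 [p h1 h2]]]; exists s1, (rcons s2 e); split.
- by rewrite -rcons_cat perm_rcons perm_sym perm_rcons perm_cons perm_sym.
- by apply: dits_mono h1; exact: dit_sub.
- by rewrite dits_rcons.
Qed.

Lemma dits_nseq rho xi n e A :
  dits rho xi (nseq n e) A = iter n (dit (rho e) (oexpw xi)) A.
Proof. by elim: n => [//|n IH] /=; rewrite IH. Qed.

End derivation_lists.

Section derivation_list_maps.
Variables (E : eqType) (T U : topologicalType).
Implicit Types (rho : E -> T -> T -> Prop) (sigma : E -> U -> U -> Prop).

Lemma dits_image (f : T -> U) rho sigma xi s A :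
  hausdorff_space U -> compact A -> closed A ->
  (forall a V, A a -> nbhs (f a) V -> nbhs a (fun x => A x -> V (f x))) ->
  (forall e a b, e \in s -> A a -> A b -> rho e a b -> sigma e (f a) (f b)) ->
  dits sigma xi s (f @` A) `<=` f @` dits rho xi s A.
Proof.
move=> hU cA clA cf; elim: s => [|e s IH] rs //=.
apply: subset_trans (dit_mono (IH _)) _.
  by move=> d a b ds; apply: rs; rewrite inE ds orbT.
have DA := @dits_sub _ _ rho xi s A; have cD := @dits_closed _ _ rho xi s _ clA.
apply: dit_image => //.
- exact: subclosed_compact cD cA DA.
- by move=> a V /DA Aa Vfa; apply: filterS (cf a V Aa Vfa) => x h /DA; exact: h.
- by move=> a b /DA Aa /DA Ab; apply: rs => //; rewrite inE eqxx.
Qed.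

Lemma dits_preimage (f : T -> U) sigma xi s A B : continuous f ->
  (forall a, A a -> B (f a)) ->
  dits (fun e a b => sigma e (f a) (f b)) xi s A `<=` f @^-1` dits sigma xi s B.
Proof.
by move=> cf AB; elim: s => [//|e s IH] /=; apply: dit_preimage.
Qed.

End derivation_list_maps.

(** * Comparison with the Szlenk derivation *)

Section szlenk_derivation.
Variables (R : realType) (k : scalars).
Local Notation K := (scalar_field R k).
Variable X : normedModType K.
Local Notation W := (weakstar X).
Implicit Types (L : set W) (e q : R) (xi : ord).

Definition nrel e (a b : W) : Prop := rnorm ((a : dual_space X) - b) <= e.

Lemma nrel_le e d a b : e <= d -> nrel e a b -> nrel d a b.
Proof. by move=> ed h; exact: le_trans ed. Qed.

Lemma der_szlenk_der e L : der (nrel e) L `<=` szlenk_der e L.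
Proof.
move=> x [Lx H]; split=> // V Vx; rewrite ltNge; apply/negP => dV.
apply: (H V Vx); exists unit, (fun=> tt) => a b VLa VLb _.
rewrite /nrel -lee_fin; apply: le_trans dV; apply: ereal_sup_ubound.
by exists (a, b).
Qed.

(** Deleting the finitely many colour classes whose closure misses [x] leaves a neighbourhood in
    which every point is within [e] of [x], since norm balls are weak* closed; hence the factor
    2. *)
Lemma szlenk_der_der e L : szlenk_der (2 * e) L `<=` der (nrel e) L.
Proof.
move=> x [Lx H]; split=> // V Vx [C [c Hc]].
pose A i : set W := [set a | (V `&` L) a /\ c a = i].
pose V' : set W := V `&` [set a | forall i, i \in enum C -> ~ closure (A i) x -> ~ A i a].
have V'x : nbhs (x : W) V'.
  apply: filterI => //; elim: (enum C) => [|i s IH].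
    by apply: filterS (@filterT _ (nbhs (x : W)) _) => a _ i; rewrite in_nil.
  have Wi : nbhs (x : W) [set a | ~ closure (A i) x -> ~ A i a].
    have [clx|nclx] := pselect (closure (A i) x).
      by apply: filterS (@filterT _ (nbhs (x : W)) _) => a _ n.
    have : nbhs (x : W) (~` closure (A i)).
      by apply: open_nbhs_nbhs; split=> //; apply: closed_openC; exact: closed_closure.
    by apply: filterS => a nA _ /subset_closure.
  apply: filterS (filterI Wi IH) => a [ai as_] j.
  by rewrite inE => /predU1P[->|/as_].
have := H _ V'x; rewrite ltNge => /negP; apply.
apply: ge_ereal_sup => _ [[a b] [/= [V'a La] [V'b Lb]] <-]; rewrite lee_fin.
have key y : V' y -> L y -> rnorm ((y : dual_space X) - x) <= e.
  move=> [Vy V'y] Ly; have clx : closure (A (c y)) x.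
    apply: contrapT => n; apply: (V'y (c y) _ n) => //; exact: mem_enum.
  rewrite rnormC; apply: (@closed_weakstar_ball R k X y e).
  apply: closureS clx => z [VLz czy] /=; rewrite rnormC.
  by have := Hc y z; apply.
have := rnorm_triangle (x : dual_space X) a b; have := key a V'a La.
by have := key b V'b Lb; rewrite (rnormC b x); lra.
Qed.

Lemma szlenk_der_mono e L L' : L `<=` L' -> szlenk_der e L `<=` szlenk_der e L'.
Proof.
move=> LL' x [Lx H]; split; first exact: LL'.
move=> V Vx; apply: lt_le_trans (H V Vx) _; apply: ereal_sup_le => _ [p [p1 p2] <-].
by exists p => //; split; apply: setIS LL' _ _.
Qed.

Lemma szlenk_iterE e xi L : szlenk_iter e xi L = oiter (szlenk_der e) xi L.
Proof.
elim: xi => [//|xi IH|J f IH] /=; first by rewrite IH.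
by congr (_ `&` _); apply: eq_bigcapr => i _; exact: IH.
Qed.

Lemma dit_szlenk e xi L : 0 < e -> dit (nrel e) xi L `<=` szlenk e xi L.
Proof.
rewrite ltNge /szlenk => /negbTE ->; rewrite szlenk_iterE.
by apply: oiter_le; [exact: der_szlenk_der|exact: szlenk_der_mono].
Qed.

Lemma szlenk_dit e xi L : 0 < e -> szlenk (2 * e) xi L `<=` dit (nrel e) xi L.
Proof.
move=> e0; rewrite /szlenk leNgt mulr_gt0 //= szlenk_iterE.
by apply: oiter_le; [exact: szlenk_der_der|move=> A B; exact: (@der_mono W)].
Qed.

(** The working form of summability: positive radii, derivation by [nrel], and a bare bound in place
    of [M ^ q]. *)
Definition qsum xi q L := exists M : R, forall s : seq R, all (fun e => 0 < e) s ->
  dits nrel xi s L !=set0 -> \sum_(e <- s) e `^ q <= M.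

Lemma q_summable_qsum xi q L : q_summable xi q L -> qsum xi q L.
Proof.
move=> [M [M0 H]]; exists (M `^ q) => s s0 [x xs]; apply: H.
  by apply: sub_all s0 => e; exact: ltW.
exists x; elim: s s0 x xs => [|e s IH] //= /andP[e0 s0] x xs.
apply: dit_szlenk => //; exact: dit_mono (IH s0) _ xs.
Qed.

Lemma qsum_q_summable xi q L : 0 < q -> qsum xi q L -> q_summable xi q L.
Proof.
move=> q0 [M H]; exists ((2 `^ q * Num.max M 0) `^ q^-1); split; first exact: powR_ge0.
move=> s s0 [x xs].
rewrite -powRrM mulVf ?gt_eqF // powRr1 ?mulr_ge0 ?powR_ge0 ?le_max ?lexx ?orbT //.
(* Zero radii neither derive nor contribute; halving the others passes from diameters to [nrel]. *)
pose s' := [seq e / 2 | e <- [seq e <- s | 0 < e]].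
have -> : \sum_(e <- s) e `^ q = 2 `^ q * \sum_(e <- s') e `^ q.
  rewrite big_map big_filter mulr_sumr [RHS]big_mkcond /= big_seq [RHS]big_seq.
  apply: eq_bigr => e es; have /allP/(_ e es) e0 := s0.
  case: ifPn => [_|]; first by rewrite -powRM ?divr_ge0 // mulrC divfK.
  rewrite -leNgt => e0'; have -> : e = 0 by apply/le_anti/andP.
  by rewrite powR0 ?gt_eqF.
rewrite ler_wpM2l ?powR_ge0 // le_max; apply/orP; left; apply: H.
  by apply/allP => _ /mapP[e + ->]; rewrite mem_filter => /andP[e1 _]; rewrite divr_gt0.
exists x; rewrite /s'; elim: s s0 x xs {s'} => [|e s IH] //= /andP[e0 s0] x xs.
case: ltP => [e0'|e0'] /=; last first.
  by apply: IH => //; move: xs; rewrite /szlenk e0'.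
have h : dit (nrel (e / 2)) (oexpw xi) (foldr (fun e => szlenk e (oexpw xi)) L s : set W) x.
  by apply: szlenk_dit; rewrite ?divr_gt0 // mulrC divfK.
apply: dit_mono h => y; exact: IH.
Qed.

End szlenk_derivation.

Arguments nrel {R k X}.

(** * Convex averages *)

Lemma closure_sub (T : topologicalType) (A B : set T) :
  A `<=` B -> closed B -> closure A `<=` B.
Proof. by move=> AB /closure_id ->; exact: closureS. Qed.

Section averages.
Variables (R : realType) (k : scalars).
Local Notation K := (scalar_field R k).
Variable X : normedModType K.
Local Notation W := (weakstar X).
Implicit Types (A L : set W) (e : R).

Definition prob (J : finType) (l : J -> R) : Prop :=
  (forall i, 0 <= l i) /\ \sum_i l i = 1.

Definition wavg (J : finType) (l : J -> R) (v : J -> W) : dual_space X :=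
  \sum_i scalar_of k (l i) *: (v i : dual_space X).

Lemma wavg_apply (J : finType) (l : J -> R) (v : J -> W) x :
  (wavg l v : dual_space X) x = \sum_i scalar_of k (l i) *: ((v i : dual_space X) x : K^o).
Proof.
rewrite /wavg; elim/big_rec2: _ => [//|i y f _ <-].
by [].
Qed.

Lemma prob_le1 (J : finType) (l : J -> R) i : prob l -> l i <= 1.
Proof.
move=> [l0 <-]; rewrite (bigD1 i) //= lerDl; apply: sumr_ge0 => j _; exact: l0.
Qed.

Lemma scalar_of_sum (J : finType) (P : pred J) (l : J -> R) :
  scalar_of k (\sum_(i | P i) l i) = \sum_(i | P i) scalar_of k (l i).
Proof.
elim/big_rec2: _ => [|i y x _ <-]; first exact: scalar_of0.
by rewrite scalar_ofD.
Qed.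

Lemma rnorm_avg (V : normedModType K) (J : finType) (l : J -> R) (v : J -> V) (a : V) e :
  prob l -> (forall i, rnorm (v i - a) <= e) ->
  rnorm (\sum_i scalar_of k (l i) *: v i - a) <= e.
Proof.
move=> [l0 l1] H.
have -> : \sum_i scalar_of k (l i) *: v i - a = \sum_i scalar_of k (l i) *: (v i - a).
  under [RHS]eq_bigr do rewrite scalerBr.
  by rewrite sumrB -scaler_suml -scalar_of_sum l1 scalar_of1 scale1r.
apply: le_trans (rnorm_sum _ _) _; rewrite -[e]mul1r -l1 mulr_suml.
by apply: ler_sum => i _; rewrite rnormZr // ler_wpM2l.
Qed.

Lemma rnorm_wavg (J : finType) (l : J -> R) (v : J -> W) (a : dual_space X) e :
  prob l -> (forall i, rnorm ((v i : dual_space X) - a) <= e) ->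
  rnorm (wavg l v - a) <= e.
Proof. exact: rnorm_avg. Qed.

(** The level belongs to a representation of [u] as an average, not to [u], which may have
    several. *)
Definition levelconv (phi : W -> R) A (t : R) : set W :=
  [set u | exists (J : finType) (l : J -> R) (v : J -> W),
    [/\ prob l, forall i, A (v i), t <= \sum_i l i * phi (v i) & u = wavg l v]].

Definition clevel phi A t : set W := closure (levelconv phi A t).

(** With [phi = 0] the level condition is void, so convex hulls are level sets too. *)
Definition wconv A : set W := levelconv (fun=> 0) A 0.

Definition clconv A : set W := closure (wconv A).

Lemma sub_wconv A : A `<=` wconv A.
Proof.
move=> a Aa; exists unit, (fun=> 1), (fun=> a); split=> //.
- by split=> // ; rewrite big_const card_unit /= addr0.
- by rewrite big1 // => i _; rewrite mulr0.
- by rewrite /wavg big_const card_unit /= addr0 scalar_of1 scale1r.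
Qed.

Lemma wconvI (J : finType) (l : J -> R) (v : J -> W) A :
  prob l -> (forall i, A (v i)) -> wconv A (wavg l v).
Proof. by move=> pl Av; exists J, l, v; split=> //; rewrite big1 // => i _; rewrite
    mulr0. Qed.

Lemma clconv_ball A (a : dual_space X) e :
  (forall y : W, A y -> rnorm ((y : dual_space X) - a) <= e) ->
  forall y : W, clconv A y -> rnorm ((y : dual_space X) - a) <= e.
Proof.
move=> H; apply: closure_sub; last exact: closed_weakstar_ball.
by move=> _ [J [l [v [pl Av _ ->]]]]; apply: rnorm_wavg => // i; exact: H.
Qed.

Lemma partition_avg (J M : finType) (c : J -> M) (l : J -> R) (h : M -> R) :
  \sum_i l i * h (c i) = \sum_m (\sum_(i | c i == m) l i) * h m.
Proof.
rewrite (partition_big c predT) //=; apply: eq_bigr => m _.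
by rewrite mulr_suml; apply: eq_bigr => i /eqP ->.
Qed.

Lemma prob_partition (J M : finType) (c : J -> M) (l : J -> R) :
  prob l -> prob (fun m => \sum_(i | c i == m) l i).
Proof.
move=> [l0 l1]; split=> [m|]; first by apply: sumr_ge0 => i _.
by rewrite -l1 (partition_big c predT).
Qed.

(** Normalising the weights inside a class of positive mass gives a point of the hull of that class.
    A class of mass zero may be empty and receives 0, which is why 0 is adjoined to the sets [G]
    below. *)
Lemma wavg_partition (J M : finType) (c : J -> M) (l : J -> R) (v : J -> W)
    (A : M -> set W) : prob l -> (forall i, A (c i) (v i)) ->
  exists x : M -> W, (forall m, (wconv (A m) `|` [set (0 : dual_space X)]) (x m)) /\
    wavg l v = wavg (fun m => \sum_(i | c i == m) l i) x.
Proof.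
move=> pl Av; pose w m := \sum_(i | c i == m) l i.
pose l' m i := if c i == m then l i / w m else 0.
have w0 m : 0 <= w m by apply: sumr_ge0 => i _; case: pl.
have sw m (F : J -> dual_space X) : w m != 0 ->
    scalar_of k (w m) *: (\sum_(i | c i == m) scalar_of k (l i / w m) *: F i) =
    \sum_(i | c i == m) scalar_of k (l i) *: F i.
  move=> wm; rewrite scaler_sumr; apply: eq_bigr => i _.
  by rewrite scalerA -scalar_ofM mulrC divfK.
pose x m : W := \sum_(i | c i == m) scalar_of k (l i / w m) *: (v i : dual_space X).
exists x; split=> [m|]; last first.
  rewrite /wavg (partition_big c predT) //=; apply: eq_bigr => m _.
  have [wm|wm] := eqVneq (w m) 0; last by rewrite -[\sum_(_ | _) l _]/(w m) sw.
  rewrite -[\sum_(_ | _) l _]/(w m) wm scalar_of0 scale0r; apply: big1 => i ci.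
  have /eqP := wm; rewrite psumr_eq0 => [/allP/(_ i (mem_index_enum _))|j _]; last by
      case: pl.
  by rewrite ci => /eqP ->; rewrite scalar_of0 scale0r.
have [wm|wm] := eqVneq (w m) 0.
  right; apply: big1 => i _; rewrite wm invr0 mulr0 scalar_of0 scale0r //.
have [i0 ci0] : exists i, c i == m.
  apply: contrapT => n; case/eqP: wm; apply: big1 => i ci; case: n; by exists i.
left; have -> : x m = wavg (fun i => if c i == m then l i / w m else 0)
    (fun i => if c i == m then v i else v i0).
  rewrite /x /wavg big_mkcond /=; apply: eq_bigr => i _.
  by case: ifP => // _; rewrite scalar_of0 scale0r.
apply: wconvI; first split=> [i|].
- by case: ifP => // _; rewrite divr_ge0 //; case: pl.
- by rewrite -big_mkcond /= -mulr_suml divff.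
- by move=> i; case: ifP => [/eqP <-|_] //; rewrite -(eqP ci0).
Qed.

End averages.

(** * Mixtures of finitely many sets *)

Section mixtures.
Variables (R : realType) (k : scalars).
Local Notation K := (scalar_field R k).
Variable X : normedModType K.
Local Notation W := (weakstar X).

Lemma cvg_bigsum (L : numFieldType) (V : normedModType L) (T : Type)
    (F : set_system T) (J : finType) (f : J -> T -> V) (l : J -> V) :
  Filter F -> (forall i, f i @ F --> l i) ->
  (fun t => \sum_i f i t) @ F --> \sum_i l i.
Proof.
move=> FF H; elim: (index_enum J) => [|i s IH].
  by under eq_fun do rewrite big_nil; rewrite big_nil; exact: cvg_cst.
under eq_fun do rewrite big_cons; rewrite big_cons; exact: cvgD.
Qed.

(** The weights of a mixture range over a totally bounded set, so they cost no derivation. *)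
Lemma fincol_unit_box (M : finType) (tau : R) : 0 < tau ->
  fincol (fun a b : M -> R => forall m, `|a m - b m| <= tau)
    [set a | forall m, 0 <= a m <= 1].
Proof.
move=> t0; pose N := Num.truncn tau^-1.
exists {ffun M -> 'I_N.+1}, (fun a => [ffun m => inord (Num.truncn (a m / tau))]).
move=> a b Ha Hb /ffunP ab m; have := ab m; rewrite !ffunE.
have H (c : M -> R) : (forall m, 0 <= c m <= 1) -> [/\ 0 <= c m / tau,
    (Num.truncn (c m / tau))%:R <= c m / tau,
    c m / tau < (Num.truncn (c m / tau)).+1%:R & (Num.truncn (c m / tau) < N.+1)%N].
  move=> /(_ m)/andP[c0 c1]; have cp : 0 <= c m / tau by rewrite divr_ge0 // ltW.
  have /andP[h1 h2] := truncn_itv cp; split=> //.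
  by rewrite ltnS le_truncn // ler_pdivrMr // mulVf ?gt_eqF.
have [_ a1 a2 a3] := H a Ha; have [_ b1 b2 b3] := H b Hb.
move=> /(congr1 (fun i : 'I_N.+1 => i : nat)); rewrite !inordK // => e.
rewrite e in a1 a2.
have -> : a m - b m = (a m / tau - b m / tau) * tau by rewrite mulrBl !divfK ?gt_eqF.
rewrite normrM (gtr0_norm t0) ger_pMl // ler_norml.
move: a1 a2 b1 b2; rewrite -natr1; set p := _%:R; lra.
Qed.

Lemma wavg_close (M : finType) (w w' r : M -> R) (x x' : M -> W) (tau D : R) :
  (forall m, 0 <= w m) -> 0 <= tau ->
  (forall m, rnorm (x' m : dual_space X) <= D) ->
  (forall m, `|w m - w' m| <= tau) -> (forall m, nrel (r m) (x m) (x' m)) ->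
  rnorm (wavg w x - wavg w' x') <= \sum_m w m * r m + tau * D * #|M|%:R.
Proof.
move=> w0 tau0 xD ww xx.
have -> : wavg w x - wavg w' x' = \sum_m (scalar_of k (w m) *: ((x m : dual_space X) - x' m)
    + scalar_of k (w m - w' m) *: (x' m : dual_space X)).
  rewrite /wavg -sumrB; apply: eq_bigr => m _.
  by rewrite scalerBr scalar_ofB scalerBl addrA subrK.
apply: le_trans (rnorm_sum _ _) _.
rewrite -sum1_card natr_sum mulr_sumr -big_split /=; apply: ler_sum => m _.
apply: le_trans (rnormD _ _) _; rewrite rnormZr // mulr1 lerD //.
  by rewrite ler_wpM2l //; exact: xx.
by rewrite rnormZ rnorm_scalar_of ler_pM ?rnorm_ge0.
Qed.

(** The relation [sig] joins all the [nrel (r m)] in the components with closeness of the weights;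
    each part vanishes after [omega ^ xi] derivations, hence so does the conjunction. Parameters
    related by [sig] have averages at distance at most the mean radius plus [tau * D' * #|M|]. *)
Lemma mix_image (T : topologicalType) (M : finType) xi (r : M -> R) (e eta D : R)
    (A : set T) (wt : T -> M -> R) (pt : T -> M -> W) :
  0 < eta -> compact A -> closed A ->
  (forall m, continuous (wt^~ m)) -> (forall m, continuous (pt^~ m)) ->
  (forall t, A t -> prob (wt t) /\ \sum_m wt t m * r m <= e) ->
  (forall t m, A t -> rnorm (pt t m : dual_space X) <= D) ->
  (forall m, dit (fun t t' => nrel (r m) (pt t m) (pt t' m)) (oexpw xi) A = set0) ->
  let F : set W := (fun t => wavg (wt t) (pt t) : W) @` A in
  closed F /\ dit (nrel (e + eta)) (oexpw xi) F = set0.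
Proof.
move=> eta0 cA clA cw cp pA GA dA F.
have cPhi : continuous (fun t => wavg (wt t) (pt t) : W).
  move=> t; apply: cvg_weakstar => x.
  under eq_fun do rewrite wavg_apply.
  rewrite wavg_apply; apply: cvg_bigsum => m; apply: cvgZ.
    by apply: scalar_of_cvg; exact: cw.
  exact: cvg_comp (cp m t) (@weakstar_eval _ _ X x (pt t m)).
have hW := @weakstar_hausdorff _ _ X.
split.
  apply: compact_closed => //; apply: continuous_compact => //.
  exact: continuous_subspaceT.
pose D' := Num.max D 0.
have D'0 : 0 <= D' by rewrite le_max lexx orbT.
(* Chosen so that [tau * D' * #|M| <= eta]; the [+ 1] keeps [C] positive. *)
pose C := D' * #|M|%:R + 1.
have C0 : 0 < C by rewrite ltr_wpDl // mulr_ge0.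
pose tau := eta / C.
have tau0 : 0 < tau by rewrite divr_gt0.
pose sig (t t' : T) := (forall m, nrel (r m) (pt t m) (pt t' m)) /\
  (forall m, `|wt t m - wt t' m| <= tau).
have sub : dit (nrel (e + eta)) (oexpw xi) F `<=`
    (fun t => wavg (wt t) (pt t) : W) @` dit sig (oexpw xi) A.
  apply: dit_image => //.
    move=> a V Aa Va; have : nbhs a ((fun t => wavg (wt t) (pt t) : W) @^-1` V) := cPhi
        a V Va.
    by apply: filterS => t Vt _.
  move=> a b Aa Ab [h1 h2]; rewrite /nrel.
  have [[w0 _] we] := pA a Aa.
  apply: le_trans (@wavg_close M _ _ r _ _ tau D' w0 (ltW tau0) _ h2 h1) _.
    by move=> m; rewrite le_max GA.
  rewrite lerD // -mulrA /tau -mulrA ger_pMr // mulrC ler_pdivrMr // mul1r.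
  by rewrite /C lerDl.
rewrite -subset0; apply: subset_trans sub _.
rewrite (_ : dit _ _ _ = set0) ?image_set0 //.
apply: ditI_empty => //; first exact: dit_forall_empty.
apply: dit_fincol.
apply: (@fincol_preimage _ _ wt (fun a b : M -> R => forall m, `|a m - b m| <= tau) _ _
    _ (fincol_unit_box M tau0)).
move=> t /pA[pt1 _] m; rewrite (prob_le1 m pt1) andbT; by case: pt1.
Qed.

(** [F] is the image of the compact set of all admissible weights and components: one closed set
    absorbs every mixture of mean radius at most [e], and with them their limits. *)
Lemma mix_empty (M : finType) xi (r : M -> R) (e eta D : R) (G : M -> set W) :
  0 < eta ->
  (forall m, closed (G m)) ->
  (forall m (f : W), G m f -> rnorm (f : dual_space X) <= D) ->
  (forall m, dit (nrel (r m)) (oexpw xi) (G m) = set0) ->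
  exists F : set W, [/\ closed F, dit (nrel (e + eta)) (oexpw xi) F = set0 &
    forall (w : M -> R) (x : M -> W), prob w -> \sum_m w m * r m <= e ->
      (forall m, G m (x m)) -> F (wavg w x)].
Proof.
move=> eta0 cG GD dG.
pose T : topologicalType := prod_topology (fun _ : M => (R * W)%type).
have [H1 H2] : (forall m, continuous (fun t : T => ((t : M -> R * W) m).1)) /\
    (forall m, continuous (fun t : T => ((t : M -> R * W) m).2 : W)).
  have cT m : continuous (fun t : T => (t : M -> R * W) m : (R * W)%type) by exact:
      proj_continuous.
  split=> m t; apply: (@cvg_comp _ _ _ _ _ _ _ _ (cT m t)); [exact: cvg_fst|exact: cvg_snd].
have cB : compact ([set t : T | forall m, (`[0, 1] `*` G m) ((t : M -> R * W) m)]).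
  have H m : compact (`[0%R, 1%R]%classic `*` G m : set (R * W)%type).
    apply: compact_setX; first exact: segment_compact.
    by apply: subclosed_compact (@compact_weakstar_ball _ _ X D) _ => // f; exact: GD.
  exact: (@tychonoff M (fun _ => (R * W)%type) _ H).
pose ctor (w : M -> R) (x : M -> W) : T := fun m => (w m, x m).
pose wt (t : T) m : R := ((t : M -> R * W) m).1.
pose pt (t : T) m : W := ((t : M -> R * W) m).2.
have e1 w x m : wt (ctor w x) m = w m by [].
have e2 w x m : pt (ctor w x) m = x m by [].
have {cB} : compact [set t : T | forall m, 0 <= wt t m <= 1 /\ G m (pt t m)].
  congr (compact _) : cB; apply/seteqP; split=> t /= H m; have := H m; rewrite /=
      in_itv //=.
have {}H1 : forall m, continuous (wt^~ m) by [].
have {}H2 : forall m, continuous (pt^~ m) by [].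
move: T wt pt ctor H1 H2 e1 e2 => T wt pt ctor cw cp e1 e2 cB.
pose B := [set t : T | forall m, 0 <= wt t m <= 1 /\ G m (pt t m)].
have cle (a : R) (h : M -> R) : closed [set t | \sum_m wt t m * h m <= a].
  have ch : continuous (fun t => \sum_m wt t m * h m).
    by move=> t; apply: cvg_bigsum => m; apply: cvgMr_tmp; exact: cw.
  by apply: (@closed_comp _ _ _ [set x | x <= a]) => [t _|]; [exact: ch|exact: closed_le].
have cge (a : R) (h : M -> R) : closed [set t | a <= \sum_m wt t m * h m].
  have ch : continuous (fun t => \sum_m wt t m * h m).
    by move=> t; apply: cvg_bigsum => m; apply: cvgMr_tmp; exact: cw.
  by apply: (@closed_comp _ _ _ [set x | a <= x]) => [t _|]; [exact: ch|exact: closed_ge].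
(* The equation for the total mass is split into two inequalities, with coefficients [1] so that
   [cle] and [cge] apply. *)
pose A := B `&` ([set t | \sum_m wt t m * 1 <= 1] `&` [set t | 1 <= \sum_m wt t m * 1]
   `&` [set t | \sum_m wt t m * r m <= e]).
have cA : compact A by apply: compact_closedI => //; do ?apply: closedI.
have clB : closed B.
  rewrite (_ : B = \bigcap_m ([set t | 0 <= wt t m] `&` [set t | wt t m <= 1] `&` pt^~
      m @^-1` G m)).
    apply: closed_bigI => m _; apply: closedI; first apply: closedI.
    - by apply: (@closed_comp _ _ (wt^~ m) [set x | 0 <= x]) => [t _|]; [exact:
        cw|exact: closed_ge].
    - by apply: (@closed_comp _ _ (wt^~ m) [set x | x <= 1]) => [t _|]; [exact:
        cw|exact: closed_le].
    - by apply: closed_comp => // t _; exact: cp.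
  apply/seteqP; split=> t H m; first by move=> _; have [/andP[h1 h2] h3] := H m.
  by have [[h1 h2] h3] := H m I; rewrite h1 h2.
have clA : closed A by apply: closedI => //; do ?apply: closedI.
have [| | |clF dF] := @mix_image T M xi r e eta D A wt pt eta0 cA clA cw cp.
- move=> t [Bt [[h1 h2] h3]]; split=> //; split=> [m|]; first by have [/andP[]] := Bt m.
  have E : \sum_m wt t m * 1 = \sum_m wt t m by apply: eq_bigr => m _; rewrite mulr1.
  by apply/le_anti/andP; split; rewrite -E.
- by move=> t m [Bt _]; have [_ /GD] := Bt m.
- move=> m; rewrite -subset0 => t H.
  have : dit (nrel (r m)) (oexpw xi) (G m) (pt t m).
    by apply: (@dit_preimage _ _ (pt^~ m) (nrel (r m)) _ A) H => // s [Bs _]; have []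
        := Bs m.
  by rewrite dG.
- exists ((fun t => wavg (wt t) (pt t) : W) @` A); split=> // w x pw we Gx.
  exists (ctor w x); last first.
    by congr (wavg _ _); apply/funext => m; rewrite ?e1 ?e2.
  have ew h : \sum_m wt (ctor w x) m * h m = \sum_m w m * h m.
    by apply: eq_bigr => m _; rewrite e1.
  case: (pw) => w0 w1; split; last first.
    have E : \sum_m w m * 1 = 1 by rewrite -[RHS]w1; apply: eq_bigr => m _; rewrite mulr1.
    by rewrite /= !ew E; split.
  by move=> m; rewrite e1 e2 w0 (prob_le1 m pw).
Qed.

End mixtures.

(** * One derivation of a convex hull *)

Section convex_step.
Variables (R : realType) (k : scalars).
Local Notation K := (scalar_field R k).
Variable X : normedModType K.
Local Notation W := (weakstar X).
Implicit Types (L : set W) (e D : R) (xi : ord).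

Definition wbounded L := exists D : R, forall f : W, L f -> rnorm (f : dual_space X) <= D.

Lemma wbounded_sub L L' : L `<=` L' -> wbounded L' -> wbounded L.
Proof. by move=> LL' [D H]; exists D => f /LL'; exact: H. Qed.

Lemma wbounded_compact L : closed L -> wbounded L -> compact L.
Proof.
by move=> cL [D H]; apply: subclosed_compact (@compact_weakstar_ball _ _ X D) _.
Qed.

Lemma clconv_bounded L D : (forall f : W, L f -> rnorm (f : dual_space X) <= D) ->
  forall f : W, clconv L f -> rnorm (f : dual_space X) <= D.
Proof.
move=> H f Lf; have := @clconv_ball _ _ X L 0 D _ f Lf.
by rewrite subr0; apply => y /H; rewrite subr0.
Qed.

Lemma fincol_set1 (T : Type) (rho : T -> T -> Prop) a : rho a a -> fincol rho [set a].
Proof. by move=> raa; exists unit, (fun=> tt) => x y -> ->. Qed.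

Lemma dit_setU0 e xi L : 0 <= e -> closed L -> dit (nrel e) (oexpw xi) L = set0 ->
  let L' := (L `|` [set (0 : dual_space X)] : set W) in
  closed L' /\ dit (nrel e) (oexpw xi) L' = set0.
Proof.
move=> e0 cL dL; have c0 : closed [set (0 : dual_space X) : W].
  apply: accessible_closed_set1; apply: hausdorff_accessible.
  exact: weakstar_hausdorff.
split; first exact: closedU.
rewrite -subset0; apply: subset_trans (@ditU W _ _ _ _ cL c0) _.
rewrite dL set0U (@dit_fincol W) //; apply: fincol_set1.
by rewrite /nrel subrr rnorm0.
Qed.

(* The loss [eta] is additive and arbitrarily small, so that it does not
   accumulate along a transfinite induction on [xi]. *)
Definition conv_stable xi := forall L e eta, 0 <= e -> 0 < eta -> closed L ->
  wbounded L -> dit (nrel e) (oexpw xi) L = set0 ->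
  dit (nrel (e + eta)) (oexpw xi) (clconv L) = set0.

(** As [omega ^ 0 = 1], the compact set [L] has a finite colouring. The hull of a colour class has
    diameter at most [e], since balls are convex and weak* closed, and the closed hull of [L]
    consists of limits of mixtures of these hulls. *)
Lemma conv_stable0 : conv_stable ozero.
Proof.
move=> L e eta e0 eta0 cL bL dL.
have cpL := wbounded_compact cL bL; have [D HD] := bL.
have : fincol (nrel e) L.
  apply: (@compact_local W (fincol (nrel e))) => //.
  - exact: fincol0.
  - by move=> A B; exact: fincolS.
  - by move=> A B; exact: fincolU.
  - move=> x Lx; apply: contrapT => n; suff : set0 x by [].
    by rewrite -dL; split=> // V Vx cV; apply: n; exists V.
move=> [C [c Hc]].
pose A i : set W := [set a | L a /\ c a = i].
pose G i : set W := clconv (A i) `|` [set (0 : dual_space X)].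
have Ge i : closed (G i) /\ dit (nrel e) (oexpw ozero) (G i) = set0.
  apply: dit_setU0 => //; first exact: closed_closure.
  apply: fincol_der; exists unit, (fun=> tt) => u v Au Av _.
  rewrite /nrel rnormC; apply: (clconv_ball _ Av) => a Aa; rewrite rnormC.
  by apply: (clconv_ball _ Au) => b Ab; apply: Hc; [case: Ab|case: Aa|case: Ab Aa => _
      -> []].
have [m f|F [cF dF HF]] := @mix_empty _ _ X C ozero (fun=> e) e eta (Num.max D 0) G eta0
  (fun i => (Ge i).1) _ (fun i => (Ge i).2).
  case=> [Af|->]; last by rewrite rnorm0 le_max lexx orbT.
  by rewrite le_max; apply/orP; left; apply: clconv_bounded Af => y [/HD].
rewrite -subset0 -dF; apply: dit_mono; apply: closure_sub => //.
move=> _ [J [l [v [pl Lv _ ->]]]].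
have [x [Gx ->]] := @wavg_partition _ _ X J C (fun i => c (v i)) l v A pl (fun i =>
    conj (Lv i) erefl).
apply: HF; first exact: prob_partition.
  by rewrite -mulr_suml (prob_partition _ pl).2 mul1r.
by move=> m; have [cx|->] := Gx m; [left; apply: subset_closure|right].
Qed.

(* Cover [L] by small neighbourhoods of points [z m].  If [u] averages points of
   [L] with [phi]-mean at least [t], moving the mass to the [z m] raises that mean by
   at least the mean of [g].  Either the result is a point of level [t + theta]
   near [u], or the mean of [g] is below [theta] and [u] is a mixture, with mean
   radius at most [e], of points of the sets [B m j]. *)
Lemma convex_step xi L (phi : W -> R) (J : finType) (r g : J -> R) e theta eta t :
  conv_stable xi -> closed L -> wbounded L -> (forall j, 0 <= r j) ->
  (forall z, L z -> exists B : J -> set W,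
    (forall j, [/\ closed (B j), B j `<=` L & dit (nrel (r j)) (oexpw xi) (B j) = set0]) /\
    exists2 V, nbhs z V & forall y, V y -> L y -> exists j, B j y /\ phi y + g j <= phi
        z) ->
  (forall w : J -> R, prob w -> \sum_j w j * g j < theta -> \sum_j w j * r j <= e) ->
  0 < eta ->
  dit (nrel (e + eta)) (oexpw xi) (clevel phi L t) `<=` clevel phi L (t + theta).
Proof.
move=> P cL bL r0 HB Hw eta0 x xd; apply: contrapT => nx.
have cpL := wbounded_compact cL bL; have [D HD] := bL.
(* A box around [x] that misses the higher level. Half of [rr] is for the distance from [u] to [x],
   half for moving the mass of [u] to the centres. *)
have [|s [rr [rr0 Hs]]] := @weakstar_nbhs _ _ X x (~` clevel phi L (t + theta)).
  by apply: open_nbhs_nbhs; split=> //; apply: closed_openC; exact: closed_closure.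
pose N (f : W) : set W := [set u | forall y, y \in s ->
  rnorm ((u : dual_space X) y - (f : dual_space X) y) <= rr / 2].
have Nn f : nbhs f (N f).
  have : 0 < rr / 2 by rewrite divr_gt0.
  rewrite /N; elim: s {Hs N} => [|y s IH] h.
    by apply: filterS (@filterT _ (nbhs (f : W)) _) => a _ i; rewrite in_nil.
  apply: filterS (filterI (IH h) (weakstar_near f y h)) => u [us uy] z.
  by rewrite inE => /predU1P[->|/us//]; exact: ltW.
pose good (z : W) (B : J -> set W) := L z /\
    forall j, [/\ closed (B j), B j `<=` L & dit (nrel (r j)) (oexpw xi) (B j) = set0].
have [M [z [B [gB cov]]]] : exists (M : finType) (z : M -> W) (B : M -> J -> set W),
    (forall m, good (z m) (B m)) /\
    forall y, L y -> exists m j, [/\ N (z m) y, B m j y & phi y + g j <= phi (z m)].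
  apply: (@compact_local W (fun S => exists (M : finType) (z : M -> W) (B : M -> J ->
      set W),
    (forall m, good (z m) (B m)) /\
    forall y, S y -> exists m j, [/\ N (z m) y, B m j y & phi y + g j <= phi (z m)])) => //.
  - by exists void, (@of_void _), (@of_void _); split => [[]|].
  - by move=> S S' SS' [M [z [B [gB H]]]]; exists M, z, B; split=> // y /SS'; exact: H.
  - move=> S S' [M [z [B [gB H]]]] [M' [z' [B' [gB' H']]]].
    exists (M + M')%type, (fun m => match m with inl a => z a | inr b => z' b end),
      (fun m => match m with inl a => B a | inr b => B' b end); split=> [[]|] //.
    move=> y [/H[m [j h]]|/H'[m [j h]]]; first by exists (inl m), j.
    by exists (inr m), j.
  - move=> z Lz; have [B [HBj [V Vz HV]]] := HB z Lz.
    exists (V `&` N z); first exact: filterI.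
    exists unit, (fun=> z), (fun=> B); split=> [_|y [[Vy Ny] Ly]]; first by split.
    by have [j [h1 h2]] := HV y Vy Ly; exists tt, j.
pose G (p : M * J) : set W := clconv (B p.1 p.2) `|` [set (0 : dual_space X)].
(* One half of [eta] pays for the hulls of the pieces, the other for the mixture. *)
have eta4 : 0 < eta / 2 by rewrite divr_gt0.
have Ge p : closed (G p) /\ dit (nrel (r p.2 + eta / 2)) (oexpw xi) (G p) = set0.
  have [Lz /(_ p.2)[cB BL dB]] := gB p.1.
  apply: dit_setU0; [by rewrite addr_ge0 // ltW|exact: closed_closure|].
  by apply: P => //; exact: wbounded_sub bL.
have [p f|F [cF dF HF]] := @mix_empty _ _ X (M * J)%type xi (fun p => r p.2 + eta / 2)
    (e + eta / 2)
   (eta / 2) (Num.max D 0) G eta4 (fun p => (Ge p).1) _ (fun p => (Ge p).2).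
  case=> [Af|->]; last by rewrite rnorm0 le_max lexx orbT.
  rewrite le_max; apply/orP; left; apply: clconv_bounded Af => y By.
  by apply: HD; have [_ /(_ p.2)[_ + _]] := gB p.1; apply.
have key u : levelconv phi L t u -> N x u -> F u.
  move=> [I0 [l [v [pl Lv tv ->]]]] Nu.
  have [c Hc] : exists c : I0 -> M * J, forall i, [/\ N (z (c i).1) (v i),
      B (c i).1 (c i).2 (v i) & phi (v i) + g (c i).2 <= phi (z (c i).1)].
    have H i : exists p : M * J, [/\ N (z p.1) (v i), B p.1 p.2 (v i) &
        phi (v i) + g p.2 <= phi (z p.1)].
      by have [m [j h]] := cov _ (Lv i); exists (m, j).
    by exists (fun i => sval (cid (H i))) => i; exact: svalP (cid (H i)).
  have l0 i : 0 <= l i by case: pl.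
  (* Otherwise the average of the centres would be a point of level [t + theta] in the box around
     [x]. *)
  have lz : \sum_i l i * phi (z (c i).1) < t + theta.
    rewrite ltNge; apply/negP => ht.
    apply: (Hs (wavg l (fun i => z (c i).1))); last first.
      apply: subset_closure; exists I0, l, (fun i => z (c i).1); split=> // i.
      by have [] := gB (c i).1.
    move=> y ys; apply: le_trans (rnorm_triangle (wavg l v y) _ _) _.
    rewrite [rr]splitr lerD //; last exact: Nu.
    have -> : wavg l (fun i => z (c i).1) y - wavg l v y =
      \sum_i scalar_of k (l i) *: ((z (c i).1 : dual_space X) y - (v i : dual_space X)
          y : K^o) - 0.
      rewrite subr0 !wavg_apply -sumrB; apply: eq_bigr => i _; by rewrite scalerBr.
    apply: rnorm_avg => // i; rewrite subr0 rnormC.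
    by have [h _ _] := Hc i; exact: h.
  have lg : \sum_i l i * g (c i).2 < theta.
    have : \sum_i l i * (phi (v i) + g (c i).2) <= \sum_i l i * phi (z (c i).1).
      by apply: ler_sum => i _; rewrite ler_wpM2l //; have [] := Hc i.
    under eq_bigr do rewrite mulrDr.
    by rewrite big_split /=; move: tv lz; lra.
  have lr : \sum_i l i * r (c i).2 <= e.
    rewrite (partition_avg (fun i => (c i).2)); apply: Hw; first exact: prob_partition.
    by rewrite -(partition_avg (fun i => (c i).2)).
  have [y [Gy ->]] := @wavg_partition _ _ X I0 (M * J)%type c l v (fun p => B p.1 p.2) pl
    (fun i => let: And3 _ h _ := Hc i in h).
  apply: HF; first exact: prob_partition.
    rewrite -(partition_avg c l (fun p => r p.2 + eta / 2)).
    under eq_bigr do rewrite mulrDr.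
    by rewrite big_split /= -mulr_suml (pl.2) mul1r lerD2r.
  by move=> m; have [cx|->] := Gy m; [left; apply: subset_closure|right].
(* Near [x] the points of level [t] are limits of averages in [N x], so they lie in the closed set
   [F], and derivation is local. *)
have := Nn x; rewrite nbhsE => -[U [oU Ux] UN].
suff : dit (nrel (e + eta)) (oexpw xi) F x by rewrite (_ : e + eta = e + eta / 2 + eta
    / 2) ?dF // -addrA -splitr.
apply: (@dit_mono W _ _ (clevel phi L t `&` U)); last by apply: dit_local.
move=> y [cy Uy]; apply: cF => V Vy.
have [u [lu [Vu Uu]]] := cy (V `&` U) (filterI Vy (open_nbhs_nbhs (conj oU Uy))).
by exists u; split=> //; apply: key => //; exact: UN.
Qed.

End convex_step.

(** * Convex hulls and the index [omega ^ xi] *)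

Section conv_stability.
Variables (R : realType) (k : scalars).
Local Notation K := (scalar_field R k).
Variable X : normedModType K.
Local Notation W := (weakstar X).
Implicit Types (L : set W) (e D : R) (xi : ord).

Lemma clconv_clevel (phi : W -> R) L : (forall y, L y -> 0 <= phi y) ->
  clconv L `<=` clevel phi L 0.
Proof.
move=> phi0; apply: closureS => _ [J [l [v [pl Lv _ ->]]]].
exists J, l, v; split=> //; apply: sumr_ge0 => i _.
by rewrite mulr_ge0 ?phi0 //; case: pl.
Qed.

Lemma clevel_empty (phi : W -> R) L t M : (forall y, L y -> phi y <= M) -> M < t ->
  clevel phi L t = set0.
Proof.
move=> HM Mt; rewrite /clevel (_ : levelconv _ _ _ = set0) ?closure0 //.
rewrite -subset0 => u [J [l [v [[l0 l1] Lv tv _]]]].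
suff : t <= M by rewrite leNgt Mt.
apply: le_trans tv _; rewrite -[M]mul1r -l1 mulr_suml.
by apply: ler_sum => i _; rewrite ler_wpM2l ?HM.
Qed.

(** Points near [z] either keep its depth and lie in a piece vanishing at radius [e], or lose a unit
    of depth and are only known to lie in [L]. Mass of the second kind below [theta] adds at most
    [eta / 2] to the mean radius, so each derivation of the hull raises the level by [theta], while
    depths stay below [n]. *)
Lemma conv_stable_succ xi : conv_stable X xi -> conv_stable X (osucc xi).
Proof.
move=> P L e eta e0 eta0 cL bL dL; have [D HD] := bL.
have cpL := wbounded_compact cL bL.
have [n An] := dit_expS_empty cpL cL dL.
pose A i := iter i (dit (nrel e) (oexpw xi)) L.
have Ale i j : (i <= j)%N -> A j `<=` A i by exact: iter_dit_le.
(* [h y] is the number of derivations of order [omega ^ xi] that [y] survives. *)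
have [h Hh] : exists h : W -> nat, forall y, L y -> [/\ A (h y) y, ~ A (h y).+1 y & (h
    y < n)%N].
  have H y : exists b, L y -> [/\ A b y, ~ A b.+1 y & (b < n)%N].
    have [Ly|] := pselect (L y); last by exists 0%N.
    have ex : exists b, `[< ~ A b y >] by exists n; apply/asboolP; rewrite /A An.
    case: (ex_minnP ex) => -[|b] /asboolP Ab min; first by case: Ab.
    exists b => _; split=> //.
      by apply: contrapT => nb; have := min b; rewrite ltnn => h; apply/negP: (h
          (asboolT nb)).
    rewrite ltnNge; apply/negP => nb; have := min n.
    rewrite leqNgt ltnS nb => h; suff : false by [].
    by apply: h; apply/asboolP; rewrite /A An.
  by exists (fun y => sval (cid (H y))) => y; exact: svalP (cid (H y)).
pose phi y : R := (h y)%:R.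
pose D' := Num.max D 0.
have D'0 : 0 <= D' by rewrite le_max lexx orbT.
(* Makes [theta * (2 * D') <= eta / 2], where [2 * D'] bounds the diameter of [L]; the [+ 1] covers
   [D' = 0]. *)
pose theta := eta / 2 / (2 * D' + 1).
have p0 : 0 < 2 * D' + 1 by rewrite ltr_wpDl // mulr_ge0.
have theta0 : 0 < theta by rewrite !divr_gt0.
pose r b : R := if b then e else 2 * D'.
pose g b : R := if b then 0 else 1.
have step t : dit (nrel (e + eta)) (oexpw xi) (clevel phi L t) `<=` clevel phi L (t +
    theta).
  rewrite [eta]splitr addrA; apply: (@convex_step _ _ _ xi L phi _ r g) => //.
  - by case=> //=; rewrite mulr_ge0.
  - move=> z Lz; have [Az nAz hz] := Hh z Lz.
    have cA := @iter_dit_closed W (nrel e) (oexpw xi) (h z) L cL.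
    have [|F Fz [cF FA dF]] := @dit_closed_local W (nrel e) (oexpw xi) (A (h z)) z _ cA nAz.
      by move=> V; exact: weakstar_regular.
    exists (fun b : bool => if b then A (h z) `&` F else L); split.
      case=> /=; split=> //; first exact: closedI.
        by move=> y [/iter_dit_sub].
      apply: dit_fincol; exists unit, (fun=> tt) => a b La Lb _.
      rewrite /nrel; apply: le_trans (rnormD _ _) _; rewrite rnormN mulr_natl mulr2n.
      by rewrite lerD // le_max HD.
    exists F => // y Fy Ly; have [Ay nAy hy] := Hh y Ly.
    have [Azy|nAzy] := pselect (A (h z) y).
      exists true; split=> //; rewrite /= addr0 /phi ler_nat leqNgt; apply/negP => lt.
      by apply: (FA y Fy); exact: (Ale _ _ lt).
    exists false; split=> //=; rewrite /phi natr1 ler_nat ltnNge; apply/negP => le.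
    exact/nAzy/(Ale _ _ le).
  - move=> w [w0 w1]; rewrite !big_bool /= mulr0 add0r mulr1 => wt.
    rewrite lerD //; first by rewrite ler_piMl // -w1 big_bool /= lerDl.
    apply: le_trans (_ : theta * (2 * D' + 1) <= _); last by rewrite /theta divfK ?gt_eqF.
    by rewrite ler_pM ?mulr_ge0 // ?(ltW wt) // lerDl.
  - by rewrite divr_gt0.
have iterC m : iter m (dit (nrel (e + eta)) (oexpw xi)) (clconv L) `<=`
    clevel phi L (m%:R * theta).
  elim: m => [|m IHm] /=.
    by rewrite mul0r; apply: clconv_clevel => y _; exact: ler0n.
  apply: subset_trans (@dit_mono W _ _ _ _ IHm) _.
  by rewrite -natr1 mulrDl mul1r; exact: step.
pose m := (Num.truncn (n%:R / theta)).+1.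
have mt : n%:R < m%:R * theta.
  rewrite -ltr_pdivrMr //; have /truncn_itv/andP[] // : 0 <= n%:R / theta.
  by rewrite divr_ge0 // ltW.
rewrite -subset0 -(@clevel_empty phi L _ _ _ mt); last first.
  by move=> y /Hh[_ _ hn]; rewrite ler_nat ltnW.
by rewrite dit_expS => x /(_ m I); exact: iterC.
Qed.

(** At a supremum, compactness empties the derived set at some member already, and the case of that
    member applies with the same [e] and [eta]. *)
Lemma conv_stable_all xi : conv_stable X xi.
Proof.
elim: xi => [|xi IH|J f IH]; [exact: conv_stable0|exact: conv_stable_succ|].
move=> L e eta e0 eta0 cL bL dL; have cpL := wbounded_compact cL bL.
have [[j|] Hj] := dit_sup_empty None cpL cL dL; rewrite -subset0.
  rewrite -(IH j L e eta e0 eta0 cL bL Hj) => x [_ H]; exact: (H (Some j) I).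
rewrite -(conv_stable0 e0 eta0 cL bL Hj) => x [_ H]; exact: (H None I).
Qed.

End conv_stability.

Lemma seq_argmax (R : realType) (T : eqType) (s : seq T) (P : T -> Prop) (S : T -> R) :
  (exists2 x, x \in s & P x) ->
  exists x, [/\ x \in s, P x & forall y, y \in s -> P y -> S y <= S x].
Proof.
elim: s => [[]//|a s IH] [x xs Px].
have [ex|nex] := pselect (exists2 x, x \in s & P x); last first.
  have xa : x = a.
    by move: xs; rewrite inE => /predU1P[//|xs]; case: nex; exists x.
  exists a; split; [by rewrite inE eqxx|by rewrite -xa|].
  by move=> y; rewrite inE => /predU1P[->//|ys Py]; case: nex; exists y.
have [m [ms Pm Hm]] := IH ex.
have [am|am] := pselect (P a /\ S m < S a).
  exists a; split; [by rewrite inE eqxx|by case: am|].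
  move=> y; rewrite inE => /predU1P[->//|ys Py].
  by apply: le_trans (Hm y ys Py) _; case: am => _ /ltW.
exists m; split=> //; first by rewrite inE ms orbT.
move=> y; rewrite inE => /predU1P[-> Pa|]; last exact: Hm.
by rewrite leNgt; apply/negP => lt; apply: am.
Qed.

Lemma finite_lists (T : finType) n :
  exists ls : seq (seq T), forall l, l \in ls = (size l <= n)%N.
Proof.
elim: n => [|n [ls H]]; first by exists [:: [::]] => l; rewrite inE; case: l.
exists ([::] :: [seq x :: l | x <- enum T, l <- ls]) => -[|x l]; rewrite inE //=.
apply/allpairsP/idP => [[[y m] /= [_ + [_ ->]]]|]; first by rewrite H.
by rewrite ltnS -H => h; exists (x, l); rewrite mem_enum.
Qed.

(** * Convex hulls and summability *)

Section conv_summable.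
Variables (R : realType) (k : scalars).
Local Notation K := (scalar_field R k).
Variable X : normedModType K.
Local Notation W := (weakstar X).
Implicit Types (L : set W) (e D : R) (xi : ord).

(** The superlevel sets of [phi] in [qsum_clconv] have this form; finite unions keep them closed. *)
Definition list_union xi (T : eqType) (r : T -> R) L (ls : seq (seq T)) : set W :=
  [set y | exists2 l, l \in ls & dits nrel xi (map r l) L y].

Lemma list_union_cons xi (T : eqType) (r : T -> R) L l ls :
  list_union xi r L (l :: ls) = dits nrel xi (map r l) L `|` list_union xi r L ls.
Proof.
apply/seteqP; split=> [y [l']|y [h|[l' l's h]]].
- by rewrite inE => /predU1P[->|l's] h; [left|right; exists l'].
- by exists l => //; rewrite inE eqxx.
- by exists l' => //; rewrite inE l's orbT.
Qed.

Lemma list_union_nil xi (T : eqType) (r : T -> R) L : list_union xi r L [::] = set0.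
Proof. by rewrite -subset0 => y []. Qed.

Lemma closed_list_union xi (T : eqType) (r : T -> R) L ls :
  closed L -> closed (list_union xi r L ls).
Proof.
move=> cL; elim: ls => [|l ls IH]; first by rewrite list_union_nil; exact: closed0.
by rewrite list_union_cons; apply: closedU => //; exact: dits_closed.
Qed.

(** A derivation of radius [r j] prefixes [j] to every list, which adds [r j ^ q] to every sum of
    powers. *)
Lemma dit_list_union xi (T : eqType) (r : T -> R) L ls j : closed L ->
  dit (nrel (r j)) (oexpw xi) (list_union xi r L ls) `<=`
  list_union xi r L [seq j :: l | l <- ls].
Proof.
move=> cL; elim: ls => [|l ls IH].
  by rewrite list_union_nil => y /dit_sub.
rewrite /= !list_union_cons; apply: subset_trans.
  by apply: ditU; [exact: dits_closed|exact: closed_list_union].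
by move=> y [h|/IH h]; [left|right].
Qed.

(* Replaces Jensen's inequality, at the cost of a factor 2: if the mean of
   [a ^ q] is at most [c ^ q] then the mean of [a] is at most [2 c]. *)
Lemma young_grid (q c a : R) : 1 <= q -> 0 < c -> 0 <= a ->
  a <= c + c / c `^ q * a `^ q.
Proof.
move=> q1 c0 a0; have cq : 0 < c `^ q by rewrite powR_gt0.
have [ac|/ltW ca] := leP a c.
  by apply: le_trans ac _; rewrite lerDl mulr_ge0 ?powR_ge0 // divr_ge0 // ltW.
have -> : c / c `^ q * a `^ q = c * (a / c) `^ q.
  have <- : (a / c) `^ q * c `^ q = a `^ q.
    by rewrite -powRM ?divfK ?divr_ge0 ?(ltW c0) // gt_eqF.
  by rewrite -mulrA; congr (_ * _); rewrite mulrCA mulVf ?gt_eqF // mulr1.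
have h : a / c <= (a / c) `^ q.
  by rewrite -[X in X <= _]powRr1 ?divr_ge0 ?(ltW c0) // ler_powR // ler_pdivlMr // mul1r.
apply: le_trans (_ : c * (a / c) <= _); first by rewrite mulrC divfK ?gt_eqF.
by apply: le_trans (_ : c * (a / c) `^ q <= _); rewrite ?ler_wpM2l ?lerDr ?(ltW c0).
Qed.

(** The depth [phi] is computed on a finite grid of radii, so that finitely many lists matter, its
    maximum is attained and it is upper semicontinuous on [L]. The constant 4 collects the factor 2
    of [young_grid], the loss [eta] of [convex_step] and the mesh: [2 * c + delta + c <= e] for
    [c = e / 4]. *)
Lemma qsum_clconv xi q L : 1 <= q -> closed L -> wbounded L ->
  qsum xi q L -> qsum xi q (clconv L).
Proof.
move=> q1 cL bL [M0 HM0]; pose M := Num.max M0 0.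
have q0 : q != 0 by rewrite gt_eqF // (lt_le_trans _ q1).
have Mge0 : 0 <= M by rewrite le_max lexx orbT.
have HM s : all (fun e => 0 < e) s -> dits nrel xi s L !=set0 -> \sum_(e <- s) e `^ q <= M.
  by move=> h1 h2; rewrite le_max HM0.
exists (4 `^ q * M) => s s0 sne.
have [delta [delta0 Hdelta]] : exists delta : R, 0 < delta /\ forall e, e \in s -> 4 *
    delta <= e.
  elim: s s0 {sne} => [|e s IH] /=; first by exists 1.
  move=> /andP[e0 /IH[d [d0 Hd]]]; exists (Num.min (e / 4) d).
  split; first by rewrite lt_min d0 divr_gt0.
  move=> e'; rewrite inE => /predU1P[->|/Hd he].
    by rewrite mulrC -ler_pdivlMr // ge_min lexx.
  by apply: le_trans he; rewrite ler_wpM2l // ge_min lexx orbT.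
(* The top of the grid exceeds [M + 1], so its [q]-th power exceeds every value of [phi] and every
   drop of [phi] is caught by some index. *)
pose N := (Num.truncn ((M + 1) / delta)).
have Nd : M + 1 < N.+1%:R * delta.
  rewrite -ltr_pdivrMr //; have /truncn_itv/andP[] // : 0 <= (M + 1) / delta.
  by rewrite divr_ge0 ?addr_ge0 // ltW.
pose r (j : 'I_N.+1) : R := j.+1%:R * delta.
have r0 j : 0 < r j by rewrite mulr_gt0.
have rtop : M < r ord_max `^ q.
  have M1 : 1 <= r ord_max by apply: ltW; apply: le_lt_trans Nd; rewrite lerDr.
  apply: lt_le_trans (_ : r ord_max <= _).
    by apply: lt_trans Nd; rewrite ltrDl.
  by rewrite -[X in X <= _]powRr1 ?(ltW (r0 _)) // ler_powR.
pose S (l : seq 'I_N.+1) := \sum_(j <- l) r j `^ q.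
have SE l : S l = \sum_(e <- map r l) e `^ q by rewrite big_map.
have rall l : all (fun e => 0 < e) (map r l) by apply/allP => _ /mapP[j _ ->].
(* Each entry adds at least [delta ^ q], so a list with nonempty derived set has at most [n]
   entries. *)
pose n := Num.truncn (M / delta `^ q).
have dq : 0 < delta `^ q by rewrite powR_gt0.
have Hn l : dits nrel xi (map r l) L !=set0 -> (size l <= n)%N /\ S l <= M.
  move=> /(HM _ (rall l)); rewrite -SE => h; split=> //.
  have : (size l)%:R * delta `^ q <= M.
    apply: le_trans h; rewrite /S; elim: (l) => [|j l' IH]; first by rewrite mul0r big_nil.
    rewrite big_cons /= -natr1 mulrDl mul1r addrC lerD //.
    rewrite ge0_ler_powR // ?nnegrE ?(ltW delta0) ?(ltW (r0 _)) ?(le_trans _ q1) //.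
    by rewrite /r ler_peMl ?(ltW delta0) // ler1n.
  by rewrite -ler_pdivlMr // /n => h'; rewrite truncn_ge_nat // divr_ge0 // ltW.
have [ls Hls] := finite_lists 'I_N.+1 n.
have [h Hh] : exists h : W -> seq 'I_N.+1, forall y, L y ->
    [/\ h y \in ls, dits nrel xi (map r (h y)) L y &
      forall l, dits nrel xi (map r l) L y -> S l <= S (h y)].
  have H y : exists l, L y -> [/\ l \in ls, dits nrel xi (map r l) L y &
      forall l', dits nrel xi (map r l') L y -> S l' <= S l].
    have [Ly|] := pselect (L y); last by exists [::].
    have [|l [l1 l2 l3]] := @seq_argmax R _ ls (fun l => dits nrel xi (map r l) L y) S.
      by exists [::] => //; rewrite Hls.
    exists l => _; split=> // l' h; apply: l3 => //; rewrite Hls.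
    by apply: (Hn _ _).1; exists y.
  by exists (fun y => sval (cid (H y))) => y; exact: svalP (cid (H y)).
(* [phi y] is the largest sum of [q]-th powers over the lists of grid radii whose
   derived set contains [y]; the grid makes its superlevel sets [U a] closed. *)
pose phi y := S (h y).
have S0 l : 0 <= S l by apply: sumr_ge0 => j _; exact: powR_ge0.
pose U a := list_union xi r L [seq l <- ls | a < S l].
have UP a y : L y -> (U a y <-> a < phi y).
  move=> Ly; have [h1 h2 h3] := Hh y Ly; split=> [[l]|ay].
    by rewrite mem_filter => /andP[al _] /h3; exact: lt_le_trans.
  by exists (h y) => //; rewrite mem_filter h1 andbT.
have cU a : closed (U a) by exact: closed_list_union.
have UL a : U a `<=` L by move=> y [l _ /dits_sub].
(* Off by one from [r j]: for the least [j] with [phi z - r j ^ q < phi y], the preceding grid point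
   bounds [phi z - phi y] from below; for the first index this bound is 0. *)
pose g (j : 'I_N.+1) : R := (j%:R * delta) `^ q.
have step e t : e \in s -> dit (nrel e) (oexpw xi) (clevel phi L t) `<=`
    clevel phi L (t + (e / 4) `^ q).
  move=> es; have ed := Hdelta e es; pose c := e / 4.
  have c0 : 0 < c by rewrite divr_gt0 //; exact: (allP s0).
  apply: subset_trans (@convex_step _ _ _ xi L phi _ r g (2 * c + delta) (c `^ q) c t
    (@conv_stable_all _ _ _ xi) cL bL (fun j => ltW (r0 j)) _ _ c0).
  - by apply: dit_le => a b _ _; apply: nrel_le; rewrite /c; lra.
  - move=> z Lz; have [z1 z2 z3] := Hh z Lz.
    (* Otherwise prefixing [j] to a list with sum above [phi z - r j ^ q] would give a list at [z]
       with sum above [phi z]. *)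
    have nz j : ~ dit (nrel (r j)) (oexpw xi) (U (phi z - r j `^ q)) z.
      move=> /dit_list_union -/(_ cL)[_ /mapP[l + ->]].
      rewrite mem_filter => /andP[+ _] /z3; rewrite /S big_cons -/(S l) -/(S _) -/(phi z).
      by move=> a b; move: a; rewrite ltNge lerBrDl b.
    have F j : exists F, [/\ nbhs z F, closed F & dit (nrel (r j)) (oexpw xi) (U (phi z
        - r j `^ q) `&` F) = set0].
      have [|F Fz [cF FA dF]] := @dit_closed_local W _ _ _ z _ (cU _) (nz j).
        by move=> V; exact: weakstar_regular.
      by exists F.
    pose G j := sval (cid (F j)); have HG j := svalP (cid (F j)) : [/\ _, _ & _].
    exists (fun j => U (phi z - r j `^ q) `&` G j); split.
      move=> j; have [h1 h2 h3] := HG j; split=> //; first exact: closedI.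
      by move=> y [/UL].
    (* On [L], [phi] does not exceed [phi z] off the closed set [U (phi z)]; the grid being finite,
       all the [G j] can be imposed at once. *)
    exists (~` U (phi z) `&` [set y | forall j, j \in enum 'I_N.+1 -> G j y]).
      apply: filterI.
        apply: open_nbhs_nbhs; split; first exact: closed_openC.
        by move=> /(UP _ _ Lz); rewrite ltxx.
      elim: (enum _) => [|j js IH].
        by apply: filterS (@filterT _ (nbhs (z : W)) _) => a _ i; rewrite in_nil.
      have [Gz _ _] := HG j.
      by apply: filterS (filterI Gz IH) => y [Gy ys] i; rewrite inE => /predU1P[->|/ys].
    move=> y [nU Gy] Ly.
    have yz : phi y <= phi z by rewrite leNgt; apply/negP => /(UP _ _ Ly).
    have ex : exists i : nat, (i < N.+1)%N && (phi z - (i.+1%:R * delta) `^ q < phi y).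
      exists N; rewrite ltnSn /=; apply: lt_le_trans (S0 _); rewrite subr_lt0.
      by apply: le_lt_trans rtop; apply: (Hn _ _).2; exists z.
    case: (ex_minnP ex) => i /andP[iN hi] min.
    exists (Ordinal iN); split.
      by split; [apply/(UP _ _ Ly)|apply: Gy; exact: mem_enum].
    rewrite /g /=; case: i iN hi min => [|i] iN hi min.
      by rewrite mul0r powR0 // addr0.
    rewrite -lerBrDr leNgt; apply/negP => lt; have := min i.
    by rewrite lt (ltnW iN) ltnn => /(_ isT).
  - move=> w [w0 w1] wt.
    have -> : \sum_j w j * r j = \sum_j w j * (j%:R * delta) + \sum_j w j * delta.
      rewrite -big_split /=; apply: eq_bigr => j _.
      by rewrite -[r j]/(j.+1%:R * delta) -natr1 mulrDl mul1r mulrDr.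
    rewrite -[X in _ + X]mulr_suml w1 mul1r.
    rewrite lerD2r; apply: le_trans (_ : \sum_j w j * (c + c / c `^ q * g j) <= _).
      apply: ler_sum => j _; rewrite ler_wpM2l // young_grid // mulr_ge0 // ltW //.
    under eq_bigr do rewrite mulrDr [X in _ + X]mulrCA.
    rewrite big_split /= -mulr_suml w1 mul1r -mulr_sumr mulr_natl mulr2n lerD2l.
    rewrite -[leRHS](divfK (_ : c `^ q != 0)) ?gt_eqF ?powR_gt0 //.
    by rewrite ler_wpM2l ?(ltW wt) // divr_ge0 ?powR_ge0 // ltW.
have key s' : {subset s' <= s} -> dits nrel xi s' (clconv L) `<=`
    clevel phi L (\sum_(e <- s') (e / 4) `^ q).
  elim: s' => [|e s' IH] ss /=.
    by rewrite big_nil; apply: clconv_clevel => y _; exact: S0.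
  apply: subset_trans (@dit_mono W _ _ _ _ (IH _)) _.
    by move=> d ds; apply: ss; rewrite inE ds orbT.
  by rewrite big_cons addrC; apply: step; apply: ss; rewrite inE eqxx.
have [x /(key s (fun e es => es))] := sne.
have [le _|lt] := leP (\sum_(e <- s) (e / 4) `^ q) M; last first.
  by rewrite (@clevel_empty _ _ _ _ _ _ M) // => y Ly; apply: (Hn _ _).2; exists y;
      have [] := Hh y Ly.
rewrite mulrC -ler_pdivrMr ?powR_gt0 //; apply: le_trans le.
rewrite mulr_suml big_seq [leRHS]big_seq; apply: ler_sum => e es.
have e0 : 0 <= e by apply: ltW; exact: (allP s0).
have <- : (e / 4) `^ q * 4 `^ q = e `^ q by rewrite -powRM ?divr_ge0 // divfK.
by rewrite mulfK // gt_eqF // powR_gt0.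
Qed.

End conv_summable.

(** * Power type *)

Lemma xosup_le (J : Type) (f : J -> xord) a :
  xole (xosup f) (Some a) <-> forall i, xole (f i) (Some a).
Proof.
rewrite /xosup; case: asboolP => [[i fi]|nf] /=.
  by split=> // /(_ i); rewrite fi.
have fE i : f i = Some (odflt ozero (f i)).
  by case E : (f i) => //; case: nf; exists i.
by split=> H i; have := H i; rewrite fE.
Qed.

Lemma geometric_sum_le (R : realType) (x : R) n : 0 <= x < 1 ->
  \sum_(j < n) x ^+ j <= (1 - x)^-1.
Proof.
move=> /andP[x0 x1]; rewrite -[leRHS]mul1r ler_pdivlMr ?subr_gt0 // mulrC.
have -> : (1 - x) * \sum_(j < n) x ^+ j = 1 - x ^+ n.
  by rewrite -opprB mulNr -subrX1 opprB.
by rewrite lerBlDr lerDl exprn_ge0.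
Qed.

Lemma powR_exprn (R : realType) (x r : R) n : 0 <= x -> (x ^+ n) `^ r = (x `^ r) ^+ n.
Proof.
move=> x0; elim: n => [|n IH]; first by rewrite !expr0 powR1.
by rewrite !exprS powRM ?exprn_ge0 // IH.
Qed.

(* Summing a tail bound [#{d : t <= d} <= C t ^ (- p)] over the dyadic levels
   [t = D 2 ^ (- j)]. *)
Lemma sum_powR_tail (R : realType) (C D p q : R) : 0 <= C -> 0 < D -> p < q -> 0 <= q ->
  exists M : R, forall s : seq R, all (fun d => 0 < d <= D) s ->
  (forall t, 0 < t -> (count (fun d => t <= d) s)%:R <= C * t `^ (- p)) ->
  \sum_(d <- s) d `^ q <= M.
Proof.
move=> C0 D0 pq q0; pose x : R := 2^-1 `^ (q - p).
have x01 : 0 <= x < 1.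
  have e1 : 1 = 1 `^ (q - p) by rewrite powR1.
  rewrite powR_ge0 /= e1 /x gt0_ltr_powR ?subr_gt0 ?nnegrE // ?invr_ge0 //.
  by rewrite invf_lt1 // ltr1n.
exists (2 `^ q * (C * D `^ (q - p) * (1 - x)^-1)) => s sD Hs.
pose t j : R := D * 2^-1 ^+ j.
have t0 j : 0 < t j by rewrite mulr_gt0 // exprn_gt0 // invr_gt0.
have tS j : 2 * t j.+1 = t j.
  by rewrite /t exprS mulrCA; congr (_ * _); rewrite mulrA divff ?mul1r //.
have tsmall d : 0 < d -> exists j, t j <= d.
  move=> d0; have [j Hj] : exists j : nat, D / d <= 2 ^+ j.
    exists (Num.truncn (D / d)).+1; apply: ltW.
    have /truncn_itv/andP[_ h] : 0 <= D / d by rewrite divr_ge0 // ltW.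
    apply: lt_le_trans h _; rewrite -natrX ler_nat; exact/ltnW/ltn_expl.
  exists j; rewrite /t exprVn ler_pdivrMr ?exprn_gt0 //.
  by rewrite mulrC -ler_pdivrMr.
have tle i j : (i <= j)%N -> t j <= t i.
  by move=> ij; rewrite /t ler_pM2l // ler_wiXn2l // ?invr_ge0 // invf_le1 // ler1n.
have [J HJ] : exists J, forall d, d \in s -> t J <= d.
  elim: s sD {Hs} => [|d s IH] /=; first by exists 0%N.
  move=> /andP[/andP[d0 _] /IH[J HJ]]; have [j Hj] := tsmall d d0.
  exists (maxn J j) => e; rewrite inE => /predU1P[->|/HJ h].
    by apply: le_trans (tle _ _ (leq_maxr J j)) _.
  by apply: le_trans (tle _ _ (leq_maxl J j)) _.
(* The least [j] with [t j <= d] has [d <= 2 * t j], so its term alone dominates [d ^ q]. *)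
have dle d : d \in s -> d `^ q <= \sum_(j < J.+1) 2 `^ q * (t j `^ q * (t j <= d)%R%:R).
  move=> ds; have /andP[d0 dD] := allP sD d ds.
  have ex : exists j, t j <= d by exists J; exact: HJ.
  case: (ex_minnP ex) => j tj min.
  have jJ : (j < J.+1)%N by rewrite ltnS; apply: min; exact: HJ.
  rewrite (bigD1 (Ordinal jJ)) //= tj mulr1; apply: le_trans (_ : (2 * t j) `^ q <= _).
    rewrite ge0_ler_powR ?nnegrE ?(ltW d0) //; first by rewrite mulr_ge0 // ltW.
    case: j tj min {jJ} => [|j] tj min.
      apply: le_trans dD _; rewrite /t expr0 mulr1 ler_peMl ?(ltW D0) // ler1n //.
    rewrite tS; apply: ltW; rewrite ltNge; apply/negP => /min; by rewrite ltnn.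
  rewrite powRM // ?(ltW (t0 j)) // lerDl; apply: sumr_ge0 => i _.
  by rewrite !mulr_ge0 ?powR_ge0.
apply: le_trans (_ : \sum_(d <- s) \sum_(j < J.+1) 2 `^ q * (t j `^ q * (t j <=
    d)%R%:R) <= _).
  by rewrite big_seq [leRHS]big_seq; apply: ler_sum => d; exact: dle.
rewrite exchange_big /=.
apply: le_trans (_ : \sum_(j < J.+1) 2 `^ q * (C * D `^ (q - p) * x ^+ j) <= _).
  apply: ler_sum => j _; rewrite -mulr_sumr ler_wpM2l ?powR_ge0 // -mulr_sumr.
  have -> : \sum_(d <- s) (t j <= d)%R%:R = (count (fun d => t j <= d) s)%:R :> R.
    by elim: (s) => [|d s' IH]; rewrite ?big_nil // big_cons IH /= natrD.
  apply: le_trans (_ : t j `^ q * (C * t j `^ (- p)) <= _).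
    by rewrite ler_wpM2l ?powR_ge0 // Hs.
  rewrite mulrCA -powRD; last by rewrite (gt_eqF (t0 j)) implybT.
  rewrite -mulrA ler_wpM2l // /t powRM ?(ltW D0) ?exprn_ge0 ?invr_ge0 //.
  by rewrite powR_exprn ?invr_ge0.
rewrite -mulr_sumr ler_wpM2l ?powR_ge0 // -mulr_sumr ler_wpM2l //.
  by rewrite mulr_ge0 // powR_ge0.
exact: geometric_sum_le.
Qed.

Section szlenk_power_type.
Variables (R : realType) (k : scalars).
Local Notation K := (scalar_field R k).
Variable X : normedModType K.
Local Notation W := (weakstar X).
Implicit Types (L : set W) (e q : R) (xi : ord).

Lemma szlenk_ole e a b L : ole a b -> szlenk e b L `<=` szlenk e a L.
Proof.
move=> ab; rewrite /szlenk; case: ifP => _; [exact: subset_refl|rewrite !szlenk_iterE].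
by apply: oiter_ole => //; [move=> ? ? []|exact: szlenk_der_mono].
Qed.

Lemma Sz_eps_le e a L : xole (Sz_eps L e) (Some a) <-> szlenk e a L = set0.
Proof.
rewrite /Sz_eps; case: pselect => [h|n] /=; last by split=> // sa; apply: n; exists a.
case: (cid (ord_least h)) => b [sb bmin] /=; split=> [ba|/bmin//].
by rewrite -subset0 -sb; exact: szlenk_ole.
Qed.

Lemma Sz_leP xi L : xole (Sz L) (Some xi) <-> forall e, 0 < e -> szlenk e xi L = set0.
Proof.
rewrite /Sz xosup_le; split=> [H e e0|H [e /= e0]]; last exact/Sz_eps_le/H.
by apply/Sz_eps_le; exact: (H (exist _ e e0)).
Qed.

Lemma dit_muln e xi n L :
  dit (nrel e) (omuln (oexpw xi) n) L = iter n (dit (nrel e) (oexpw xi)) L.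
Proof. by apply: oiter_muln; exact: der_sub. Qed.

(** [omega ^ (xi + 1)] is the supremum of the [omega ^ xi * n], so compactness stops the iteration
    at a finite [n]; the successor [n.+1] ensures positivity. *)
Lemma Sz_expS_fin xi e L : closed L -> wbounded L -> xole (Sz L) (Some (oexpw (osucc
    xi))) ->
  0 < e -> exists2 n, (0 < n)%N & szlenk e (omuln (oexpw xi) n) L = set0.
Proof.
move=> cL bL /Sz_leP H e0; have e2 : 0 < e / 2 by rewrite divr_gt0.
have d0 : dit (nrel (e / 2)) (oexpw (osucc xi)) L = set0.
  rewrite -subset0 -(H _ e2); exact: dit_szlenk.
have [n Hn] := dit_expS_empty (wbounded_compact cL bL) cL d0.
exists n.+1 => //; rewrite -subset0.
have -> : e = 2 * (e / 2) by rewrite mulrC divfK.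
by move=> y /(szlenk_dit e2); rewrite dit_muln /= Hn => /dit_sub.
Qed.

Lemma Sz_xi_ge1 xi L e : (0 < Sz_xi xi L e)%N.
Proof. by rewrite /Sz_xi; case: xgetP => // n _ []. Qed.

Lemma Sz_xiP xi L e n : (0 < n)%N -> szlenk e (omuln (oexpw xi) n) L = set0 ->
  szlenk e (omuln (oexpw xi) (Sz_xi xi L e)) L = set0 /\ (Sz_xi xi L e <= n)%N.
Proof.
move=> n0 sn; set A := [set n | (0 < n)%N /\ xole (Sz_eps L e) (Some (omuln (oexpw xi)
    n)) /\
    forall m, (0 < m)%N -> xole (Sz_eps L e) (Some (omuln (oexpw xi) m)) -> (n <= m)%N].
have ex : exists m, (0 < m)%N && `[< xole (Sz_eps L e) (Some (omuln (oexpw xi) m)) >].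
  by exists n; rewrite n0; apply/asboolP/Sz_eps_le.
have [m Am] : exists m, A m.
  case: (ex_minnP ex) => m /andP[m0 /asboolP hm] min; exists m; split=> //; split=> //
      j j0 hj.
  by apply: min; rewrite j0; exact/asboolP.
have : A (Sz_xi xi L e) by rewrite /Sz_xi; apply: xgetPex; exists m.
by move=> [_ [/Sz_eps_le h1 h2]]; split=> //; apply: h2 => //; exact/Sz_eps_le.
Qed.

Lemma p_index_ge0 xi L : (0 <= p_index xi L)%E.
Proof.
rewrite /p_index; case: ifP => [_|_]; last exact: leey.
apply: limf_esup_ge0; first exact: filter_not_empty.
by move=> e; rewrite lee_fin divr_ge0 // ln_ge0 // ler1n Sz_xi_ge1.
Qed.

(** Derivation with a radius [d >= e] is contained in that with radius [e], and other entries may be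
    skipped. This turns bounds on [Sz_xi] into the tail bounds of [sum_powR_tail]. *)
Lemma dits_count xi s L e : 0 < e ->
  dits nrel xi s L `<=` iter (count (fun d => e <= d) s) (dit (nrel e) (oexpw xi)) L.
Proof.
move=> e0; elim: s => [//|d s IH] /=; case: leP => [ed|_] /=.
  apply: subset_trans (dit_mono IH); apply: dit_le => a b _ _; exact: nrel_le.
exact: subset_trans (@dit_sub W _ _ _) IH.
Qed.

(** A limit superior below [q] gives [p < q] with [Sz_xi xi L e <= e ^ (- p)] for small [e], hence
    at most [t ^ (- p)] entries of size [t] or more, for small [t], in a list with nonempty derived
    set. The entries are bounded because [L] is. *)
Lemma p_index_qsum xi q L : 0 < q -> closed L -> wbounded L ->
  (p_index xi L < q%:E)%E -> qsum xi q L.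
Proof.
move=> q0 cL bL; have [D HD] := bL; rewrite /p_index; case: asboolP => [Sz_le|_]; last
    by rewrite ltNge leey.
move=> /ereal_inf_lt[_ [A A0 <-]] Aq.
have [p [p0 pq HA]] : exists p, [/\ 0 <= p, p < q & forall e, A e ->
    ln (Sz_xi xi L e)%:R / `|ln e| <= p].
  have Ap e : A e -> ((ln (Sz_xi xi L e)%:R / `|ln e|)%:E <=
      ereal_sup [set (ln (Sz_xi xi L x)%:R / `|ln x|)%:E | x in A])%E.
    by move=> Ae; apply: ereal_sup_ubound; exists e.
  have [e Ae] := filter_ex A0; move: Aq Ap (Ap e Ae).
  case: (ereal_sup _) => [p| |]; first last.
  - by move=> _ _; rewrite leNgt ltNyr.
  - by rewrite ltNge leey.
  rewrite lte_fin => pq Ap h; exists p; split=> //.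
    move: h; rewrite lee_fin; apply: le_trans.
    by rewrite divr_ge0 // ln_ge0 // ler1n Sz_xi_ge1.
have [e0 e00 He0] : exists2 e0, 0 < e0 <= 1/2 & forall e, 0 < e -> e <= e0 -> A e.
  move: A0 => /nbhs_ballP[d /= d0 Hd]; exists (Num.min (d / 2) (1/2)).
    by rewrite lt_min !divr_gt0 //= ge_min lexx orbT.
  move=> e ep; rewrite le_min => /andP[ed _]; apply: Hd => //=.
  rewrite /ball /= sub0r normrN gtr0_norm //; apply: le_lt_trans ed _.
  by rewrite ltr_pdivrMr // ltr_pMr // ltr1n.
have /andP[e0p e0h] := e00.
have Sze e : 0 < e -> e <= e0 -> (Sz_xi xi L e)%:R <= e `^ (- p).
  move=> ep ee; have e1 : e < 1 by apply: le_lt_trans ee _; apply: le_lt_trans e0h _; lra.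
  have lne : ln e < 0 by apply: ln_lt0; rewrite ep.
  have := HA e (He0 e ep ee).
  rewrite ltr0_norm // ler_pdivrMr ?oppr_gt0 // mulrN -mulNr -ln_powR.
  by rewrite ler_ln // qualifE /= ?powR_gt0 // ltr0n Sz_xi_ge1.
pose D' := 2 * Num.max D 0 + e0.
have D'0 : 0 < D' by rewrite ltr_wpDl // mulr_ge0 // le_max lexx orbT.
(* Extends the count from [t <= e0] to [t <= D']: there [C * t ^ (- p)] is at least [e0 ^ (- p)]. *)
pose C := D' `^ p * e0 `^ (- p).
have C0 : 0 <= C by rewrite mulr_ge0 ?powR_ge0.
have [M HM] := sum_powR_tail C0 D'0 pq (ltW q0).
exists M => s s0 [x xs].
have sD : all (fun d => 0 < d <= D') s.
  apply/allP => d ds; rewrite (allP s0) //= leNgt; apply/negP => lt.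
  have : dit (nrel d) (oexpw xi) L x.
    elim: s s0 ds xs => [|d' s IH] //= /andP[d'0 s0].
    rewrite inE => /predU1P[->|ds]; first by apply: dit_mono; exact: dits_sub.
    by move=> /dit_sub; exact: IH.
  rewrite dit_fincol //; exists unit, (fun=> tt) => a b La Lb _.
  rewrite /nrel; apply: le_trans (rnormD _ _) _; rewrite rnormN.
  apply: le_trans (ltW lt); apply: le_trans (_ : 2 * Num.max D 0 <= _); last by rewrite
      lerDl ltW.
  by rewrite mulr_natl mulr2n lerD // le_max HD.
have cnt t : 0 < t -> t <= e0 -> (count (fun d => t <= d) s)%:R <= t `^ (- p).
  move=> t0 te; apply: le_trans (Sze t t0 te); rewrite ler_nat leqNgt; apply/negP => lt.
  have [n n0 sn] := Sz_expS_fin cL bL Sz_le t0.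
  have [h _] := Sz_xiP n0 sn.
  have := dits_count t0 xs; move=> /(iter_dit_le (ltnW lt)).
  by rewrite -dit_muln => /(dit_szlenk t0); rewrite h.
have pcancel u : 0 < u -> u `^ p * u `^ (- p) = 1.
  by move=> u0; rewrite -powRD ?subrr ?powRr0 // (gt_eqF u0) implybT.
apply: HM => // t t0; have [te|te] := leP t e0.
  apply: le_trans (cnt t t0 te) _; rewrite ler_peMl ?powR_ge0 //.
  rewrite /C -(pcancel e0 e0p) ler_wpM2r ?powR_ge0 // ge0_ler_powR ?nnegrE // ?(ltW
      e0p) ?(ltW D'0) //.
  by rewrite /D' lerDr mulr_ge0 // le_max lexx orbT.
have [tD|tD] := leP t D'; last first.
  rewrite (_ : count _ _ = 0%N) ?mulr_ge0 ?powR_ge0 //.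
  rewrite (@eq_in_count _ _ pred0) ?count_pred0 // => d /(allP sD)/andP[_ dD] /=.
  by rewrite leNgt (le_lt_trans dD tD).
apply: le_trans (_ : (count (fun d => e0 <= d) s)%:R <= _).
  by rewrite ler_nat; apply: sub_count => d /=; apply: le_trans; exact: ltW.
apply: le_trans (cnt e0 e0p (lexx _)) _.
rewrite /C mulrAC ler_peMl ?powR_ge0 // -(pcancel t t0) ler_wpM2r ?powR_ge0 //.
by rewrite ge0_ler_powR ?nnegrE // ltW.
Qed.

(** Constant lists give [n * (e / 2) ^ q <= M] as long as [n] derivations leave something, so
    [Sz_xi] is at most a constant times [e ^ (- q)]. *)
Lemma qsum_p_index xi q L : 0 < q -> closed L -> wbounded L -> qsum xi q L ->
  (p_index xi L <= q%:E)%E.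
Proof.
move=> q0 cL bL [M0 HM0]; pose M := Num.max M0 0.
have Mge0 : 0 <= M by rewrite le_max lexx orbT.
have emp e n : 0 < e -> M < n%:R * (e / 2) `^ q -> szlenk e (omuln (oexpw xi) n) L = set0.
  move=> e0 Mn; have e2 : 0 < e / 2 by rewrite divr_gt0.
  rewrite -subset0 => x; rewrite -{1}[e](@divfK _ 2) // mulrC => /(szlenk_dit e2).
  rewrite dit_muln -dits_nseq => xn.
  have : \sum_(d <- nseq n (e / 2)) d `^ q <= M.
    rewrite le_max HM0 //; last by exists x.
    by apply/allP => d /nseqP[-> _].
  by rewrite big_nseq iter_addr_0 -[_ *+ n]mulr_natl leNgt Mn.
(* The [+ 1] pays for rounding up to an integer, since [1 <= e ^ (- q)] for [e < 1]. *)
pose C := M * 2 `^ q + 1.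
have C1 : 1 <= C by rewrite lerDr mulr_ge0 ?powR_ge0.
have Sz_bound e : 0 < e -> e < 1 -> exists2 n, (0 < n)%N &
    szlenk e (omuln (oexpw xi) n) L = set0 /\ n%:R <= C * e `^ (- q).
  move=> e0 e1; pose n := (Num.truncn (M / (e / 2) `^ q)).+1; exists n => //.
  have pe : 0 < (e / 2) `^ q by rewrite powR_gt0 // divr_gt0.
  have /truncn_itv/andP[h1 h2] : 0 <= M / (e / 2) `^ q by rewrite divr_ge0 // ltW.
  split; first by apply: emp => //; rewrite -ltr_pdivrMr.
  rewrite /n -natr1; apply: le_trans (_ : M / (e / 2) `^ q + 1 <= _); first by rewrite
      lerD2r.
  have E : M / (e / 2) `^ q = M * 2 `^ q * e `^ (- q).
    have E0 : e `^ q = (e / 2) `^ q * 2 `^ q.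
      by rewrite -powRM ?divfK // divr_ge0 // ltW.
    rewrite powRN E0; field.
    by rewrite !gt_eqF // powR_gt0.
  rewrite E mulrDl mul1r lerD2l powRN invf_ge1 ?powR_gt0 //.
  have -> : 1 = 1 `^ q by rewrite powR1.
  by rewrite ge0_ler_powR ?nnegrE ?(ltW q0) ?(ltW e0) ?(ltW e1).
have cond : xole (Sz L) (Some (oexpw (osucc xi))).
  apply/Sz_leP => e e0; have [n Hn] : exists n : nat, M < n%:R * (e / 2) `^ q.
    have pe : 0 < (e / 2) `^ q by rewrite powR_gt0 // divr_gt0.
    exists (Num.truncn (M / (e / 2) `^ q)).+1; rewrite -ltr_pdivrMr //.
    by have /truncn_itv/andP[] : 0 <= M / (e / 2) `^ q by rewrite divr_ge0 // ltW.
  rewrite -subset0 -(emp e n e0 Hn); apply: szlenk_ole.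
  exact: (ole_sup_r (g := omuln (oexpw xi)) (ole_refl _)).
rewrite /p_index; case: asboolP => // _.
apply/lee_addgt0Pr => d d0; rewrite -EFinD.
(* Below this threshold [ln C <= d * |ln e|], so the constant costs at most [d]. *)
pose e0 := expR (- (ln C / d + 1)).
have e01 : 0 < e0 < 1.
  rewrite expR_gt0 /= expR_lt1 oppr_lt0 ltr_wpDl // divr_ge0 ?ln_ge0 // ltW //.
apply: ge_ereal_inf; exists (ereal_sup [set (ln (Sz_xi xi L e)%:R / `|ln e|)%:E | e in
    [set e | 0 < e < e0]]).
  exists [set e | 0 < e < e0] => //.
  have /andP[e0p _] := e01.
  apply/nbhs_ballP; exists e0 => //= y.
  rewrite /ball /= sub0r normrN => ye y0; rewrite y0 /=.
  by move: ye; rewrite gtr0_norm.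
apply: ge_ereal_sup => _ [e /= /andP[ep ee] <-]; rewrite lee_fin.
have e1 : e < 1 by apply: lt_trans ee _; case/andP: e01.
have lne : ln e < 0 by apply: ln_lt0; rewrite ep.
have [n n0 [sn nC]] := Sz_bound e ep e1.
have [_ hn] := Sz_xiP n0 sn.
rewrite ltr0_norm // ler_pdivrMr ?oppr_gt0 //.
apply: le_trans (_ : ln (C * e `^ (- q)) <= _).
  rewrite ler_ln ?qualifE /= ?ltr0n ?Sz_xi_ge1 ?mulr_gt0 ?powR_gt0 // ?(lt_le_trans _
      C1) //.
  by apply: le_trans nC; rewrite ler_nat.
rewrite lnM ?qualifE /= ?powR_gt0 // ?(lt_le_trans _ C1) // ln_powR mulrDl mulNr -mulrN
    addrC lerD2l.
have : ln e <= - (ln C / d + 1).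
  by rewrite -ler_expR lnK ?qualifE //= ltW.
rewrite lerNr => h; rewrite mulrC -ler_pdivrMr //; apply: le_trans h; rewrite lerDl //.
Qed.

Lemma cvg_affine (T : Type) (F : set_system T) (h : T -> W) (v y : W) (c : R) :
  Filter F -> h @ F --> v ->
  (fun t => scalar_of k c *: (h t : dual_space X) + (y : dual_space X) : W) @ F -->
    (scalar_of k c *: (v : dual_space X) + (y : dual_space X) : W).
Proof.
move=> FF hv; apply: cvg_weakstar => x.
have affine (u : T -> K^o) (l b : K^o) : u @ F --> l ->
    (fun t => scalar_of k c *: u t + b) @ F --> scalar_of k c *: l + b.
  by move=> ul; apply: cvgD; [exact: cvgZl_tmp|exact: cvg_cst].
exact: (affine _ _ ((y : dual_space X) x) (@cvg_eval R k X T F h v x FF hv)).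
Qed.

Lemma affine_continuous (c : R) (y : W) :
  continuous (fun v : W => scalar_of k c *: (v : dual_space X) + (y : dual_space X) : W).
Proof. by move=> v; exact: (@cvg_affine W (nbhs v) id). Qed.

Definition wconvex L := forall (t : R) (a b : W), 0 <= t <= 1 -> L a -> L b ->
  L (scalar_of k t *: (a : dual_space X) + scalar_of k (1 - t) *: (b : dual_space X)).

Lemma dit_affine (c e : R) (y : W) xi L L' : 0 < c ->
  (forall a : W, L a -> L' (scalar_of k c *: (a : dual_space X) + (y : dual_space X))) ->
  forall a : W, dit (nrel e) xi L a ->
    dit (nrel (c * e)) xi L' (scalar_of k c *: (a : dual_space X) + (y : dual_space X)).
Proof.
move=> c0 LL' a ae.
apply: (@dit_preimage W W _ (nrel (c * e)) xi L L' (@affine_continuous c y) LL').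
apply: dit_le ae => u v _ _; rewrite /nrel opprD addrACA subrr addr0 -scalerBr.
by rewrite rnormZr ?(ltW c0) // ler_pM2l.
Qed.

(* In a symmetric convex set a nonempty derived set contains [0]; averaging [n]
   copies then survives [n] derivations with radius [e / n]. *)
Lemma qsum_lt1 xi q L : 0 < q < 1 -> wconvex L ->
  (forall a : W, L a -> L (- (a : dual_space X))) ->
  qsum xi q L -> forall e, 0 < e -> dit (nrel e) (oexpw xi) L = set0.
Proof.
move=> /andP[q0 q1] cvL symL [M HM] e e0; rewrite -subset0 => z ze.
have Lz : L z by exact: dit_sub ze.
pose a := 2^-1 * e; have a0 : 0 < a by rewrite mulr_gt0 // invr_gt0.
(* The map [u |-> u / 2 - z / 2] sends [L] into itself and [z] to 0, halving radii. *)
have z0 : dit (nrel a) (oexpw xi) L (0 : dual_space X).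
  have := @dit_affine 2^-1 e (scalar_of k (1 - 2^-1) *: (- (z : dual_space X))) (oexpw
      xi) L L _ _ z ze.
  rewrite (_ : scalar_of k 2^-1 *: _ + _ = 0); last first.
    by rewrite scalerN (_ : 1 - 2^-1 = 2^-1 :> R) ?subrr //; lra.
  apply; first by rewrite invr_gt0.
  move=> u Lu; apply: cvL => //; last exact: symL.
  by rewrite invr_ge0 ler0n invf_le1 // ler1n.
(* A share [u / n] is exchanged for [v / n] with [v] in [L]; as [v = 0] survives a derivation of
   radius [a], what is left of [u] survives one more of radius [a / n]. *)
have iterP n j (u : W) : (0 < n)%N -> (j <= n)%N -> L u ->
    iter j (dit (nrel (n%:R^-1 * a)) (oexpw xi)) L (scalar_of k ((n - j)%:R / n%:R) *:
        (u : dual_space X)).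
  move=> n0; have n0' : 0 < n%:R :> R by rewrite ltr0n.
  elim: j u => [|j IH] u jn Lu.
    by rewrite subn0 divff ?gt_eqF // scalar_of1 scale1r.
  have := @dit_affine n%:R^-1 a (scalar_of k ((n - j.+1)%:R / n%:R) *: (u : dual_space
      X)) (oexpw xi) L
    (iter j (dit (nrel (n%:R^-1 * a)) (oexpw xi)) L) _ _ (0 : dual_space X) z0.
  rewrite scaler0 add0r; apply; first by rewrite invr_gt0.
  move=> v Lv; set m := (n - j)%N; have m0 : (0 < m)%N by rewrite subn_gt0.
  have m0' : 0 < m%:R :> R by rewrite ltr0n.
  have mE : (n - j.+1)%:R = m%:R - 1 :> R by rewrite subnS -subn1 natrB.
  have Lw : L (scalar_of k m%:R^-1 *: (v : dual_space X) + scalar_of k (1 - m%:R^-1) *: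
      (u : dual_space X)).
    by apply: cvL => //; rewrite invr_ge0 ler0n invf_le1 // ler1n.
  have F1 (x y : R) : x != 0 -> y != 0 -> x / y / x = y^-1.
    by move=> x0 y0; field; rewrite x0 y0.
  have F2 (x y : R) : x != 0 -> y != 0 -> x / y * (1 - x^-1) = (x - 1) / y.
    by move=> x0 y0; field; rewrite x0 y0.
  have := IH _ (ltnW jn) Lw; rewrite -/m scalerDr !scalerA -!scalar_ofM mE.
  by rewrite F1 ?F2 // gt_eqF.
have bnd n : (0 < n)%N -> n%:R * (n%:R^-1 * a) `^ q <= M.
  move=> n0; have n0' : 0 < n%:R :> R by rewrite ltr0n.
  have : \sum_(d <- nseq n (n%:R^-1 * a)) d `^ q <= M.
    apply: HM; first by apply/allP => d /nseqP[-> _]; rewrite mulr_gt0 // invr_gt0.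
    by rewrite dits_nseq; eexists; exact: (iterP n n z n0 (leqnn n) Lz).
  by rewrite big_nseq iter_addr_0 -[_ *+ n]mulr_natl.
(* As [q < 1], the quantity [n * (a / n) ^ q = n ^ (1 - q) * a ^ q] is unbounded; [c] and [n] make
   it exceed [M]. *)
pose c := (Num.max M 0 + 1) / a `^ q.
have aq : 0 < a `^ q by rewrite powR_gt0.
have c0 : 0 < c by rewrite divr_gt0 // ltr_wpDl // le_max lexx orbT.
pose n := (Num.truncn (c `^ (1 - q)^-1)).+1.
have n0' : 0 < n%:R :> R by rewrite ltr0n.
have := bnd n isT; apply/negP; rewrite -ltNge.
rewrite powRM ?invr_ge0 ?(ltW a0) // mulrA.
have -> : n%:R * n%:R^-1 `^ q = n%:R `^ (1 - q).
  rewrite powRD; last by rewrite (gt_eqF n0') implybT.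
  by rewrite powRr1 ?(ltW n0') // -powR_inv1 ?(ltW n0') // -powRrM mulN1r.
have cn : c <= n%:R `^ (1 - q).
  have -> : c = (c `^ (1 - q)^-1) `^ (1 - q).
    by rewrite -powRrM mulVf ?powRr1 ?(ltW c0) // gt_eqF // subr_gt0.
  have /truncn_itv/andP[_ h] : 0 <= c `^ (1 - q)^-1 by exact: powR_ge0.
  by rewrite ge0_ler_powR ?nnegrE ?powR_ge0 ?subr_ge0 ?(ltW q1) // ltW.
apply: lt_le_trans (_ : c * a `^ q <= _); last by rewrite ler_wpM2r // ltW.
by rewrite /c divfK ?gt_eqF // ltr_pwDr // le_max lexx.
Qed.

End szlenk_power_type.

(** * Hahn-Banach *)

Section real_part.
Variables (R : realType) (k : scalars).
Local Notation K := (scalar_field R k).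

Lemma scalar_ReD (z w : K) : scalar_Re (z + w) = scalar_Re z + scalar_Re w.
Proof. by move: z w; rewrite /scalar_Re; case: k => //= -[a b] [c d]. Qed.

Lemma scalar_ReB (z w : K) : scalar_Re (z - w) = scalar_Re z - scalar_Re w.
Proof. by move: z w; rewrite /scalar_Re; case: k => //= -[a b] [c d]. Qed.

Lemma scalar_ReM (a : R) (z : K) : scalar_Re (scalar_of k a * z) = a * scalar_Re z.
Proof. by move: z; rewrite /scalar_Re /scalar_of; case: k => //= -[b c] /=; rewrite
    mul0r subr0. Qed.

Lemma scalar_Re_sum (J : Type) (s : seq J) (F : J -> K) :
  scalar_Re (\sum_(i <- s) F i) = \sum_(i <- s) scalar_Re (F i).
Proof.
elim: s => [|i s IH]; first by rewrite !big_nil -(scalar_of0 R k) scalar_ofK.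
by rewrite !big_cons scalar_ReD IH.
Qed.

Lemma scalar_Re_le (z : K) : `|scalar_Re z| <= rnorm (z : K^o).
Proof.
move: z; rewrite /rnorm /scalar_Re; case: k => [//|] -[a b] /=.
by rewrite -sqrtr_sqr ler_wsqrtr // lerDl sqr_ge0.
Qed.

Lemma scalar_phase (z : K) : exists c : K, rnorm (c : K^o) = 1 /\
  c * z = scalar_of k (rnorm (z : K^o)).
Proof.
have [->|z0] := eqVneq z 0.
  exists 1; split; first by rewrite -(scalar_of1 R k) rnorm_scalar.
  by rewrite mulr0 [rnorm _]rnorm0 scalar_of0.
have n0 : rnorm (z : K^o) != 0 by apply: contra_neq z0; exact: rnorm_eq0.
exists (scalar_of k (rnorm (z : K^o)) / z); split; last by rewrite divfK.
have := @rnormZ R k K^o (scalar_of k (rnorm (z : K^o)) / z) z.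
rewrite [_ *: _]divfK // rnorm_scalar ?rnorm_ge0 // -{1}[rnorm _]mul1r.
by move=> /(mulIf n0).
Qed.

(* [t] is multiplication by the imaginary unit in the complex case. *)
Lemma rnorm_le_Re : exists t : K, forall z : K,
  rnorm (z : K^o) <= `|scalar_Re z| + `|scalar_Re (t * z)|.
Proof.
rewrite /rnorm /scalar_Re; case: k => /=; first by exists 0 => z; rewrite lerDl.
exists (0 +i* 1)%C => -[a b] /=; rewrite !mul0r mul1r sub0r normrN.
rewrite -(@ler_sqr _ (Num.sqrt _)) ?nnegrE ?sqrtr_ge0 ?addr_ge0 //.
rewrite sqr_sqrtr ?addr_ge0 ?sqr_ge0 //.
rewrite -(real_normK (num_real a)) -(real_normK (num_real b)).
by have := mulr_ge0 (normr_ge0 a) (normr_ge0 b); nra.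
Qed.

End real_part.

Section hahn_banach.
Variables (R : realType) (k : scalars).
Local Notation K := (scalar_field R k).
Variable V : normedModType K.
Local Notation "a •: x" := (scalar_of k a *: x) (at level 40).

(** Functionals on real subspaces are represented by graphs, ordered by inclusion; linearity with
    domination by the norm makes a graph single-valued. *)
Definition graph_linear (G : set (V * R)) :=
  forall a p q, G p -> G q -> G (a •: p.1 + q.1, a * p.2 + q.2).

Definition graph_dominated (G : set (V * R)) := forall p, G p -> p.2 <= rnorm p.1.

(** The value at [x0] must lie above all [p.2 - |p.1 - x0|] and below all [|q.1 + x0| - q.2]; by
    [key], which is the triangle inequality, the supremum [c] of the former qualifies. *)
Lemma graph_extend (G : set (V * R)) (x0 : V) :
  G !=set0 -> graph_linear G -> graph_dominated G ->
  exists c, let G' := [set p | exists q t, G q /\ p = (q.1 + t •: x0, q.2 + t * c)] in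
    graph_linear G' /\ graph_dominated G'.
Proof.
move=> [q0 Gq0] lG dG.
have key p q : G p -> G q -> p.2 - rnorm (p.1 - x0) <= rnorm (q.1 + x0) - q.2.
  move=> Gp Gq; rewrite lerBrDr addrAC lerBlDr.
  have := dG _ (lG 1 p q Gp Gq); rewrite /= mul1r scalar_of1 scale1r => h.
  apply: le_trans h _.
  have -> : p.1 + q.1 = (p.1 - x0) + (q.1 + x0) by rewrite addrACA addNr addr0.
  by rewrite [leRHS]addrC; exact: rnormD.
pose S := [set p.2 - rnorm (p.1 - x0) | p in G].
have S0 : S !=set0 by exists (q0.2 - rnorm (q0.1 - x0)), q0.
pose c := sup S.
have c1 p : G p -> p.2 - rnorm (p.1 - x0) <= c.
  move=> Gp; apply: ub_le_sup; last by exists p.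
  by exists (rnorm (q0.1 + x0) - q0.2) => _ [q Gq <-]; exact: key.
have c2 q : G q -> c <= rnorm (q.1 + x0) - q.2.
  by move=> Gq; apply: ge_sup => // _ [p Gp <-]; exact: key.
have G0 : G (0, 0).
  have := lG (-1) q0 q0 Gq0 Gq0.
  by rewrite scalar_ofN scalar_of1 scaleN1r addNr mulN1r addNr.
have Gs a p : G p -> G (a •: p.1, a * p.2).
  by move=> Gp; have := lG a p (0, 0) Gp G0; rewrite !addr0.
exists c => G'; split.
  move=> a _ _ [p [t [Gp ->]]] [q [u [Gq ->]]].
  exists (a •: p.1 + q.1, a * p.2 + q.2), (a * t + u); split; first exact: lG.
  congr (_, _) => /=; last by ring.
  by rewrite scalerDr scalerA scalar_ofD scalar_ofM scalerDl addrACA.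
move=> _ [q [t [Gq ->]]] /=.
have [t0|t0|->] := ltgtP t 0; last by rewrite scalar_of0 scale0r mul0r !addr0; exact: dG.
- have nt0 : 0 < - t by rewrite oppr_gt0.
  have := c1 _ (Gs (- t)^-1 q Gq) => /=.
  rewrite -(ler_pM2l nt0) mulrBr mulrA divff ?gt_eqF // mul1r.
  rewrite -[_ * rnorm _](@rnormZr _ k) ?(ltW nt0) // scalerBr scalerA -scalar_ofM divff
      ?gt_eqF //.
  rewrite scalar_of1 scale1r scalar_ofN scaleNr opprK; lra.
- have := c2 _ (Gs t^-1 q Gq) => /=.
  rewrite -(ler_pM2l t0) mulrBr mulrA divff ?gt_eqF // mul1r.
  rewrite -[_ * rnorm _](@rnormZr _ k) ?(ltW t0) // scalerDr scalerA -scalar_ofM divff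
      ?gt_eqF //.
  rewrite scalar_of1 scale1r; lra.
Qed.

Lemma real_hahn_banach (y0 : V) : exists g : V -> R,
  [/\ forall a x y, g (a •: x + y) = a * g x + g y,
      forall x, g x <= rnorm x & g y0 = rnorm y0].
Proof.
(* [Zorn_bigcup] also tests the empty chain, whose union is the empty graph; the last clause admits
   it, and maximality against the line through [y0] then rules it out. *)
pose P (G : set (V * R)) := [/\ graph_linear G, graph_dominated G &
  G !=set0 -> G (y0, rnorm y0)].
have [|A [[lA dA nA] Amax]] := @Zorn_bigcup _ P.
  move=> F FP tot; split.
  - move=> a p q [S FS Sp] [T FT Tq].
    have [ST|TS] := tot S T FS FT.
      by exists T => //; have [lT _ _] := FP _ FT; apply: lT => //; exact: ST.
    by exists S => //; have [lS _ _] := FP _ FS; apply: lS => //; exact: TS.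
  - by move=> p [S FS Sp]; have [_ dS _] := FP _ FS; exact: dS.
  - move=> [p [S FS Sp]]; exists S => //; have [_ _ nS] := FP _ FS.
    by apply: nS; exists p.
have Ane : A !=set0.
  apply/set0P/negP => /eqP A0.
  pose G0 := [set p : V * R | exists a, p = (a •: y0, a * rnorm y0)].
  have G0y : G0 (y0, rnorm y0) by exists 1; rewrite scalar_of1 scale1r mul1r.
  apply: (Amax G0).
    by rewrite A0; split; [move=> p|move=> /(_ _ G0y)].
  split=> //.
  - move=> a _ _ [b ->] [c ->]; exists (a * b + c) => /=.
    by rewrite scalar_ofD scalar_ofM scalerDl scalerA mulrDl mulrA.
  - by move=> _ [a ->] /=; rewrite rnormZ rnorm_scalar_of ler_wpM2r ?rnorm_ge0 // ler_norm.
have A0 : A (0, 0).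
  have [q0 Aq0] := Ane; have := lA (-1) q0 q0 Aq0 Aq0.
  by rewrite scalar_ofN scalar_of1 scaleN1r addNr mulN1r addNr.
have tot x : exists r, A (x, r).
  apply: contrapT => nx; have [c [lG dG]] := graph_extend x Ane lA dA.
  set G := (X in graph_linear X) in lG dG.
  have AG : A `<=` G.
    move=> [y r] Ay; exists (y, r), 0; split=> //=.
    by rewrite scalar_of0 scale0r mul0r !addr0.
  have Gx : G (x, c).
    by exists (0, 0), 1; split=> //=; rewrite scalar_of1 scale1r mul1r !add0r.
  apply: (Amax G).
    by split=> // GA; apply: nx; exists c; exact: GA.
  by split=> // _; exact/AG/nA.
have uniq x r s : A (x, r) -> A (x, s) -> r <= s.
  move=> Ar As; have := dA _ (lA (-1) _ _ As Ar) => /=.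
  by rewrite scalar_ofN scalar_of1 scaleN1r addNr rnorm0 mulN1r addrC subr_le0.
pose g x := sval (cid (tot x)); have gP x := svalP (cid (tot x)) : A (x, g x).
have gE x r : A (x, r) -> g x = r.
  by move=> Ar; apply/le_anti/andP; split; [exact: uniq (gP x) Ar|exact: uniq Ar (gP x)].
exists g; split=> [a x y|x|].
- by apply: gE; exact: (lA a (x, g x) (y, g y)).
- exact: dA (gP x).
- by apply: gE; exact: nA.
Qed.

End hahn_banach.

(** In the complex case [f x = g x - i * g (i *: x)]. *)
Lemma linear_of_Re (R : realType) (k : scalars) (V : normedModType (scalar_field R k))
    (g : V -> R) : (forall a x y, g (scalar_of k a *: x + y) = a * g x + g y) ->
  exists f : V -> (scalar_field R k)^o, linear f /\ forall x, scalar_Re (f x) = g x.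
Proof.
case: k V g => V g gl; first by exists g.
have gZ a x : g (a%:C%C *: x) = a * g x.
  have g0 : g 0 = 0.
    by have := gl 1 0 0; rewrite [scalar_of _ _]scalar_of1 scale1r addr0 mul1r => /eqP;
        rewrite -subr_eq0 opprD addrA subrr sub0r oppr_eq0 => /eqP.
  by have := gl a x 0; rewrite !addr0 g0 addr0.
have gD x y : g (x + y) = g x + g y.
  by have := gl 1 x y; rewrite [scalar_of _ _]scalar_of1 scale1r mul1r.
pose i : R[i] := (0 +i* 1)%C.
exists (fun x => (g x +i* (- g (i *: x)))%C); split=> //.
move=> [a b] x y.
have E1 : (a +i* b)%C *: x = a%:C%C *: x + b%:C%C *: (i *: x).
  rewrite scalerA -scalerDl; congr (_ *: _).
  by apply/eqP; rewrite eq_complex /= !mulr0 !mul0r !mulr1 subrr !addr0 add0r !eqxx.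
have E2 : i *: ((a +i* b)%C *: x) = a%:C%C *: (i *: x) + (- b)%:C%C *: x.
  rewrite !scalerA -scalerDl; congr (_ *: _).
  by apply/eqP; rewrite eq_complex /= !mulr0 !mul0r !mulr1 !mul1r; apply/andP; split;
      apply/eqP; ring.
rewrite scalerDr !gD E2 E1 !gD !gZ.
apply/eqP; rewrite eq_complex /=; apply/andP; split; apply/eqP; simpl; ring.
Qed.

Section norming.
Variables (R : realType) (k : scalars).
Local Notation K := (scalar_field R k).
Variable V : normedModType K.

Lemma hahn_banach_norming (y0 : V) : exists f : dual_space V,
  rnorm f <= 1 /\ f y0 = scalar_of k (rnorm y0).
Proof.
have [g [gl gb gy]] := real_hahn_banach y0.
have [f [fl fg]] := linear_of_Re gl.
have fZ a x : f (a *: x) = a * f x.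
  have f0 : f 0 = 0.
    have := fl 1 0 0; rewrite !scale1r addr0 => /eqP.
    by rewrite -subr_eq0 opprD addrA subrr sub0r oppr_eq0 => /eqP.
  by have := fl a x 0; rewrite !addr0 f0 addr0.
have fb x : rnorm (f x) <= 1 * rnorm x.
  (* Rotating by the phase [c] makes the value real, so the bound on [g] applies. *)
  have [c [c1 cf]] := scalar_phase (f x).
  rewrite mul1r -[leLHS](scalar_ofK k) -cf -fZ fg; apply: le_trans (gb _) _.
  by rewrite rnormZ c1 mul1r.
have fB : f \in @bounded_op R k V K^o by apply/asboolP; split=> //; exists 1.
have [c [c1 cf]] := scalar_phase (f y0).
exists (c *: (Bop fB : dual_space V)); split.
  rewrite rnormZ c1 mul1r; apply: dual_rnorm_le => x x1.
  by apply: le_trans (fb x) _; rewrite mul1r.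
apply: (etrans cf); congr (scalar_of _ _); apply/le_anti/andP; split.
  by have := fb y0; rewrite mul1r.
rewrite -gy -fg; apply: le_trans (ler_norm _) _; exact: scalar_Re_le.
Qed.

End norming.

(* If [h] nearly minimises the distance from [H] to [l], the functional [l - h]
   separates [l] from [H]. *)
Lemma finite_separation (R : realType) n (H : set ('I_n -> R)) (l : 'I_n -> R) (rho : R) :
  H !=set0 -> (exists D, forall h i, H h -> `|h i| <= D) ->
  (forall h h' t, 0 <= t <= 1 -> H h -> H h' -> H (fun i => t * h' i + (1 - t) * h i)) ->
  0 < rho ->
  (forall (a : 'I_n -> R) M, (forall h, H h -> \sum_i a i * h i <= M) -> \sum_i a i * l
      i <= M) ->
  exists2 h, H h & forall i, `|h i - l i| <= rho.
Proof.
move=> [h0 Hh0] [D HD] cH rho0 dom.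
pose N (h : 'I_n -> R) := \sum_i (h i - l i) ^+ 2.
have N0 h : 0 <= N h by apply: sumr_ge0 => i _; exact: sqr_ge0.
pose m := inf [set N h | h in H].
have lbN : has_lbound [set N h | h in H] by exists 0 => _ [h _ <-].
have mN h : H h -> m <= N h by move=> Hh; apply: ge_inf => //; exists h.
suff [h Hh Nh] : exists2 h, H h & N h <= rho ^+ 2.
  exists h => // i; rewrite -ler_sqr ?nnegrE ?(ltW rho0) // real_normK ?num_real //.
  by apply: le_trans Nh; rewrite /N (bigD1 i) //= lerDl; apply: sumr_ge0 => j _; exact:
      sqr_ge0.
apply: contrapT => nN.
have m0 : rho ^+ 2 <= m.
  apply: lb_le_inf; first by exists (N h0), h0.
  by move=> _ [h Hh <-]; rewrite leNgt; apply/negP => /ltW lt; apply: nN; exists h.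
have rho2 : 0 < rho ^+ 2 by rewrite exprn_gt0.
pose B := n%:R * (2 * D) ^+ 2 + 1.
have D0 h (i : 'I_n) : H h -> 0 <= D by move=> Hh; apply: (le_trans (normr_ge0 (h i)));
    exact: HD.
have B0 : 0 < B by rewrite ltr_wpDl // mulr_ge0 // sqr_ge0.
(* Step length from [h] towards [h']: as [|h' - h| ^ 2 <= B], the quadratic term is at most
   [t * m / 2]. *)
pose t := Num.min 1 (m / (2 * B)).
have mgt0 : 0 < m by exact: lt_le_trans m0.
have t0 : 0 < t by rewrite lt_min ltr01 divr_gt0 // mulr_gt0.
have t1 : t <= 1 by rewrite ge_min lexx.
have tB : t * B <= m / 2.
  apply: le_trans (_ : m / (2 * B) * B <= _).
    by rewrite ler_wpM2r ?(ltW B0) // ge_min lexx orbT.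
  by rewrite invfM mulrA divfK // gt_eqF.
have tm : 0 < t * m / 2 by rewrite divr_gt0 // mulr_gt0.
have [_ [h Hh <-] hN] : exists2 y, [set N h | h in H] y & y < m + t * m / 2.
  have hi : has_inf [set N h | h in H] by split=> //; exists (N h0), h0.
  exact: inf_adherent tm hi.
have hdiff h' : H h' -> \sum_i (h' i - h i) ^+ 2 <= B.
  move=> Hh'; apply: le_trans (_ : \sum_(i < n) (2 * D) ^+ 2 <= _); last first.
    by rewrite sumr_const card_ord /B -[_ *+ n]mulr_natl lerDl.
  apply: ler_sum => i _; have d0 := D0 h i Hh.
  rewrite -[leLHS]real_normK ?num_real // ler_sqr ?nnegrE ?mulr_ge0 //.
  apply: le_trans (ler_normB _ _) _; rewrite mulr_natl mulr2n.
  by rewrite lerD ?HD.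
have key h' : H h' -> \sum_i (l i - h i) * h' i <= \sum_i (l i - h i) * h i + (m / 2).
  move=> Hh'.
  have := mN _ (cH h h' t ltac:(by rewrite (ltW t0) t1) Hh Hh').
  have -> : N (fun i => t * h' i + (1 - t) * h i) =
      N h + (- (2 * t)) * \sum_i (l i - h i) * (h' i - h i) + t ^+ 2 * \sum_i (h' i - h
          i) ^+ 2.
    rewrite /N !mulr_sumr -!big_split /=; apply: eq_bigr => i _; ring.
  have -> : \sum_i (l i - h i) * (h' i - h i) = \sum_i (l i - h i) * h' i - \sum_i (l i
      - h i) * h i.
    by rewrite -sumrB; apply: eq_bigr => i _; rewrite mulrBr.
  move: (hdiff h' Hh'); set q := \sum_i (_ - _) ^+ 2; set u := _ - _; move=> qB.
  have q0 : 0 <= q by apply: sumr_ge0 => i _; exact: sqr_ge0.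
  move=> h1; have h2 : 2 * t * u <= t * m / 2 + t * (t * B).
    have : t ^+ 2 * q <= t * (t * B).
      by rewrite mulrA -expr2 ler_wpM2l // sqr_ge0.
    move: h1 hN; lra.
  have h3 : t * (t * B) <= t * (m / 2) by rewrite ler_wpM2l // ltW.
  have h4 : t * (2 * u) <= t * m.
    move: h2 h3; rewrite !mulrA; lra.
  have : 2 * u <= m by rewrite -(ler_pM2l t0).
  rewrite /u; lra.
(* With coefficients [l - h] the domination gives [N h <= m / 2], against [m <= N h]. *)
have := dom _ _ key.
have : N h = \sum_i (l i - h i) * l i - \sum_i (l i - h i) * h i.
  by rewrite -sumrB; apply: eq_bigr => i _; ring.
have := mN h Hh; lra.
Qed.

(** * Functionals on the injective tensor product *)

Section tensor_functionals.
Variables (R : realType) (k : scalars).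
Local Notation K := (scalar_field R k).
Variables (X0 X1 : normedModType K).
Local Notation W0 := (weakstar X0).
Local Notation W1 := (weakstar X1).
Local Notation WT := (weakstar (injtens X0 X1)).

Lemma tfun_subproof (f : dual_space X0) (g : dual_space X1) :
  (fun u : injtens X0 X1 => f ((u : bop (dual_space X1) X0) g))
    \in @bounded_op R k (injtens X0 X1) K^o.
Proof.
apply/asboolP; split=> [a u v|].
  by rewrite -[(a *: u + v : injtens X0 X1) : bop _ _]/(a *: injtens_val u +
      injtens_val v) linearP.
exists (rnorm f * rnorm g) => u; apply: le_trans (ler_dual f _) _.
rewrite -mulrA ler_wpM2l ?rnorm_ge0 // rnorm_injtens mulrC.
exact: ler_opnorm.
Qed.

Definition tfun (f : dual_space X0) (g : dual_space X1) : dual_space (injtens X0 X1) :=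
  Bop (tfun_subproof f g).

Lemma tfunE f g (u : injtens X0 X1) : tfun f g u = f ((u : bop (dual_space X1) X0) g).
Proof. by []. Qed.

Lemma rnorm_tfun f g : rnorm (tfun f g) <= rnorm f * rnorm g.
Proof.
apply: dual_rnorm_le => u u1; rewrite tfunE; apply: le_trans (ler_dual f _) _.
rewrite ler_wpM2l ?rnorm_ge0 //; apply: le_trans (ler_opnorm _ _) _.
by rewrite -rnorm_injtens ler_piMl // rnorm_ge0.
Qed.

Lemma tfun_diff f f' g g' : tfun f g - tfun f' g' = tfun (f - f') g + tfun f' (g - g').
Proof.
apply/val_inj/funext => u.
rewrite [LHS]/(f ((u : bop _ _) g) - f' ((u : bop _ _) g')).
rewrite [RHS]/((f ((u : bop _ _) g) - f' ((u : bop _ _) g)) + f' ((u : bop _ _) (g - g'))).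
have E (a b c : K^o) : a - c = (a - b) + (b - c) by rewrite subrKA.
by rewrite !linearB; exact: E.
Qed.

Lemma tfun_close f f' g g' (D a : R) : rnorm g <= D -> rnorm f' <= D -> 0 <= D ->
  rnorm (f - f') <= a -> rnorm (g - g') <= a ->
  rnorm (tfun f g - tfun f' g') <= 2 * D * a.
Proof.
move=> gD fD D0 ff gg; rewrite tfun_diff; apply: le_trans (rnormD _ _) _.
rewrite -mulrA [2 * _]mulr_natl mulr2n lerD //; apply: le_trans (rnorm_tfun _ _) _.
  by rewrite mulrC ler_pM ?rnorm_ge0.
by rewrite ler_pM ?rnorm_ge0.
Qed.

Lemma cvg_tens_span (v : bop (dual_space X1) X0) (T : Type) (F : set_system T)
    (h0 : T -> W0) (h1 : T -> W1) (f : W0) (g : W1) :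
  tens_span v -> Filter F -> h0 @ F --> f -> h1 @ F --> g ->
  (fun t => (h0 t : dual_space X0) (v (h1 t : dual_space X1)) : K^o) @ F -->
    ((f : dual_space X0) (v (g : dual_space X1)) : K^o).
Proof.
move=> [s ->] FF hf hg.
pose c (p : K * (X0 * X1)) (f : W0) (g : W1) : K^o :=
  p.1 *: (((g : dual_space X1) p.2.2 : K) *: ((f : dual_space X0) p.2.1 : K^o)).
have E (f' : W0) (g' : W1) : (f' : dual_space X0) ((\sum_(p <- s) p.1 *: tens p.2.1
    p.2.2) (g' : dual_space X1)) =
    \sum_(p <- s) c p f' g'.
  elim: s => [|p s IH].
    by rewrite !big_nil [X in _ X]/0 linear0.
  rewrite !big_cons -IH; set w := \sum_(_ <- _) _.
  rewrite -[(p.1 *: tens _ _ + w) _]/(p.1 *: ((g' : dual_space X1) p.2.2 *: p.2.1) + w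
      (g' : dual_space X1)).
  by rewrite linearD !linearZ.
under eq_fun do rewrite E.
rewrite E; elim: s {E} => [|p s IH].
  by rewrite big_nil; under eq_fun do rewrite big_nil; exact: cvg_cst.
rewrite big_cons (_ : (fun t => _) = (fun t => c p (h0 t) (h1 t)) \+
    (fun t => \sum_(p <- s) c p (h0 t) (h1 t))); last first.
  by apply/funext => t; rewrite big_cons.
apply: cvgD IH.
by apply: cvgZl_tmp; apply: cvgZ; by apply: cvg_eval.
Qed.

Definition tfun_pair (p : (W0 * W1)%type) : WT := tfun p.1 p.2.

(** Approximation of [u] by an element of [tens_span] is uniform over the bounded set [A], and on
    [tens_span] the pairing is a finite sum of products of evaluations. *)
Lemma tfun_pair_continuous (A : set (W0 * W1)%type) (D : R) :
  (forall p, A p -> rnorm (p.1 : dual_space X0) <= D /\ rnorm (p.2 : dual_space X1) <= D) ->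
  forall a V, A a -> nbhs (tfun_pair a) V -> nbhs a (fun p => A p -> V (tfun_pair p)).
Proof.
move=> AD a V Aa /weakstar_nbhs[s [e [e0 HV]]].
suff H : forall u : injtens X0 X1, nbhs a (fun p => A p -> rnorm ((tfun p.1 p.2 :
    dual_space _) u - (tfun a.1 a.2) u) <= e).
  have : nbhs a (fun p => forall u, u \in s -> A p -> rnorm ((tfun p.1 p.2 : dual_space
      _) u - (tfun a.1 a.2) u) <= e).
    elim: s {HV} => [|u s IH].
      by apply: filterS (@filterT _ (nbhs a) _) => p _ u; rewrite in_nil.
    apply: filterS (filterI (H u) IH) => p [pu ps] v.
    by rewrite inE => /predU1P[->|/ps].
  by apply: filterS => p hp Ap; apply: HV => u us; exact: hp.
move=> u; have [aD0 aD1] := AD a Aa.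
have D0 : 0 <= D by exact: le_trans (rnorm_ge0 _) aD0.
pose tau := e / 3 / (D * D + 1).
have p0 : 0 < D * D + 1 by rewrite ltr_wpDl // mulr_ge0.
have tau0 : 0 < tau by rewrite !divr_gt0.
have /in_injtensP/(_ tau tau0)[v sv uv] := injtens_valP u.
have apx (p : (W0 * W1)%type) : A p ->
    rnorm ((tfun p.1 p.2 : dual_space _) u - (p.1 : dual_space X0) (v (p.2 : dual_space
        X1))) <= e / 3.
  move=> /AD[pD0 pD1].
  have -> : (tfun p.1 p.2 : dual_space _) u - (p.1 : dual_space X0) (v (p.2 :
      dual_space X1)) =
      (p.1 : dual_space X0) ((injtens_val u - v) (p.2 : dual_space X1)).
    rewrite tfunE -[(injtens_val u - v) _]/(injtens_val u (p.2 : dual_space X1) - v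
        (p.2 : dual_space X1)).
    by rewrite linearB.
  apply: le_trans (ler_dual _ _) _.
  apply: le_trans (_ : D * (tau * D) <= _).
    apply: ler_pM; rewrite ?rnorm_ge0 //; apply: le_trans (ler_opnorm _ _) _.
    by rewrite ler_pM ?opnorm_ge0 ?rnorm_ge0 // -rnorm_bop ltW.
  rewrite mulrCA /tau; apply: le_trans (_ : e / 3 / (D * D + 1) * (D * D + 1) <= _).
    by rewrite ler_wpM2l ?lerDl // !divr_ge0 ?ltW.
  by rewrite divfK // gt_eqF.
have e3 : 0 < e / 3 by rewrite divr_gt0.
have : (fun p : (W0 * W1)%type => (p.1 : dual_space X0) (v (p.2 : dual_space X1)) :
    K^o) @ nbhs a -->
    ((a.1 : dual_space X0) (v (a.2 : dual_space X1)) : K^o).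
  by apply: (@cvg_tens_span v _ (nbhs a) fst snd) => //; [exact: cvg_fst|exact: cvg_snd].
move=> /cvg_rnormP/(_ _ e3); apply: filterS => p hp Ap.
have h1 := apx p Ap; have h2 := apx a Aa; rewrite rnormC in h2.
apply: le_trans (rnorm_triangle ((p.1 : dual_space X0) (v (p.2 : dual_space X1))) _ _) _.
apply: le_trans (lerD h1 (rnorm_triangle ((a.1 : dual_space X0) (v (a.2 : dual_space
    X1))) _ _)) _.
by move: hp h2; lra.
Qed.

End tensor_functionals.

(** * Images of dual balls under adjoints *)

Section adjoint_balls.
Variables (R : realType) (k : scalars).
Local Notation K := (scalar_field R k).

Lemma cvg_adjoint (X Y : normedModType K) (A : bop X Y) (T : Type) (F : set_system T)
    (h : T -> weakstar Y) (f : weakstar Y) : Filter F -> h @ F --> f ->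
  (fun t => adjoint A (h t) : weakstar X) @ F --> (adjoint A f : weakstar X).
Proof. by move=> FF hf; apply: cvg_weakstar => x; exact: (@cvg_eval _ _ Y _ _ _ _ (A
    x)). Qed.

Lemma adjoint_continuous (X Y : normedModType K) (A : bop X Y) :
  continuous (adjoint A : weakstar Y -> weakstar X).
Proof. by move=> f; exact: (@cvg_adjoint X Y A (weakstar Y) (nbhs f) id). Qed.

Lemma adjoint_ball_compact (X Y : normedModType K) (A : bop X Y) :
  compact (adjoint_ball A : set (weakstar X)).
Proof.
apply: (@continuous_compact (weakstar Y) (weakstar X) (adjoint A)).
  by apply: continuous_subspaceT; exact: adjoint_continuous.
exact: compact_weakstar_ball.
Qed.

Lemma adjoint_ball_closed (X Y : normedModType K) (A : bop X Y) :
  closed (adjoint_ball A : set (weakstar X)).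
Proof. by apply: compact_closed; [exact: weakstar_hausdorff|exact:
    adjoint_ball_compact]. Qed.

Lemma adjoint_ball_le (X Y : normedModType K) (A : bop X Y) (f : weakstar X) :
  adjoint_ball A f -> rnorm (f : dual_space X) <= opnorm (adjoint A).
Proof. by move=> [g /= g1 <-]; exact: (@ler_opnorm_ball R k _ _ (adjoint A) g g1). Qed.

Lemma adjoint_ball_bounded (X Y : normedModType K) (A : bop X Y) :
  wbounded (adjoint_ball A : set (weakstar X)).
Proof. by exists (opnorm (adjoint A)) => f; exact: adjoint_ball_le. Qed.

Lemma adjoint_ball_sym (X Y : normedModType K) (A : bop X Y) (f : weakstar X) :
  adjoint_ball A f -> adjoint_ball A (- (f : dual_space X)).
Proof. by move=> [g /= g1 <-]; exists (- g : dual_space Y); [by rewrite /=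
    rnormN|exact: linearN]. Qed.

Lemma adjoint_ball_convex (X Y : normedModType K) (A : bop X Y) :
  wconvex (adjoint_ball A : set (weakstar X)).
Proof.
move=> t _ _ /andP[t0 t1] [f /= f1 <-] [g /= g1 <-].
exists (scalar_of k t *: f + scalar_of k (1 - t) *: g : dual_space Y); last first.
  by rewrite (linearD (adjoint A)) !linearZ.
rewrite /=; apply: le_trans (rnormD _ _) _; rewrite !rnormZr ?subr_ge0 //.
apply: le_trans (_ : t * 1 + (1 - t) * 1 <= 1); last by rewrite !mulr1 addrC subrK.
by rewrite lerD // ler_wpM2l ?subr_ge0.
Qed.

Lemma wconv_convex (X : normedModType K) (A : set (weakstar X)) (a b : weakstar X) (t : R) :
  0 <= t <= 1 -> wconv A a -> wconv A b ->
  wconv A (scalar_of k t *: (a : dual_space X) + scalar_of k (1 - t) *: (b : dual_space X)).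
Proof.
move=> /andP[t0 t1] [J [l [v [[l0 l1] Av _ ->]]]] [M [m [w [[m0 m1] Aw _ ->]]]].
have -> : scalar_of k t *: wavg l v + scalar_of k (1 - t) *: wavg m w =
    wavg (fun i : J + M => match i with inl i => t * l i | inr j => (1 - t) * m j end)
      (fun i : J + M => match i with inl i => v i | inr j => w j end).
  rewrite /wavg big_sumType /= !scaler_sumr.
  by congr (_ + _); apply: eq_bigr => i _; rewrite scalerA scalar_ofM.
apply: wconvI; last by case.
split; first by case=> i; rewrite mulr_ge0 ?subr_ge0.
by rewrite big_sumType /= -!mulr_sumr l1 m1 !mulr1 addrC subrK.
Qed.

Lemma wconv_bop (X Y : normedModType K) (T : bop (dual_space Y) (dual_space X))
    (A : set (weakstar Y)) (f : weakstar Y) : wconv A f ->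
  wconv ((T : weakstar Y -> weakstar X) @` A) (T f).
Proof.
move=> [J [l [v [pl Av _ ->]]]].
have -> : T (wavg l v) = wavg l (fun i => T (v i)).
  by rewrite /wavg linear_sum; apply: eq_bigr => i _; rewrite linearZ.
by apply: wconvI => // i; exists (v i).
Qed.

End adjoint_balls.

Section tensor_ball.
Variables (R : realType) (k : scalars).
Local Notation K := (scalar_field R k).

(** A weak* neighbourhood sees finitely many coordinates, so separation in [R ^ n] suffices. A real
    combination of coordinates is the real part of evaluation at some [v], and [|v|] is the supremum
    of [Re (f (v g))] over the two dual balls, by the operator norm and [hahn_banach_norming]. *)
Lemma injtens_ball_clconv (Y0 Y1 : normedModType K) (L : dual_space (injtens Y0 Y1)) :
  rnorm L <= 1 ->
  clconv (@tfun_pair R k Y0 Y1 @` [set p | rnorm (p.1 : dual_space Y0) <= 1 /\ rnorm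
      (p.2 : dual_space Y1) <= 1]) L.
Proof.
set B := (X in _ @` X) => L1 V /weakstar_nbhs[s [e [e0 HV]]].
have [t Ht] := rnorm_le_Re R k.
(* With [t *: u] added, real parts on [z] control the moduli on [s]. *)
pose z := s ++ [seq t *: u | u <- s].
pose n := size z; pose zi (i : 'I_n) := tnth (in_tuple z) i.
pose C := wconv (@tfun_pair R k Y0 Y1 @` B).
pose H : set ('I_n -> R) := [set h | exists2 f : weakstar (injtens Y0 Y1), C f & h =
    fun i => scalar_Re ((f : dual_space _) (zi i))].
have C1 (f : weakstar (injtens Y0 Y1)) : C f -> rnorm (f : dual_space _) <= 1.
  move=> Cf; have := @clconv_ball _ _ (injtens Y0 Y1) (@tfun_pair R k Y0 Y1 @` B) 0 1 _
      f (subset_closure Cf).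
  rewrite subr0; apply => _ [[g0 g1] [/= h0 h1] <-]; rewrite subr0.
  apply: le_trans (rnorm_tfun _ _) _; rewrite -[1]mulr1.
  by apply: ler_pM => //; exact: rnorm_ge0.
have Cpair (f : dual_space Y0) (g : dual_space Y1) : rnorm f <= 1 -> rnorm g <= 1 -> C
    (tfun f g).
  by move=> f1 g1; apply: sub_wconv; exists (f, g).
have [| | | | |h [f Cf hE] hl] := @finite_separation R n H (fun i => scalar_Re (L (zi
    i))) (e / 2).
- exists (fun i => scalar_Re ((tfun (0 : dual_space Y0) (0 : dual_space Y1)) (zi i))),
    (tfun 0 0) => //.
  by apply: Cpair; rewrite rnorm0.
- exists (\sum_i rnorm (zi i)) => _ i [f Cf ->]; apply: le_trans (scalar_Re_le _) _.
  apply: le_trans (ler_dual _ _) _; apply: le_trans (_ : 1 * rnorm (zi i) <= _).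
    by rewrite ler_wpM2r ?rnorm_ge0 // C1.
  rewrite mul1r (bigD1 i) //= lerDl; apply: sumr_ge0 => j _; exact: rnorm_ge0.
- move=> _ _ r r01 [f Cf ->] [g Cg ->].
  exists (scalar_of k r *: (g : dual_space _) + scalar_of k (1 - r) *: (f : dual_space
      _)); first exact: wconv_convex.
  apply/funext => i; rewrite -!scalar_ReM -scalar_ReD //.
- by rewrite divr_gt0.
- move=> a M HM; pose v : injtens Y0 Y1 := \sum_i scalar_of k (a i) *: zi i.
  have Rev (f : dual_space (injtens Y0 Y1)) : \sum_i a i * scalar_Re (f (zi i)) =
      scalar_Re (f v).
    rewrite /v linear_sum scalar_Re_sum; apply: eq_bigr => i _.
    by rewrite linearZ -scalar_ReM.
  rewrite Rev; apply: le_trans (ler_norm _) _; apply: le_trans (scalar_Re_le _) _.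
  apply: le_trans (ler_dual _ _) _; apply: le_trans (_ : 1 * rnorm v <= _).
    by rewrite ler_wpM2r ?rnorm_ge0.
  rewrite mul1r rnorm_injtens; apply: opnorm_le => g g1.
  have [f [f1 fv]] := hahn_banach_norming ((v : bop _ _) g).
  rewrite -[leLHS](scalar_ofK k) -fv -[f _]/(tfun f g v) -Rev; apply: HM.
  by exists (tfun f g) => //; exact: Cpair.
exists f; split=> //; apply: HV => u us.
apply: le_trans (Ht _) _; rewrite [e]splitr.
have key w : w \in z -> `|scalar_Re ((f : dual_space _) w - L w)| <= e / 2.
  move=> /(tnthP (in_tuple z))[i ->]; rewrite scalar_ReB; have := hl i; by rewrite hE.
have uz : u \in z by rewrite mem_cat us.
have tuz : t *: u \in z by rewrite mem_cat orbC map_f.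
apply: lerD; first exact: key.
have -> : t * ((f : dual_space _) u - L u) = (f : dual_space _) (t *: u) - L (t *: u).
  have lin (g : dual_space (injtens Y0 Y1)) : g (t *: u) = t * g u by exact: linearZ.
  rewrite !lin; exact: mulrBr.
exact: key.
Qed.

End tensor_ball.

Lemma compact_image_within (T U : topologicalType) (f : T -> U) (A : set T) : compact A ->
  (forall a V, A a -> nbhs (f a) V -> nbhs a (fun x => A x -> V (f x))) ->
  compact (f @` A).
Proof.
move=> cA cf F FF FA.
pose G : set_system T := [set S | exists2 B, F B & A `&` f @^-1` B `<=` S].
have GF : ProperFilter G.
  apply: Build_ProperFilter_ex => [S [B FB BS]|].
    have [y [Bx [a Aa fa]]] := filter_ex (filterI FB FA); exists a.
    by apply: BS; split=> //=; rewrite fa.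
  split; first by exists setT => //; exact: filterT.
    move=> P Q [B FB BP] [C FC CQ]; exists (B `&` C); first exact: filterI.
    by move=> x [Ax [Bx Cx]]; split; [exact: BP|exact: CQ].
  by move=> P Q PQ [B FB BP]; exists B => //; exact: subset_trans PQ.
have GA : G A by exists setT; [exact: filterT|move=> x []].
have [a [Aa cl]] := cA G GF GA.
exists (f a); split; first by exists a.
move=> B V FB Va.
have [|x [[Ax Bx] Vx]] := cl (A `&` f @^-1` B) _ _ (cf a V Aa Va).
  by exists B.
by exists (f x); split=> //; exact: Vx.
Qed.

(** * Summability for products of functionals *)

Section tensor_summability.
Variables (R : realType) (k : scalars).
Local Notation K := (scalar_field R k).

Lemma dits_scale (T : topologicalType) (rho : R -> T -> T -> Prop) (c : R -> R) xi s A :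
  dits (fun e => rho (c e)) xi s A = dits rho xi (map c s) A.
Proof. by elim: s => [//|e s IH] /=; rewrite IH. Qed.

Lemma sum_powR_scale (c q : R) (s : seq R) : 0 < c -> all (fun e => 0 < e) s ->
  \sum_(e <- s) e `^ q = c `^ q * \sum_(e <- map (fun e => e / c) s) e `^ q.
Proof.
move=> c0 s0; rewrite big_map mulr_sumr big_seq [RHS]big_seq; apply: eq_bigr => e es.
by rewrite mulrC -powRM ?divfK ?gt_eqF // ?(ltW c0) // divr_ge0 ?(ltW c0) // ltW //
    (allP s0).
Qed.

(** An adjoint is weak* continuous and Lipschitz with constant [c], so derived sets of the image
    lift to [L'] with radii divided by [c]; the [+ 1] keeps [c] positive. *)
Lemma qsum_adjoint (X Y : normedModType K) (T : bop X Y) (L : set (weakstar X))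
    (L' : set (weakstar Y)) xi q : closed L' -> wbounded L' ->
  L `<=` (adjoint T : weakstar Y -> weakstar X) @` L' ->
  qsum xi q L' -> qsum xi q L.
Proof.
move=> cL bL LL [M HM]; pose c := opnorm (adjoint T) + 1.
have c0 : 0 < c by rewrite ltr_wpDl // opnorm_ge0.
exists (c `^ q * M) => s s0 [x xs].
rewrite (sum_powR_scale q c0 s0) ler_wpM2l ?powR_ge0 //; apply: HM.
  by apply/allP => _ /mapP[e es ->]; rewrite divr_gt0 // (allP s0).
have sub : dits nrel xi s ((adjoint T : weakstar Y -> weakstar X) @` L') `<=`
    (adjoint T : weakstar Y -> weakstar X) @` dits (fun e => nrel (e / c)) xi s L'.
  apply: dits_image => //; [exact: weakstar_hausdorff|exact: wbounded_compact| |].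
    move=> a V _ Va; have : nbhs a ((adjoint T : weakstar Y -> weakstar X) @^-1` V).
      exact: (@adjoint_continuous _ _ X Y T a V Va).
    by apply: filterS => ? ?.
  move=> e a b _ _ _; rewrite /nrel -linearB => h.
  apply: le_trans (ler_opnorm _ _) _; rewrite mulrC.
  move: h; rewrite ler_pdivlMr //; apply: le_trans.
  by rewrite ler_wpM2l ?rnorm_ge0 // lerDl.
have [y ys _] := sub x (dits_mono LL xs).
by exists y; rewrite -dits_scale.
Qed.

Variables (X0 X1 : normedModType K) (L0 : set (weakstar X0)) (L1 : set (weakstar X1)).
Hypotheses (cL0 : closed L0) (bL0 : wbounded L0) (cL1 : closed L1) (bL1 : wbounded L1).

Let A : set (weakstar X0 * weakstar X1)%type := L0 `*` L1.

Definition tfun_image : set (weakstar (injtens X0 X1)) := @tfun_pair R k X0 X1 @` A.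

Let cA : compact A.
Proof. by apply: compact_setX; exact: wbounded_compact. Qed.

Let clA : closed A.
Proof.
rewrite (_ : A = fst @^-1` L0 `&` snd @^-1` L1) //; apply: closedI.
  by apply: closed_comp => // p _; exact: cvg_fst.
by apply: closed_comp => // p _; exact: cvg_snd.
Qed.

Let boundA : exists2 D : R, 0 < D & forall p, A p ->
  rnorm (p.1 : dual_space X0) <= D /\ rnorm (p.2 : dual_space X1) <= D.
Proof.
have [D0 H0] := bL0; have [D1 H1] := bL1.
exists (Num.max (Num.max D0 D1) 1); first by rewrite lt_max ltr01 orbT.
move=> p [p0 p1]; split; rewrite !le_max; first by rewrite H0.
by rewrite [X in _ || X || _]H1 ?orbT.
Qed.

Lemma tfun_image_closed : closed tfun_image.
Proof.
have [D _ HD] := boundA; apply: compact_closed; first exact: weakstar_hausdorff.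
by apply: compact_image_within => // a V; exact: (tfun_pair_continuous HD).
Qed.

Lemma tfun_image_bounded : wbounded tfun_image.
Proof.
have [D D0 HD] := boundA; exists (D * D) => _ [p Ap <-].
have [h0 h1] := HD p Ap; apply: le_trans (rnorm_tfun _ _) _.
by rewrite ler_pM ?rnorm_ge0.
Qed.

(** On bounded sets [tfun_pair] is Lipschitz with constant [2 * D], so derivations lift to the
    product. There closeness is a conjunction over the two factors, and [ditsI] splits the list. *)
Lemma dits_tfun_image : exists2 c : R, 0 < c & forall xi s f,
  dits nrel xi s tfun_image f -> exists s0 s1,
    [/\ perm_eq (s0 ++ s1) s, dits nrel xi (map (fun e => e / c) s0) L0 !=set0 &
        dits nrel xi (map (fun e => e / c) s1) L1 !=set0].
Proof.
have [D D0 HD] := boundA; pose c := 2 * D; have c0 : 0 < c by rewrite mulr_gt0.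
exists c => // xi s f fs.
pose rho0 (e : R) (p p' : (weakstar X0 * weakstar X1)%type) := nrel (e / c) p.1 p'.1.
pose rho1 (e : R) (p p' : (weakstar X0 * weakstar X1)%type) := nrel (e / c) p.2 p'.2.
have sub : dits nrel xi s tfun_image `<=`
    @tfun_pair R k X0 X1 @` dits (fun e p p' => rho0 e p p' /\ rho1 e p p') xi s A.
  apply: dits_image => //; first exact: weakstar_hausdorff.
    by move=> a V; exact: (tfun_pair_continuous HD).
  move=> e a b _ Aa Ab [h0 h1]; have [_ a1] := HD a Aa; have [b0 _] := HD b Ab.
  have := tfun_close a1 b0 (ltW D0) h0 h1.
  by rewrite -/c mulrC divfK // gt_eqF.
have [p ps _] := sub f fs.
have [s0 [s1 [pe p0 p1]]] := ditsI clA ps.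
exists s0, s1; split=> //.
  exists p.1; rewrite -dits_scale.
  apply: (@dits_preimage R _ _ fst (fun e => nrel (e / c)) xi s0 A L0) p0; last by
      move=> ? [].
  by move=> ?; exact: cvg_fst.
exists p.2; rewrite -dits_scale.
apply: (@dits_preimage R _ _ snd (fun e => nrel (e / c)) xi s1 A L1) p1; last by move=>
    ? [].
by move=> ?; exact: cvg_snd.
Qed.

Lemma tfun_image_qsum xi q : qsum xi q L0 -> qsum xi q L1 -> qsum xi q tfun_image.
Proof.
move=> [M0 H0] [M1 H1]; have [c c0 Hc] := dits_tfun_image.
exists (c `^ q * (M0 + M1)) => s sp [f /Hc[s0 [s1 [pe ne0 ne1]]]].
rewrite (sum_powR_scale q c0 sp) ler_wpM2l ?powR_ge0 //.
have pe' : perm_eq (map (fun e => e / c) s) (map (fun e => e / c) s0 ++ map (fun e => e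
    / c) s1).
  by rewrite -map_cat perm_sym perm_map.
have pos e : e \in map (fun e => e / c) s -> 0 < e.
  by move=> /mapP[e' es ->]; rewrite divr_gt0 // (allP sp).
rewrite (perm_big _ pe') big_cat /= lerD //; [apply: H0 => //|apply: H1 => //].
  by apply/allP => e es; apply: pos; rewrite (perm_mem pe') mem_cat es.
by apply/allP => e es; apply: pos; rewrite (perm_mem pe') mem_cat es orbT.
Qed.

Lemma tfun_image_empty xi : (forall e, 0 < e -> dit (nrel e) (oexpw xi) L0 = set0) ->
  (forall e, 0 < e -> dit (nrel e) (oexpw xi) L1 = set0) ->
  forall e, 0 < e -> dit (nrel e) (oexpw xi) tfun_image = set0.
Proof.
move=> H0 H1 e e0; have [c c0 Hc] := dits_tfun_image.
have ec : 0 < e / c by rewrite divr_gt0.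
(* The one-element list falls to one of the factors. *)
rewrite -subset0 => f fe; have [s0 [s1 [pe ne0 ne1]]] := Hc xi [:: e] f fe.
have : size (s0 ++ s1) = 1%N by rewrite (perm_size pe).
have : {subset s0 ++ s1 <= [:: e]} by move=> d; rewrite (perm_mem pe).
case: s0 {pe} ne0 => [|d s0] ne0 sub sz.
  case: s1 ne1 sub sz => [//|d s1] [g gs] sub _.
  have de : d = e by apply/eqP; have := sub d; rewrite !inE eqxx => /(_ isT).
  have : dit (nrel (e / c)) (oexpw xi) L1 g.
    by rewrite -de; apply: dit_mono gs; exact: dits_sub.
  by rewrite H1.
have [g gs] := ne0.
have de : d = e by apply/eqP; have := sub d; rewrite !inE eqxx => /(_ isT).
have : dit (nrel (e / c)) (oexpw xi) L0 g.
  by rewrite -de; apply: dit_mono gs; exact: dits_sub.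
by rewrite H0.
Qed.

End tensor_summability.

(** * The induced operator *)

Section tensor_operators.
Variables (R : realType) (k : scalars).
Local Notation K := (scalar_field R k).
Variables (X0 X1 Y0 Y1 : normedModType K) (A0 : bop X0 Y0) (A1 : bop X1 Y1).
Implicit Types (xi : ord) (q : R).

Lemma adjoint_tensop_tfun (f : dual_space Y0) (g : dual_space Y1) :
  adjoint (tensop A0 A1) (tfun f g) = tfun (adjoint A0 f) (adjoint A1 g).
Proof. by apply/val_inj/funext => u. Qed.

(** The adjoint of [tensop A0 A1] is linear and weak* continuous, so it carries the closed hull of
    the functionals [tfun f g] into that of their images. *)
Lemma tensop_ball_clconv :
  (adjoint_ball (tensop A0 A1) : set (weakstar (injtens X0 X1))) `<=`
  clconv (tfun_image (adjoint_ball A0 : set (weakstar X0)) (adjoint_ball A1)).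
Proof.
move=> _ [L /= L1 <-] V VL.
have VL' := @adjoint_continuous _ _ _ _ (tensop A0 A1) L V VL.
have [f [Cf Vf]] := injtens_ball_clconv L1 VL'.
exists (adjoint (tensop A0 A1) f); split=> //.
have := wconv_bop (adjoint (tensop A0 A1)) Cf.
move=> [J [l [v [pl Av h e]]]]; exists J, l, v; split=> // i.
have [_ [[g0 g1] [/= h0 h1] <-] <-] := Av i.
exists (adjoint A0 g0 : weakstar X0, adjoint A1 g1 : weakstar X1).
  by split; [exists g0|exists g1].
exact: (esym (adjoint_tensop_tfun g0 g1)).
Qed.

Let K0 : set (weakstar X0) := adjoint_ball A0.
Let K1 : set (weakstar X1) := adjoint_ball A1.
Let KT : set (weakstar (injtens X0 X1)) := adjoint_ball (tensop A0 A1).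

Lemma tensop_qsum xi q : 1 <= q -> qsum xi q K0 -> qsum xi q K1 -> qsum xi q KT.
Proof.
move=> q1 h0 h1.
have [M HM] : qsum xi q (clconv (tfun_image K0 K1)).
  apply: qsum_clconv => //; [apply: tfun_image_closed|apply: tfun_image_bounded|apply:
      tfun_image_qsum] => //;
  by [exact: adjoint_ball_closed|exact: adjoint_ball_bounded].
exists M => s s0 [x xs]; apply: HM => //; exists x.
by apply: dits_mono xs; exact: tensop_ball_clconv.
Qed.

Lemma tensop_empty xi : (forall e, 0 < e -> dit (nrel e) (oexpw xi) K0 = set0) ->
  (forall e, 0 < e -> dit (nrel e) (oexpw xi) K1 = set0) ->
  forall e, 0 < e -> dit (nrel e) (oexpw xi) KT = set0.
Proof.
move=> h0 h1 e e0; have e2 : 0 < e / 2 by rewrite divr_gt0.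
have P : dit (nrel (e / 2 + e / 2)) (oexpw xi) (clconv (tfun_image K0 K1)) = set0.
  apply: conv_stable_all => //; first exact: ltW.
  - by apply: tfun_image_closed; by [exact: adjoint_ball_closed|exact:
      adjoint_ball_bounded].
  - by apply: tfun_image_bounded; exact: adjoint_ball_bounded.
  - by apply: tfun_image_empty => //; by [exact: adjoint_ball_closed|exact:
      adjoint_ball_bounded].
rewrite -splitr in P; rewrite -subset0 -P; apply: dit_mono.
exact: tensop_ball_clconv.
Qed.

Lemma empty_qsum (X : normedModType K) xi q (L : set (weakstar X)) :
  (forall e, 0 < e -> dit (nrel e) (oexpw xi) L = set0) -> qsum xi q L.
Proof.
move=> H; exists 0 => -[|e s] /=; first by rewrite big_nil.
move=> /andP[e0 _] [x xs]; have : dit (nrel e) (oexpw xi) L x.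
  by apply: dit_mono xs; exact: dits_sub.
by rewrite H.
Qed.

Lemma p_index_le_ge0 (X : normedModType K) xi (L : set (weakstar X)) (r : R) : 0 <= r ->
  closed L -> wbounded L -> (forall q, r < q -> qsum xi q L) -> (p_index xi L <= r%:E)%E.
Proof.
move=> r0 cL bL H; apply/lee_addgt0Pr => d d0; rewrite -EFinD.
have rd : r < r + d by rewrite ltrDl.
by apply: qsum_p_index => //; [exact: le_lt_trans rd|exact: H].
Qed.

(** If the maximum [r] is at least 1, every [q > r] is admissible in [tensop_qsum]. If [r < 1], both
    factors lose everything after [omega ^ xi] derivations, and [tensop_empty] passes this on. *)
Lemma tensop_p_index xi : (p_index xi KT <= maxe (p_index xi K0) (p_index xi K1))%E.
Proof.
have cT : closed KT by exact: adjoint_ball_closed.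
have bT : wbounded KT by exact: adjoint_ball_bounded.
have small (X Y : normedModType K) (A : bop X Y) : (p_index xi (adjoint_ball A) < 1)%E ->
    forall e, 0 < e -> dit (nrel e) (oexpw xi) (adjoint_ball A : set (weakstar X)) = set0.
  move=> lt1.
  have [q [q0 q1 pq]] : exists q : R, [/\ 0 < q, q < 1 & (p_index xi (adjoint_ball A) <
      q%:E)%E].
    move: lt1 (p_index_ge0 xi (adjoint_ball A)); case: (p_index _ _) => [r| |].
    - rewrite lte_fin lee_fin => r1 r0; exists ((r + 1) / 2); rewrite lte_fin.
      by split; lra.
    - by rewrite ltNge leey.
    - by move=> _; rewrite leNgt ltNyr.
  apply: (@qsum_lt1 _ _ _ xi q); first by rewrite q0.
  - exact: adjoint_ball_convex.
  - by move=> a; exact: adjoint_ball_sym.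
  - by apply: p_index_qsum => //; [exact: adjoint_ball_closed|exact: adjoint_ball_bounded].
have := p_index_ge0 xi K0; have := p_index_ge0 xi K1.
case E : (maxe _ _) => [r| |] p1 p0; last 2 first.
- exact: leey.
- have : (p_index xi K0 <= -oo)%E by rewrite -E le_max lexx.
  by rewrite leNgt (lt_le_trans _ p0) // ltNyr.
have hK0 : (p_index xi K0 <= r%:E)%E by rewrite -E le_max lexx.
have hK1 : (p_index xi K1 <= r%:E)%E by rewrite -E le_max lexx orbT.
have r0 : 0 <= r by rewrite -lee_fin; exact: le_trans hK0.
have [r1|r1] := ltP r 1.
  apply: le_trans (_ : 0 <= _)%E; last by rewrite lee_fin.
  apply: p_index_le_ge0 => // q _; apply: empty_qsum; apply: tensop_empty; apply: small.
    by apply: le_lt_trans hK0 _; rewrite lte_fin.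
  by apply: le_lt_trans hK1 _; rewrite lte_fin.
apply: p_index_le_ge0 => // q rq; have q0 : 0 < q by exact: le_lt_trans rq.
apply: tensop_qsum; first exact: le_trans (ltW rq).
  apply: p_index_qsum => //; [exact: adjoint_ball_closed|exact: adjoint_ball_bounded|].
  by apply: le_lt_trans hK0 _; rewrite lte_fin.
apply: p_index_qsum => //; [exact: adjoint_ball_closed|exact: adjoint_ball_bounded|].
by apply: le_lt_trans hK1 _; rewrite lte_fin.
Qed.

Lemma nonzero_norming (X Y : normedModType K) (A : bop X Y) : A != 0 ->
  exists (x : X) (f : dual_space Y), rnorm f <= 1 /\ f (A x) = 1.
Proof.
move=> An0; have [x Ax] : exists x, A x != 0.
  apply: contrapT => n; move/eqP: An0; apply; apply/val_inj/funext => x.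
  by apply/eqP; apply: contrapT => h; apply: n; exists x; exact/negP.
have n0 : 0 < rnorm (A x).
  by rewrite lt_neqAle rnorm_ge0 andbT eq_sym; apply: contra_neq Ax; exact: rnorm_eq0.
have [f [f1 fA]] := hahn_banach_norming (A x).
exists (scalar_of k (rnorm (A x))^-1 *: x), f; split=> //.
transitivity (scalar_of k (rnorm (A x))^-1 * f (A x)); first by rewrite !linearZ.
by rewrite fA -scalar_ofM mulVf ?gt_eqF // scalar_of1.
Qed.

Lemma tens_injtens (x : X0) (y : X1) : tens x y \in @in_injtens R k X0 X1.
Proof.
apply/in_injtensP => e e0; exists (tens x y); last by rewrite subrr rnorm0.
by exists [:: (1, (x, y))]; rewrite big_seq1 scale1r.
Qed.

Lemma tensl_subproof (y : X1) :
  (fun x => Injtens (tens_injtens x y)) \in @bounded_op R k X0 (injtens X0 X1).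
Proof.
apply/asboolP; split=> [a x x'|].
  apply/val_inj/val_inj/funext => f.
  have E (b c : K) (u v : X0) : b *: (c *: u + v) = c *: (b *: u) + b *: v.
    by rewrite scalerDr !scalerA mulrC.
  exact: E.
exists (rnorm y) => x; rewrite rnorm_injtens; apply: opnorm_le => f f1.
rewrite [X in rnorm X]/(f y *: x) rnormZ ler_wpM2r ?rnorm_ge0 //.
by apply: le_trans (ler_dual f y) _; rewrite ler_piMl // rnorm_ge0.
Qed.

Lemma tensr_subproof (x : X0) :
  (fun y => Injtens (tens_injtens x y)) \in @bounded_op R k X1 (injtens X0 X1).
Proof.
apply/asboolP; split=> [a y y'|].
  apply/val_inj/val_inj/funext => f.
  have E (b c d : K) (u : X0) : (c * b + d) *: u = c *: (b *: u) + d *: u.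
    by rewrite scalerDl scalerA.
  by apply: etrans (E _ _ _ _); congr (_ *: _); exact: linearP.
exists (rnorm x) => y; rewrite rnorm_injtens; apply: opnorm_le => f f1.
rewrite [X in rnorm X]/(f y *: x) rnormZ mulrC ler_wpM2l ?rnorm_ge0 //.
by apply: le_trans (ler_dual f y) _; rewrite ler_piMl // rnorm_ge0.
Qed.

Definition tensl y : bop X0 (injtens X0 X1) := Bop (tensl_subproof y).
Definition tensr x : bop X1 (injtens X0 X1) := Bop (tensr_subproof x).

Lemma tfun_ball (f : dual_space Y0) (g : dual_space Y1) : rnorm f <= 1 -> rnorm g <= 1 ->
  KT (adjoint (tensop A0 A1) (tfun f g)).
Proof.
move=> f1 g1; exists (tfun f g) => //=; apply: le_trans (rnorm_tfun _ _) _.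
by rewrite -[1]mulr1; apply: ler_pM => //; exact: rnorm_ge0.
Qed.

(** Restricted along [tensl x1], the adjoint image of [tfun f g] is [g (A1 x1) * f (A0 x)]; the
    normalisation [g (A1 x1) = 1] makes this [adjoint A0 f]. *)
Lemma qsum_tensopl xi q : A1 != 0 -> qsum xi q KT -> qsum xi q K0.
Proof.
move=> /nonzero_norming[x1 [g [g1 gx]]]; apply: (@qsum_adjoint _ _ _ _ (tensl x1)).
- exact: adjoint_ball_closed.
- exact: adjoint_ball_bounded.
move=> _ [f /= f1 <-]; exists (adjoint (tensop A0 A1) (tfun f g)); first exact: tfun_ball.
apply/val_inj/funext => x.
transitivity (g (A1 x1) * f (A0 x)); last by rewrite gx mul1r.
have E (c : K) : f (A0 (c *: x)) = c * f (A0 x) by rewrite !linearZ.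
exact: E.
Qed.

Lemma qsum_tensopr xi q : A0 != 0 -> qsum xi q KT -> qsum xi q K1.
Proof.
move=> /nonzero_norming[x0 [f [f1 fx]]]; apply: (@qsum_adjoint _ _ _ _ (tensr x0)).
- exact: adjoint_ball_closed.
- exact: adjoint_ball_bounded.
move=> _ [g /= g1 <-]; exists (adjoint (tensop A0 A1) (tfun f g)); first exact: tfun_ball.
apply/val_inj/funext => x.
transitivity (g (A1 x) * f (A0 x0)); last by rewrite fx mulr1.
have E (c : K) : f (A0 (c *: x0)) = c * f (A0 x0) by rewrite !linearZ.
exact: E.
Qed.

(** An index below [q] on [L'] gives summability there, hence on [L], hence an index at most [q]. *)
Lemma p_index_le (X Y : normedModType K) xi (L : set (weakstar X)) (L' : set (weakstar Y)) :
  closed L -> wbounded L -> closed L' -> wbounded L' ->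
  (forall q, qsum xi q L' -> qsum xi q L) -> (p_index xi L <= p_index xi L')%E.
Proof.
move=> cL bL cL' bL' H; have := p_index_ge0 xi L'.
case E : (p_index xi L') => [r| |] p0; last 2 first.
- exact: leey.
- by move: p0; rewrite leNgt ltNyr.
rewrite lee_fin in p0; apply: p_index_le_ge0 => // q rq; apply: H.
by apply: p_index_qsum => //; [exact: le_lt_trans rq|rewrite E lte_fin].
Qed.

End tensor_operators.

Theorem theorem1p4 (R : realType) (k : scalars) (q : R) (xi : ord)
    (X0 X1 Y0 Y1 : completeNormedModType (scalar_field R k))
    (A0 : bop X0 Y0) (A1 : bop X1 Y1) :
  1 <= q ->
  [/\ op_q_summable xi q A0 -> op_q_summable xi q A1 ->
        op_q_summable xi q (tensop A0 A1),
      (op_p_index xi (tensop A0 A1) <=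
         maxe (op_p_index xi A0) (op_p_index xi A1))%E
    & A0 != 0 -> A1 != 0 ->
        (op_q_summable xi q (tensop A0 A1) <->
           op_q_summable xi q A0 /\ op_q_summable xi q A1) /\
        op_p_index xi (tensop A0 A1) =
          maxe (op_p_index xi A0) (op_p_index xi A1)].
Proof.
move=> q1; have q0 : 0 < q by exact: lt_le_trans q1.
have sum : op_q_summable xi q A0 -> op_q_summable xi q A1 ->
    op_q_summable xi q (tensop A0 A1).
  move=> /q_summable_qsum h0 /q_summable_qsum h1.
  by apply: qsum_q_summable => //; exact: tensop_qsum.
have le := tensop_p_index A0 A1 xi.
split=> // A0n A1n; split.
  split=> [/q_summable_qsum h|[h0 h1]]; last exact: sum.
  split; apply: qsum_q_summable => //; first exact: qsum_tensopl h.
  exact: qsum_tensopr h.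
apply/le_anti/andP; split=> //; rewrite ge_max; apply/andP.
split; apply: p_index_le; do ?[exact: adjoint_ball_closed|exact: adjoint_ball_bounded].
  by move=> r; exact: qsum_tensopl.
by move=> r; exact: qsum_tensopr.
Qed.
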